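(* Let $\overline{\,\cdot\,}$ be a continuous antilinear involution on $V$. Then the Gel'fand transformation $$\widehat{\,\cdot\,}:\big(\mathcal{S}^\bullet(V)^{\mathrm{cpl}},\vee,{}^*\big)\to\mathscr{C}^{\omega_{HS}}(V'_h),\qquad X\mapsto\widehat X,\quad \widehat X(\rho)=\delta_\rho(X),$$ is an isomorphism of unital $^*$-algebras.
   Context: $V$ is a complex Hausdorff locally convex space whose topology is given by its continuous Hilbert seminorms: let $\mathcal{I}_V$ be the set of continuous positive Hermitian forms $\langle\cdot\,|\,\cdot\rangle_\alpha$ on $V$ (sesquilinear, antilinear in the first argument, Hermitian, positive semi-definite), put $\|v\|_\alpha:=\sqrt{\langle v|v\rangle_\alpha}$, and let $\mathcal{P}_V$ be the set of all these seminorms; it is assumed that $\mathcal{P}_V$ is cofinal in the set of all continuous seminorms on $V$. Let $\mathcal{T}^k_{\mathrm{alg}}(V)$ be the algebraic $k$-th tensor power ($\mathcal{T}^0_{\mathrm{alg}}(V)=\mathbb{C}$), $\mathcal{T}^\bullet_{\mathrm{alg}}(V)=\bigoplus_{k\ge 0}\mathcal{T}^k_{\mathrm{alg}}(V)$, and $\langle X\rangle_k$ the degree-$k$ component of $X$. Each $\langle\cdot|\cdot\rangle_\alpha\in\mathcal{I}_V$ is extended to a positive Hermitian form $\langle X|Y\rangle_\alpha^\bullet:=\sum_{k}\langle\langle X\rangle_k|\langle Y\rangle_k\rangle_\alpha^\bullet$ on $\mathcal{T}^\bullet_{\mathrm{alg}}(V)$, where $\langle x_1\otimes\cdots\otimes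 x_k|y_1\otimes\cdots\otimes y_k\rangle_\alpha^\bullet:=k!\prod_{m=1}^k\langle x_m|y_m\rangle_\alpha$; set $\|X\|_\alpha^\bullet:=\sqrt{\langle X|X\rangle_\alpha^\bullet}$. $\mathcal{T}^\bullet(V)$ is $\mathcal{T}^\bullet_{\mathrm{alg}}(V)$ with the locally convex topology defined by all seminorms $\|\cdot\|_\alpha^\bullet$, $\|\cdot\|_\alpha\in\mathcal{P}_V$. Let $\mathrm{Sym}^\bullet$ be the symmetrisation operator, $\mathrm{Sym}^\bullet(x_1\otimes\cdots\otimes x_k)=\frac1{k!}\sum_{\sigma\in\mathfrak{S}_k}x_{\sigma(1)}\otimes\cdots\otimes x_{\sigma(k)}$, and let $\mathcal{S}^\bullet(V)$ be its image with the subspace topology; $\mathcal{S}^\bullet(V)^{\mathrm{cpl}}$ is its completion. $X\vee Y:=\mathrm{Sym}^\bullet(X\otimes Y)$, and $^*$ is the antilinear map $(x_1\otimes\cdots\otimes x_k)^*:=\overline{x_k}\otimes\cdots\otimes\overline{x_1}$ (complex conjugation on scalars). These operations are continuous and, like all continuous maps below, are extended to completions by continuity. $V_h:=\{v\in V:\overline v=v\}$; $V'$ is the topological dual of $V$ and $V'_h:=\{\rho\in V':\overline{\rho(v)}=\rho(\overline v)\ \forall v\in V\}$; $\mathcal{I}_{V,h}:=\{\langle\cdot|\cdot\rangle_\alpha\in\mathcal{I}_V:\overline{\langle v|w\rangle_\alpha}=\langle\overline v|\overline w\rangle_\alpha\ \forall v,w\in V\}$. A subset $B\subseteq V'_h$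 is bounded if there is $\langle\cdot|\cdot\rangle_\alpha\in\mathcal{I}_{V,h}$ with $|\rho(v)|\le\|v\|_\alpha$ for all $v\in V$, $\rho\in B$; (multi)linear maps are bounded if they map bounded sets to bounded sets. For $\rho\in V'_h$: $D_\rho(x_1\otimes\cdots\otimes x_k):=k\rho(x_k)\,x_1\otimes\cdots\otimes x_{k-1}$ (zero on scalars), $\tau^*_\rho:=\sum_{t\ge0}\frac1{t!}(D_\rho)^t$, and $\delta_\rho:=\langle\cdot\rangle_0\circ\tau^*_\rho$ with values in $\mathbb{C}$; these are continuous. (On $\mathcal{S}^\bullet(V)$, $\delta_\rho$ is the unital algebra homomorphism with $\delta_\rho(v)=\rho(v)$ for $v\in V$.) For $f:V'_h\to\mathbb{C}$ let $(\widehat D_\rho f)(\sigma):=\frac{d}{dt}\big|_{t=0}f(\sigma+t\rho)$ and $\widehat D^{(k)}_{(\rho_1,\dots,\rho_k)}f:=\widehat D_{\rho_1}\cdots\widehat D_{\rho_k}f$ ($\widehat D^{(0)}f:=f$), if they exist. $f$ is smooth if all iterated directional derivatives exist everywhere and $(V'_h)^k\ni\rho\mapsto(\widehat D^{(k)}_\rho f)(\sigma)\in\mathbb{C}$ is a bounded symmetric multilinear form for all $k\in\mathbb{N}_0$ and $\sigma\in V'_h$. For $\langle\cdot|\cdot\rangle_\alpha\in\mathcal{I}_{V,h}$ let $V^{\mathrm{cpl}}_{h,\alpha}$ be the real Hilbert space obtained by completing $V_h/\{v\in V_h:\|v\|_\alpha=0\}$ with respect to $\langle\cdot|\cdot\rangle_\alpha$,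 and for $v\in V^{\mathrm{cpl}}_{h,\alpha}$ let $v^{\flat_\alpha}\in V'_h$ be $v^{\flat_\alpha}(w):=\langle v|w\rangle_\alpha$, $w\in V$. A function $f:V'_h\to\mathbb{C}$ is analytic of Hilbert-Schmidt type if it is smooth and for all $\sigma,\sigma'\in V'_h$ and all $\langle\cdot|\cdot\rangle_\alpha\in\mathcal{I}_{V,h}$ there is $C_{\sigma,\sigma',\alpha}\in\mathbb{R}$ such that $$\sum_{k=0}^\infty\frac1{k!}\sum_{i\in I^k}\Big|\big(\widehat D^{(k)}_{(e_{i_1}^{\flat_\alpha},\dots,e_{i_k}^{\flat_\alpha})}f\big)(\xi)\Big|^2\le C_{\sigma,\sigma',\alpha}$$ for one Hilbert basis $e\in(V^{\mathrm{cpl}}_{h,\alpha})^I$ of $V^{\mathrm{cpl}}_{h,\alpha}$ (the condition does not depend on the choice) and every $\xi=\lambda\sigma+(1-\lambda)\sigma'$, $\lambda\in[0,1]$. $\mathscr{C}^{\omega_{HS}}(V'_h)$ is the set of all such functions, with pointwise operations and complex conjugation as $^*$-involution. *)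

(* Defs.v *)
From HB Require Import structures.
From mathcomp Require Import all_boot all_order all_algebra.
From mathcomp Require Import generic_quotient ring_quotient perm.
From mathcomp Require Import freeg complex.
From mathcomp Require Import all_classical all_reals all_analysis.

Set Implicit Arguments.
Unset Strict Implicit.
Unset Printing Implicit Defensive.

Import Order.TTheory GRing.Theory Num.Theory.
Import numFieldNormedType.Exports Normc.

Local Open Scope classical_set_scope.
Local Open Scope ring_scope.
Local Open Scope complex_scope.
Local Open Scope quotient_scope.

(* A family, indexed by k, of k-linear maps is represented by one function on
   finite words: its restriction to the words of length k is the k-linear map. *)
Definition multilinear (K : fieldType) (U W : lmodType K) (f : seq U -> W) :=
  forall (u v : seq U) (a : K) (x y : U),
    f (u ++ (a *: x + y) :: v) = a *: f (u ++ x :: v) + f (u ++ y :: v).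

(* The direct sum of the algebraic tensor powers of V: the free vector space
   on all finite words in V (the word [:: x1; ..; xk] standing for the tensor
   x1 (x) .. (x) xk), modulo the multilinearity relations. *)
Section TensorAlgebra.
Variables (K : fieldType) (V : lmodType K).

Local Notation word := (seq V).
Local Notation free := {freeg word / K}.

Inductive tensor_relator : free -> Prop :=
  TensorRelator (u v : word) (a : K) (x y : V) :
    tensor_relator (<< u ++ (a *: x + y) :: v >> - a *: << u ++ x :: v >>
                    - << u ++ y :: v >>).

(* The subspace spanned by the relators. *)
Definition tensor_null (X : free) : Prop :=
  forall P : free -> Prop, P 0 ->
    (forall a Y Z, P Y -> P Z -> P (a *: Y + Z)) ->
    (forall Y, tensor_relator Y -> P Y) -> P X.

Definition tensor_nullb : {pred free} := fun X => `[< tensor_null X >].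

Lemma tensor_null_lin a X Y :
  tensor_null X -> tensor_null Y -> tensor_null (a *: X + Y).
Proof.
by move=> nX nY P P0 Plin Prel; apply: (Plin); [apply: nX|apply: nY].
Qed.

Fact tensor_nullb_zmod : zmod_closed tensor_nullb.
Proof.
split=> [|X Y]; first by apply/asboolP.
move=> /asboolP nX /asboolP nY; apply/asboolP.
by rewrite addrC -scaleN1r; exact: tensor_null_lin.
Qed.
HB.instance Definition _ :=
  GRing.isZmodClosed.Build free tensor_nullb tensor_nullb_zmod.

Definition tensor_alg : Type := Quotient.quot tensor_nullb.
HB.instance Definition _ := GRing.Zmodule.on tensor_alg.
HB.instance Definition _ := Choice.on tensor_alg.

Definition tclass (X : free) : tensor_alg := \pi_(Quotient.quot tensor_nullb) X.
Definition trepr (X : tensor_alg) : free := repr X.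

Lemma tclassP X Y : tclass X = tclass Y <-> tensor_null (X - Y).
Proof.
split=> [/eqP|n]; last apply/eqP.
  by rewrite /tclass -Quotient.idealrBE => /asboolP.
by rewrite /tclass -Quotient.idealrBE; apply/asboolP.
Qed.

Lemma treprK X : tclass (trepr X) = X.
Proof. exact: reprK. Qed.

Lemma tclassD X Y : tclass (X + Y) = tclass X + tclass Y.
Proof. by rewrite /tclass !piE. Qed.

Definition tscale (a : K) (X : tensor_alg) : tensor_alg :=
  tclass (a *: trepr X).

Lemma tclassZ a X : tclass (a *: X) = tscale a (tclass X).
Proof.
apply/tclassP; rewrite -scalerBr -[X in tensor_null X]addr0.
apply: tensor_null_lin; last by [].
by apply/tclassP; rewrite treprK.
Qed.

Fact tscaleA a b X : tscale a (tscale b X) = tscale (a * b) X.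
Proof. by rewrite -[X]treprK -!tclassZ scalerA. Qed.
Fact tscale1 : left_id 1 tscale.
Proof. by move=> X; rewrite -[X]treprK -!tclassZ scale1r. Qed.
Fact tscaleDr : right_distributive tscale +%R.
Proof.
move=> a X Y; rewrite -[X]treprK -[Y]treprK -tclassD.
by rewrite -!tclassZ -tclassD scalerDr.
Qed.
Fact tscaleDl X : {morph tscale^~ X : a b / a + b}.
Proof. by move=> a b; rewrite -[X]treprK -!tclassZ -tclassD scalerDl. Qed.

HB.instance Definition _ := GRing.Zmodule_isLmodule.Build K tensor_alg
  tscaleA tscale1 tscaleDr tscaleDl.

Lemma tclassZE a X : tclass (a *: X) = a *: tclass X.
Proof. exact: tclassZ. Qed.

Definition tpure (w : word) : tensor_alg := tclass << w >>.

Lemma tpure_multilinear : multilinear tpure.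
Proof.
move=> u v a x y; rewrite /tpure -tclassZE -tclassD; apply/tclassP.
by move=> P _ _; apply; rewrite opprD addrA; constructor.
Qed.

(* The linear extension of a map f given on elementary tensors; this is
   independent of the choice of representatives when f is multilinear
   (tlift_linear, tlift_pure). *)
Definition tlift (W : lmodType K) (f : word -> W) (X : tensor_alg) : W :=
  fglift f (trepr X).

Section Lift.
Variables (W : lmodType K) (f : word -> W).

HB.instance Definition _ :=
  GRing.isZmodMorphism.Build free W (fglift f) (lift_is_additive f).

Lemma fgliftE X : fglift f X = \sum_(w <- dom X) coeff w X *: f w.
Proof.
rewrite -[in LHS](freeg_sumE X) raddf_sum; apply: eq_bigr => w _.
by rewrite /= liftU.
Qed.

Lemma fgliftZ a X : fglift f (a *: X) = a *: fglift f X.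
Proof.
rewrite -[_ *: X]/(\sum_(w <- dom X) << a * coeff w X *g w >>) raddf_sum.
rewrite fgliftE scaler_sumr; apply: eq_bigr => w _.
by rewrite /= liftU scalerA.
Qed.

Hypothesis f_multi : multilinear f.

Lemma fglift_null X : tensor_null X -> fglift f X = 0.
Proof.
move/(_ (fun X => fglift f X = 0)); apply=> [|a Y Z Y0 Z0|_ [u v a x y]].
- exact: raddf0.
- by rewrite raddfD /= fgliftZ Y0 Z0 scaler0 addr0.
- by rewrite !raddfB /= fgliftZ !liftU !scale1r f_multi -addrA -opprD subrr.
Qed.

Lemma tlift_class X : tlift f (tclass X) = fglift f X.
Proof.
apply/eqP; rewrite -subr_eq0 -raddfB; apply/eqP; apply: fglift_null.
by apply/tclassP; rewrite treprK.
Qed.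

Lemma tlift_pure w : tlift f (tpure w) = f w.
Proof. by rewrite tlift_class liftU scale1r. Qed.

Lemma tlift_linear : linear (tlift f).
Proof.
move=> a X Y; rewrite -[X]treprK -[Y]treprK -tclassZE -tclassD.
by rewrite !tlift_class raddfD /= fgliftZ.
Qed.

End Lift.

(* x1 (x) .. (x) xk |-> x_(s 1) (x) .. (x) x_(s k), averaged over 'S_k *)
Definition sym_word (w : word) : tensor_alg :=
  ((size w)`!%:R)^-1 *: \sum_(s : 'S_(size w))
    tpure [seq nth 0 w (s i) | i <- enum 'I_(size w)].

Lemma sym_word_multilinear : multilinear sym_word.
Proof.
move=> u v a x y; rewrite /sym_word.
pose k := (size u + (size v).+1)%N.
have sz z : size (u ++ z :: v) = k by rewrite size_cat.
rewrite !sz scalerA mulrC -scalerA -scalerDr; congr (_ *: _).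
rewrite scaler_sumr -big_split; apply: eq_bigr => s _ /=.
have uk : (size u < k)%N by rewrite /k addnS ltnS leq_addr.
pose j := (s^-1)%g (Ordinal uk).
pose g z (i : 'I_k) := nth 0 (u ++ z :: v) (s i).
have gj z : g z j = z.
  by rewrite /g /j permKV /= nth_cat ltnn subnn.
have gNj z i : i != j -> g z i = g 0 i.
  move=> ij; rewrite /g !nth_cat; case: ltnP => // ui.
  have : (s i : nat) != size u.
    apply: contraNneq ij => siu; apply/eqP; rewrite /j -(permK s i).
    by congr (_ _); apply: val_inj.
  by move: ui; rewrite leq_eqVlt eq_sym => /orP[/eqP->|]; rewrite ?eqxx// -subn_gt0;
     case: (_ - _)%N.
have split_enum z : [seq g z i | i <- enum 'I_k] =
    [seq g 0 i | i <- take j (enum 'I_k)] ++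
    z :: [seq g 0 i | i <- drop j.+1 (enum 'I_k)].
  have jE : (j < size (enum 'I_k))%N by rewrite size_enum_ord.
  rewrite -{1}(cat_take_drop j (enum 'I_k)) (drop_nth j jE) nth_ord_enum.
  rewrite map_cat /= gj; have := enum_uniq 'I_k.
  rewrite -{1}(cat_take_drop j (enum 'I_k)) (drop_nth j jE) nth_ord_enum.
  rewrite cat_uniq /= negb_or => /and3P[_ /andP[jt _] /andP[jd _]].
  congr (_ ++ _ :: _); apply/eq_in_map => i iE; apply: gNj.
    by apply: (contraNneq _ jt) => ij; rewrite -{1}ij.
  by apply: (contraNneq _ jd) => ij; rewrite -{1}ij.
by rewrite !split_enum tpure_multilinear.
Qed.

Definition Sym : tensor_alg -> tensor_alg := tlift sym_word.

Definition sym_tensors : {pred tensor_alg} := fun X => `[< range Sym X >].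

Fact sym_tensors_submod : submod_closed sym_tensors.
Proof.
have SymL : linear Sym by apply: tlift_linear; exact: sym_word_multilinear.
split=> [|a _ _ /asboolP[X _ <-] /asboolP[Y _ <-]]; apply/asboolP.
  by exists (0 - 0) => //; rewrite -scaleN1r addrC SymL scaleN1r addNr.
by exists (a *: X + Y) => //; rewrite SymL.
Qed.
HB.instance Definition _ :=
  GRing.isSubmodClosed.Build K tensor_alg sym_tensors sym_tensors_submod.

Record sym_alg := SymAlg {
  sym_val :> tensor_alg; _ : sym_val \in sym_tensors }.
HB.instance Definition _ := [isSub for sym_val].
HB.instance Definition _ := [Choice of sym_alg by <:].
HB.instance Definition _ := [SubChoice_isSubLmodule of sym_alg by <:].

Fact Sym_in (X : tensor_alg) : Sym X \in sym_tensors.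
Proof. by apply/asboolP; exists X. Qed.
Definition symmetrise (X : tensor_alg) : sym_alg := SymAlg (Sym_in X).

Definition tmul (X Y : tensor_alg) : tensor_alg :=
  tlift (fun u => tlift (fun v => tpure (u ++ v)) Y) X.

Definition vee (X Y : sym_alg) : sym_alg := symmetrise (tmul X Y).

Definition sym_one : sym_alg := symmetrise (tpure [::]).

Lemma sym_one_val : sym_one = tpure [::] :> tensor_alg.
Proof.
rewrite /= /Sym tlift_pure; last exact: sym_word_multilinear.
rewrite /sym_word /= fact0 invr1 scale1r.
rewrite (eq_bigr (fun=> tpure [::])) => [|s _]; last first.
  by rewrite (size0nil (size_enum_ord 0)).
by rewrite sumr_const card_Sn.
Qed.

End TensorAlgebra.

Arguments sym_alg {K} V.
Arguments tensor_alg {K} V.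
Arguments sym_one {K V}.

Section LocallyConvex.
Variables (R : realType) (V : tvsType R[i]).

(* R[i]^o is R[i] with its usual topology. *)
Local Notation C := (R[i]^o).
Local Notation form := (V -> V -> R[i]).

Record is_seminorm (p : V -> R) : Prop := {
  seminorm_ge0 : forall v, 0 <= p v;
  seminormD : forall v w, p (v + w) <= p v + p w;
  seminormZ : forall c v, p (c *: v) = normc c * p v }.

(* The set I_V of continuous positive Hermitian forms. *)
Record cont_pos_herm (a : form) : Prop := {
  form_linr : forall u c v w, a u (c *: v + w) = c * a u v + a u w;
  form_linl : forall u c v w, a (c *: v + w) u = c^* * a v u + a w u;
  form_herm : forall v w, a w v = (a v w)^*;
  form_pos : forall v, 0 <= a v v;
  form_cont : continuous (fun p : V * V => a p.1 p.2 : C) }.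

Definition form_norm (a : form) (v : V) : R := Num.sqrt (complex.Re (a v v)).

(* P_V is cofinal in the set of continuous seminorms. *)
Definition hilbert_seminorms_cofinal : Prop :=
  forall p : V -> R, is_seminorm p -> continuous p ->
    exists2 a, cont_pos_herm a & forall v, p v <= form_norm a v.

Record cont_antilinear_involution (bar : V -> V) : Prop := {
  bar_antilinear : forall c v w, bar (c *: v + w) = c^* *: bar v + bar w;
  barK : involutive bar;
  bar_cont : continuous bar }.

End LocallyConvex.

(* The complex conjugate of a complex vector space W: a linear map into
   conj_space W is an antilinear map into W. *)
Section ConjSpace.
Variables (R : realType) (W : lmodType R[i]).

Definition conj_space : Type := W.
HB.instance Definition _ := GRing.Zmodule.on conj_space.

Definition conj_scale (c : R[i]) (w : conj_space) : conj_space :=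
  c^* *: (w : W).

Fact conj_scaleA a b w : conj_scale a (conj_scale b w) = conj_scale (a * b) w.
Proof. by rewrite /conj_scale scalerA -rmorphM. Qed.
Fact conj_scale1 : left_id 1 conj_scale.
Proof. by move=> w; rewrite /conj_scale rmorph1 scale1r. Qed.
Fact conj_scaleDr : right_distributive conj_scale +%R.
Proof. by move=> c v w; rewrite /conj_scale scalerDr. Qed.
Fact conj_scaleDl w : {morph conj_scale^~ w : a b / a + b}.
Proof. by move=> a b; rewrite /conj_scale rmorphD scalerDl. Qed.

HB.instance Definition _ := GRing.Zmodule_isLmodule.Build R[i] conj_space
  conj_scaleA conj_scale1 conj_scaleDr conj_scaleDl.

End ConjSpace.

Section TopologicalTensorAlgebra.
Variables (R : realType) (V : tvsType R[i]) (bar : V -> V).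

Local Notation C := (R[i]^o).
Local Notation form := (V -> V -> R[i]).

(* <x1 (x) .. (x) xk | y1 (x) .. (x) yl> = k! <x1|y1> .. <xk|yk> if k = l,
   and 0 otherwise, the homogeneous components being orthogonal. *)
Definition word_form (a : form) (x y : seq V) : R[i] :=
  if size x == size y
  then (size x)`!%:R * \prod_(p <- zip x y) a p.1 p.2 else 0.

(* antilinear extension in the first argument, linear in the second *)
Definition tensor_form (a : form) (X Y : tensor_alg V) : R[i] :=
  tlift (fun x => tlift (fun y => word_form a x y : C) Y : conj_space C) X.

Definition tensor_norm (a : form) (X : tensor_alg V) : R :=
  Num.sqrt (complex.Re (tensor_form a X X)).

(* Neighbourhoods of 0 for the locally convex topology on S(V) defined by the
   restrictions of the seminorms tensor_norm a, a in I_V. *)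
Definition sym_nbhs0 : set_system (sym_alg V) :=
  [set A | exists n (a : 'I_n -> form) (eps : R),
    [/\ forall i, cont_pos_herm (a i), 0 < eps &
        [set X : sym_alg V | forall i, tensor_norm (a i) X < eps] `<=` A]].

Definition tensor_star (X : tensor_alg V) : tensor_alg V :=
  tlift (fun x => tpure (rev (map bar x)) : conj_space (tensor_alg V)) X.

(* tensor_star maps S(V) to itself, so that the default 0 is not used. *)
Definition sym_star (X : sym_alg V) : sym_alg V :=
  insubd (0 : sym_alg V) (tensor_star X).

Definition degree0 (X : tensor_alg V) : R[i] :=
  tlift (fun x => (x == [::])%:R : C) X.

Definition Dword (rho : V -> R[i]) (x : seq V) : tensor_alg V :=
  if x is x0 :: x' then
    ((size x)%:R * rho (last x0 x')) *: tpure (belast x0 x')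
  else 0.
Definition D (rho : V -> R[i]) : tensor_alg V -> tensor_alg V :=
  tlift (Dword rho).

(* The sum over t is finite, D lowering the degree by one. *)
Definition tau_star (rho : V -> R[i]) (X : tensor_alg V) : tensor_alg V :=
  \sum_(t \in [set: nat]) (t`!%:R)^-1 *: iter t (D rho) X.

Definition delta (rho : V -> R[i]) (X : tensor_alg V) : R[i] :=
  degree0 (tau_star rho X).

End TopologicalTensorAlgebra.

Arguments sym_nbhs0 {R V}.

(* The uniform structure of a tvsType is not required to be
   translation invariant, so Cauchy filters are defined from differences. *)
Section Completion.
Variables (R : realType).

Definition tvs_cauchy (W : tvsType R[i]) (F : set_system W) : Prop :=
  forall U, nbhs (0 : W) U ->
    exists2 A, F A & forall x y, A x -> A y -> U (x - y).

Definition tvs_complete (W : tvsType R[i]) : Prop :=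
  forall F : set_system W, ProperFilter F -> tvs_cauchy F ->
    exists x : W, F --> x.

(* iota : S -> W is a Hausdorff completion of the vector space S equipped with
   the vector space topology having nbhs0 as filter of neighbourhoods of 0. *)
Record is_completion (S : lmodType R[i]) (nbhs0 : set_system S)
    (W : tvsType R[i]) (iota : S -> W) : Prop := {
  completion_hausdorff : hausdorff_space W;
  completion_complete : tvs_complete W;
  completion_linear : linear iota;
  completion_dense : dense (range iota);
  completion_initial : forall A,
    nbhs0 A <-> exists2 B, nbhs (0 : W) B & iota @^-1` B `<=` A }.

Definition tvs_lim (W : tvsType R[i]) (F : set_system W) : W :=
  xget 0 [set x : W | F --> x].

Section Extension.
Variables (S : lmodType R[i]) (W : tvsType R[i]) (iota : S -> W).

(* the trace on S of the neighbourhood filter of X *)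
Definition trace_nbhs (X : W) : set_system S :=
  filter_from (nbhs X) (fun B => iota @^-1` B).

(* extension by continuity along iota *)
Definition extend (Z : tvsType R[i]) (f : S -> Z) (X : W) : Z :=
  tvs_lim (f x @[x --> trace_nbhs X]).

Definition extend2 (Z : tvsType R[i]) (f : S -> S -> Z) (X Y : W) : Z :=
  tvs_lim (f p.1 p.2 @[p --> filter_prod (trace_nbhs X) (trace_nbhs Y)]).

End Extension.
End Completion.

Section RealDual.
Variables (R : realType) (V : tvsType R[i]) (bar : V -> V).

Local Notation C := (R[i]^o).
Local Notation form := (V -> V -> R[i]).

(* Rcomplex R is R[i] as a real vector space: V'_h is a real vector space. *)
Record is_real_dual (rho : V -> R[i]) : Prop := {
  dual_linear : forall c v w, rho (c *: v + w) = c * rho v + rho w;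
  dual_cont : continuous (rho : V -> C);
  dual_real : forall v, (rho v)^* = rho (bar v) }.

Definition real_dual_pred : {pred V -> Rcomplex R} :=
  fun rho => `[< is_real_dual rho >].

Fact real_dual_submod : submod_closed real_dual_pred.
Proof.
have scaleE (t : R) (z : Rcomplex R) : t *: z = (t%:C : R[i]) * z.
  by case: z => x y /=; simpc.
split=> [|t f g /asboolP[fL fc fR] /asboolP[gL gc gR]]; apply/asboolP; split.
- by move=> c v w; rewrite /= mulr0 addr0.
- by move=> v; exact: (@cvg_cst C).
- by move=> v; rewrite /= oppr0.
- move=> c v w; rewrite !fctE /= !scaleE fL gL.
  by rewrite !mulrDr addrACA !(mulrCA _ c).
- move=> v; rewrite (_ : (t *: f + g) = (fun x => (t%:C : C) *: (f x : C) + (g x : C))).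
    by apply: cvgD; [apply: cvgZr; exact: fc|exact: gc].
  by apply/funext => x; rewrite !fctE scaleE.
- by move=> v; rewrite !fctE !scaleE rmorphD rmorphM /= fR gR /= oppr0.
Qed.
HB.instance Definition _ := GRing.isSubmodClosed.Build R (V -> Rcomplex R)
  real_dual_pred real_dual_submod.

Record real_dual := RealDual {
  dual_fun :> V -> Rcomplex R; _ : dual_fun \in real_dual_pred }.
HB.instance Definition _ := [isSub for dual_fun].
HB.instance Definition _ := [Choice of real_dual by <:].
HB.instance Definition _ := [SubChoice_isSubLmodule of real_dual by <:].

(* The set I_{V,h}. *)
Definition real_cont_pos_herm (a : form) : Prop :=
  cont_pos_herm a /\ forall v w, (a v w)^* = a (bar v) (bar w).

Definition dual_bounded (B : set real_dual) : Prop :=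
  exists2 a, real_cont_pos_herm a &
    forall (rho : real_dual) v, B rho -> normc (rho v) <= form_norm a v.

Definition diff_quotient (rho : real_dual) (f : real_dual -> C)
    (sigma : real_dual) (t : R) : C :=
  (t%:C)^-1 * (f (sigma + t *: rho) - f sigma).

Definition dirD (rho : real_dual) (f : real_dual -> C) (sigma : real_dual) : C :=
  lim (diff_quotient rho f sigma t @[t --> (0 : R)^']).

Definition iterD (s : seq real_dual) (f : real_dual -> C) : real_dual -> C :=
  foldr dirD f s.

Record smooth (f : real_dual -> C) : Prop := {
  smooth_ex : forall s rho sigma,
    cvg (diff_quotient rho (iterD s f) sigma t @[t --> (0 : R)^']);
  smooth_sym : forall sigma s s', perm_eq s s' ->
    iterD s f sigma = iterD s' f sigma;
  smooth_multilinear : forall sigma,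
    multilinear (fun s => iterD s f sigma : Rcomplex R);
  smooth_bounded : forall sigma k (B : 'I_k -> set real_dual),
    (forall i, dual_bounded (B i)) ->
    exists M : R, forall s : k.-tuple real_dual, (forall i, B i (tnth s i)) ->
      normc (iterD s f sigma) <= M }.

(* A vector of the real Hilbert space completion of V_h / ker a is represented
   by a Cauchy sequence in V_h for the seminorm of a; two sequences represent
   the same vector when their difference tends to 0. *)
Definition hilbert_vector (a : form) (u : nat -> V) : Prop :=
  (forall n, bar (u n) = u n) /\
  forall eps : R, 0 < eps -> exists N, forall m n, (N <= m)%N -> (N <= n)%N ->
    form_norm a (u m - u n) < eps.

Definition hilbert_dot (a : form) (u v : nat -> V) : R :=
  lim (complex.Re (a (u n) (v n)) @[n --> \oo]).

Definition hilbert_norm (a : form) (u : nat -> V) : R :=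
  Num.sqrt (hilbert_dot a u u).

(* orthonormal families with dense linear span *)
Record hilbert_basis (a : form) (I : choiceType) (e : I -> nat -> V) : Prop := {
  basis_vector : forall i, hilbert_vector a (e i);
  basis_orthonormal : forall i j, hilbert_dot a (e i) (e j) = (i == j)%:R;
  basis_total : forall u, hilbert_vector a u -> forall eps : R, 0 < eps ->
    exists s : seq (R * I),
      hilbert_norm a (fun n => u n - \sum_(p <- s) p.1%:C *: e p.2 n) < eps }.

(* The functional w |-> <u|w>; it belongs to V'_h for a in I_{V,h} and u a
   hilbert_vector of a, in which case the default 0 is not used. *)
Definition flat (a : form) (u : nat -> V) : real_dual :=
  insubd (0 : real_dual)
    (fun w => lim ((a (u n) w : C) @[n --> \oo]) : Rcomplex R).

Definition analytic_HS (f : real_dual -> C) : Prop :=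
  smooth f /\
  forall (sigma sigma' : real_dual) (a : form), real_cont_pos_herm a ->
    exists (M : R) (I : choiceType) (e : I -> nat -> V),
      hilbert_basis a e /\
      forall lambda : R, 0 <= lambda <= 1 ->
        ((\sum_(0 <= k <oo) ((k`!%:R^-1)%:E *
           \esum_(i in [set: k.-tuple I])
             (normc (iterD [seq flat a (e j) | j <- i] f
                (lambda *: sigma + (1 - lambda) *: sigma')) ^+ 2)%:E))
         <= M%:E)%E.

End RealDual.

Section StarAlgebra.
Variables (R : realType).

(* The subset P of A is a unital associative *-algebra over R[i]. *)
Record unital_star_algebra (A : lmodType R[i]) (P : set A)
    (mul : A -> A -> A) (one : A) (star : A -> A) : Prop := {
  alg_zero : P 0;
  alg_lin : forall c x y, P x -> P y -> P (c *: x + y);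
  alg_mul : forall x y, P x -> P y -> P (mul x y);
  alg_one : P one;
  alg_star : forall x, P x -> P (star x);
  alg_mulA : forall x y z, P x -> P y -> P z ->
    mul x (mul y z) = mul (mul x y) z;
  alg_mul_linl : forall c x y z, P x -> P y -> P z ->
    mul (c *: x + y) z = c *: mul x z + mul y z;
  alg_mul_linr : forall c x y z, P x -> P y -> P z ->
    mul z (c *: x + y) = c *: mul z x + mul z y;
  alg_mul1 : forall x, P x -> mul one x = x /\ mul x one = x;
  alg_starK : forall x, P x -> star (star x) = x;
  alg_star_lin : forall c x y, P x -> P y ->
    star (c *: x + y) = c^* *: star x + star y;
  alg_starM : forall x y, P x -> P y -> star (mul x y) = mul (star y) (star x) }.

Record unital_star_iso (A B : lmodType R[i])
    (P : set A) (mulA : A -> A -> A) (oneA : A) (starA : A -> A)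
    (Q : set B) (mulB : B -> B -> B) (oneB : B) (starB : B -> B)
    (phi : A -> B) : Prop := {
  iso_dom : unital_star_algebra P mulA oneA starA;
  iso_codom : unital_star_algebra Q mulB oneB starB;
  iso_bij : set_bij P Q phi;
  iso_linear : forall c x y, P x -> P y -> phi (c *: x + y) = c *: phi x + phi y;
  iso_mul : forall x y, P x -> P y -> phi (mulA x y) = mulB (phi x) (phi y);
  iso_one : phi oneA = oneB;
  iso_star : forall x, P x -> phi (starA x) = starB (phi x) }.

End StarAlgebra.

Section Gelfand.
Variables (R : realType) (V : tvsType R[i]) (bar : V -> V).
Variables (W : tvsType R[i]) (iota : sym_alg V -> W).

Local Notation C := (R[i]^o).

Definition vee_cpl : W -> W -> W := extend2 iota (fun X Y => iota (vee X Y)).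
Definition one_cpl : W := iota sym_one.
Definition star_cpl : W -> W := extend iota (fun X => iota (sym_star bar X)).

Definition gelfand (X : W) (rho : real_dual bar) : C :=
  extend iota (fun Y : sym_alg V => delta rho Y : C) X.

Definition fun_mul (f g : real_dual bar -> C) : real_dual bar -> C :=
  fun rho => f rho * g rho.
Definition fun_one : real_dual bar -> C := fun=> 1.
Definition fun_star (f : real_dual bar -> C) : real_dual bar -> C :=
  fun rho => (f rho)^*.

End Gelfand.

Arguments fun_mul {R V} bar.
Arguments fun_one {R V} bar.
Arguments fun_star {R V} bar.
Arguments gelfand {R V} bar {W} iota.

(* Main.v *)
Require Import Defs.
From mathcomp Require Import all_boot all_order all_algebra perm.
From mathcomp Require Import freeg complex.
From mathcomp Require Import all_classical all_reals all_analysis.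
From mathcomp Require Import ring lra.

(** The Gelfand transform of an element [X] of the completion is smooth, and its
    iterated derivatives at [sigma] are the extensions by continuity of explicit
    functionals: on an elementary symmetric tensor, the derivative in the
    directions [w] is a falling factorial times the product of the functionals
    of [w], completed by copies of [sigma], evaluated on the letters ([Qd]).
    Everything rests on estimates of such words of functionals. A positive
    Hermitian form restricted to finitely many vectors is a finite sum of rank
    one forms ([gram]), so the inner product of tensors is a sum, over words of
    functionals, of products of values of these words ([tensor_parseval]).
    Consequently a finite family of functionals satisfying Bessel's inequality
    for a form on [V] satisfies one for tensors, with weights [k!]
    ([tensor_bessel]). This controls products, the involution, single
    derivatives ([Qd_bound]), Taylor remainders ([Qd_remainder]) and the
    Hilbert-Schmidt sums of derivatives ([Qd_HS]); hence transforms are analytic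
    of Hilbert-Schmidt type ([gelfand_HS]). That the transform respects the
    operations is clear for tensors and passes to limits.

    Derivatives at the origin decide the rest. If [f] is analytic of
    Hilbert-Schmidt type, the defining bound for the rank one form of [sigma]
    makes the Taylor series of [f] converge along the segment from 0 to [sigma],
    so [f] is determined by its derivatives at 0 ([analytic_HS_eq]).

    Injectivity: if the transform of [X] vanishes, then so do its derivatives at
    0, which are limits of values of words of real functionals on tensors
    tending to [X]. The inner product with a fixed tensor is a combination of
    such words ([inner_combination]), so [X] is orthogonal to all tensors and
    vanishes ([Qhat_eq0]).

    Surjectivity: given [f], a real form [a] and a Hilbert basis [e] for it, let
    the Taylor tensors be the sums of [1/k! f^(k)(e_t) e_t] over finitely many
    words [t]. The Hilbert-Schmidt bound makes their tails small in the norm of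
    [a], and continuity of the derivatives of [f] as multilinear forms gives
    them, in the limit, the derivatives of [f] on all words of [a]-bounded
    functionals. So for every precision some tensor approximates the
    derivatives of [f] at 0, uniformly over combinations of words of norm one
    ([approximates_exists]). Two such tensors are close because the norm of
    their difference is given by such a combination ([approximates_close]);
    the approximants thus form a Cauchy filter, whose limit has the derivatives
    of [f] at 0 and therefore the transform [f] ([gelfand_preimage]).

    The axioms of algebras hold pointwise for functions, and are carried over by
    the bijection ([function_algebra_iso]). *)

Set Implicit Arguments.
Unset Strict Implicit.
Unset Printing Implicit Defensive.

Import Order.TTheory GRing.Theory Num.Theory.
Import numFieldNormedType.Exports Normc.

Local Open Scope classical_set_scope.
Local Open Scope ring_scope.

(* Elsewhere these names denote symmetric groups and a lemma on iterates. *)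
Local Notation Sym := Defs.Sym.
Local Notation iterD := Defs.iterD.

(** * Complex numbers: modulus and limits *)

Section Scalars.
Variable R : realType.
Local Notation K := R[i].
Implicit Types x y z : K.

Lemma normr_normc z : `|z| = (normc z)%:C%C.
Proof. by rewrite normc_def; case: z. Qed.

Lemma sqr_normcC z : ((normc z ^+ 2)%:C)%C = z^* * z :> K.
Proof. by rewrite rmorphXn /= -normr_normc normCK mulrC. Qed.

Lemma normc_ge0 z : 0 <= normc z.
Proof. by case: z => a b; exact: sqrtr_ge0. Qed.

Lemma normcD x y : normc (x + y) <= normc x + normc y.
Proof. exact: (@le_normcD R x y). Qed.

Lemma normc_opp x : normc (- x) = normc x.
Proof. exact: (@normcN R x). Qed.

Lemma normcB x y : normc (x - y) = normc (y - x).
Proof. by rewrite -normc_opp opprB. Qed.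

Lemma normc_conj z : normc z^* = normc z.
Proof.
have := norm_conjC z; rewrite !normr_normc => /(congr1 (@complex.Re R)) /= //.
Qed.

Lemma normc_real (r : R) : normc (r%:C)%C = `|r|.
Proof. by rewrite /normc /= expr0n /= addr0 sqrtr_sqr. Qed.

Lemma normc_nat n : normc (n%:R : K) = n%:R.
Proof. by rewrite -(rmorph_nat (real_complex R)) normc_real normr_nat. Qed.

Lemma normcX z n : normc (z ^+ n) = normc z ^+ n.
Proof. by elim: n => [|n IH]; rewrite ?expr0 ?normc1// !exprS normcM IH. Qed.

Lemma normc_sum (I : Type) (r : seq I) (P : pred I) (F : I -> K) :
  normc (\sum_(i <- r | P i) F i) <= \sum_(i <- r | P i) normc (F i).
Proof.
elim/big_rec2 : _ => [|i y1 y2 _ H]; first by rewrite normc0.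
by rewrite (le_trans (normcD _ _))// lerD2l.
Qed.

Lemma Re_le_normc z : `|complex.Re z| <= normc z.
Proof. by rewrite -lecR -normr_normc; exact: normc_ge_Re. Qed.

Lemma ReE z : complex.Re (z^* * z) = normc z ^+ 2.
Proof. by rewrite -sqr_normcC. Qed.

Lemma normc_le_ReIm z : normc z <= `|complex.Re z| + `|complex.Im z|.
Proof.
rewrite {1}(complexE z); apply: le_trans (normcD _ _) _.
rewrite normc_real lerD2l normcM normc_real.
by rewrite /normc /= expr0n expr1n /= add0r sqrtr1 mul1r.
Qed.

Lemma conj_real (r : R) : ((r%:C)%C : K)^* = (r%:C)%C.
Proof. by apply/CrealP; rewrite complex_real. Qed.

Lemma normc_eq0 z : (normc z == 0) = (z == 0).
Proof. by apply/eqP/eqP => [/eq0_normc//|->]; rewrite normc0. Qed.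

Lemma ge0_ReE z : 0 <= z -> z = (complex.Re z)%:C%C.
Proof. by case: z => a b; rewrite lecE /= => /andP[/eqP -> _]. Qed.

Lemma ge0_Re z : 0 <= z -> 0 <= complex.Re z.
Proof. by case: z => a b; rewrite lecE /= => /andP[]. Qed.

Lemma Re_sum (I : Type) (r : seq I) (P : pred I) (F : I -> K) :
  complex.Re (\sum_(i <- r | P i) F i) = \sum_(i <- r | P i) complex.Re (F i).
Proof. exact: raddf_sum. Qed.

Lemma Re_mulr (r : R) z : complex.Re ((r%:C)%C * z) = r * complex.Re z.
Proof. by case: z => a b /=; rewrite mul0r subr0. Qed.

(** By induction; the cross term is bounded by the inequality between the
    arithmetic and the geometric mean. *)
Lemma sum_CS (I : Type) (r : seq I) (x y : I -> R) :
  (\sum_(i <- r) x i * y i) ^+ 2 <=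
  (\sum_(i <- r) x i ^+ 2) * (\sum_(i <- r) y i ^+ 2).
Proof.
elim: r => [|i r IH]; first by rewrite !big_nil expr0n mulr0.
rewrite !big_cons; move: IH.
set A := \sum_(i <- r) x i ^+ 2; set B := \sum_(i <- r) y i ^+ 2.
set C := \sum_(i <- r) _ => IH.
have A0 : 0 <= A by apply: sumr_ge0 => j _; exact: sqr_ge0.
have B0 : 0 <= B by apply: sumr_ge0 => j _; exact: sqr_ge0.
set a := x i; set b := y i.
suff : 2 * (C * a * b) <= A * b ^+ 2 + B * a ^+ 2 by move=> H; nra.
have P0 : 0 <= A * b ^+ 2 + B * a ^+ 2.
  by rewrite addr_ge0// mulr_ge0// sqr_ge0.
have [|n0] := leP (2 * (C * a * b)) 0; first by move/le_trans; apply.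
rewrite -ler_sqr ?nnegrE//; last exact: ltW.
have : C ^+ 2 * (a ^+ 2 * b ^+ 2) <= A * B * (a ^+ 2 * b ^+ 2).
  by rewrite ler_wpM2r// mulr_ge0// sqr_ge0.
have := sqr_ge0 (A * b ^+ 2 - B * a ^+ 2).
nra.
Qed.

Lemma normc_sum_CS (I : Type) (r : seq I) (x y : I -> K) :
  normc (\sum_(i <- r) x i * y i) ^+ 2 <=
  (\sum_(i <- r) normc (x i) ^+ 2) * (\sum_(i <- r) normc (y i) ^+ 2).
Proof.
apply: le_trans (sum_CS _ _ _).
rewrite ler_sqr ?nnegrE ?normc_ge0//; last first.
  by apply: sumr_ge0 => i _; rewrite mulr_ge0// normc_ge0.
by apply: le_trans (normc_sum _ _ _) _; under eq_bigr do rewrite normcM.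
Qed.

(** Limits in [R[i]^o] are expressed with radii in [R[i]]; all estimates here use
    radii in [R]. *)
Lemma cvgC_normc (T : Type) (F : set_system T) (FF : Filter F)
    (f : T -> R[i]^o) (z : R[i]^o) :
  f @ F --> z <->
  forall eps : R, 0 < eps -> \forall t \near F, normc (f t - z) < eps.
Proof.
split=> [/cvgrPdist_lt fz e e0|fz].
  have /fz : 0 < (e%:C)%C :> K by rewrite ltcR.
  by apply: filterS => t; rewrite normr_normc ltcR normcB.
apply/cvgrPdist_lt => e e0.
have eE : e = (complex.Re e)%:C%C by apply: ge0_ReE; exact: ltW.
rewrite eE ltcR in e0; have := fz _ e0.
by apply: filterS => t; rewrite normcB eE normr_normc ltcR.
Qed.

Lemma cvgC_unique (T : Type) (F : set_system T) (FF : ProperFilter F)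
    (f : T -> R[i]^o) (z z' : R[i]^o) : f @ F --> z -> f @ F --> z' -> z = z'.
Proof. exact: (@cvg_unique _ (@norm_hausdorff _ (R[i]^o)) (f @ F)). Qed.

Lemma cvgC_Re (T : Type) (F : set_system T) (FF : Filter F)
    (f : T -> R[i]^o) (z : R[i]^o) :
  f @ F --> z -> (complex.Re (f t) : R) @[t --> F] --> (complex.Re z : R).
Proof.
move=> /cvgC_normc fz; apply/cvgrPdist_lt => e /fz; apply: filterS => t.
by apply: le_lt_trans; rewrite normcB -raddfB; exact: Re_le_normc.
Qed.

Lemma cvgC_conj (T : Type) (F : set_system T) (FF : Filter F)
    (f : T -> R[i]^o) (z : R[i]^o) :
  f @ F --> z -> ((f t)^* : R[i]^o) @[t --> F] --> (z^* : R[i]^o).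
Proof.
move=> /cvgC_normc fz; apply/cvgC_normc => e /fz; apply: filterS => t.
by rewrite -rmorphB normc_conj.
Qed.

Lemma cvgC_norm (T : Type) (F : set_system T) (FF : Filter F)
    (f : T -> R[i]^o) (z : R[i]^o) :
  f @ F --> z -> (normc (f t) : R) @[t --> F] --> (normc z : R).
Proof.
move=> /cvgC_normc fz; apply/cvgrPdist_lt => e /fz; apply: filterS => t.
apply: le_lt_trans; rewrite distrC ler_norml.
have := normcD (f t - z) z; have := normcD (z - f t) (f t).
by rewrite !subrK (normcB z) => h1 h2; apply/andP; split; lra.
Qed.

Lemma cvgC_le (T : Type) (F : set_system T) (FF : ProperFilter F)
    (f : T -> R[i]^o) (z : R[i]^o) (M : R) :
  f @ F --> z -> (\forall t \near F, normc (f t) <= M) -> normc z <= M.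
Proof.
move=> fz fM; apply: (@closed_cvg _ _ F FF (fun t => normc (f t)) [set x | x <= M]).
- exact: closed_le.
- exact: fM.
- exact: cvgC_norm.
Qed.

End Scalars.

(** * Words of functionals on tensors *)

Section Words.
Variables (R : realType) (V : tvsType R[i]).
Local Notation K := R[i].
Local Notation T := (tensor_alg V).
Implicit Types (l : seq (V -> K)) (x : seq V) (X Y : T).

(** The value of the tensor product of the functionals [l] on the elementary tensor
    of [x]; being zero for different lengths, it covers all degrees at once. *)
Fixpoint wev l x : K := match l, x with
  | [::], [::] => 1
  | f :: l', v :: x' => f v * wev l' x'
  | _, _ => 0
  end.

Definition lin_fun (f : V -> K) := forall c v w, f (c *: v + w) = c * f v + f w.
Definition all_lin l := forall f, f \in l -> lin_fun f.

Lemma all_lin_cons f l : all_lin (f :: l) <-> lin_fun f /\ all_lin l.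
Proof.
split=> [H|[f0 H] g]; first by split=> [|g gl]; apply: H; rewrite inE ?eqxx ?gl ?orbT.
by rewrite inE => /orP[/eqP->|/H].
Qed.

Lemma all_lin_cat l1 l2 : all_lin (l1 ++ l2) <-> all_lin l1 /\ all_lin l2.
Proof.
split=> [H|[h1 h2] g]; last by rewrite mem_cat => /orP[/h1|/h2].
by split=> g gl; apply: H; rewrite mem_cat gl ?orbT.
Qed.

Lemma wev_size l x : size l != size x -> wev l x = 0.
Proof.
by elim: l x => [|f l IH] [|v x]//=; rewrite eqSS => /IH ->; rewrite mulr0.
Qed.

Lemma wev_multilinear l : all_lin l -> multilinear (wev l : seq V -> K^o).
Proof.
elim: l => [|f l IH] ll u v a x y.
  by case: u => [|u0 u] /=; rewrite scaler0 addr0.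
case: u => [|u0 u] /=.
  have [fl _] := (all_lin_cons f l).1 ll.
  by rewrite fl mulrDl -mulrA.
have /IH -> : all_lin l by have [_] := (all_lin_cons f l).1 ll.
by rewrite mulrDr /GRing.scale /= mulrCA.
Qed.

Lemma wev_cat l1 l2 x1 x2 : size l1 = size x1 ->
  wev (l1 ++ l2) (x1 ++ x2) = wev l1 x1 * wev l2 x2.
Proof.
elim: l1 x1 => [|f l1 IH] [|v x1]//=; first by rewrite mul1r.
by case=> /IH ->; rewrite mulrA.
Qed.

Definition weval l : T -> K := tlift (fun x => wev l x : K^o).

Lemma weval_pure l x : all_lin l -> weval l (tpure x) = wev l x.
Proof. by move=> ll; rewrite /weval tlift_pure//; exact: wev_multilinear. Qed.

Lemma weval_lin l a X Y : all_lin l ->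
  weval l (a *: X + Y) = a * weval l X + weval l Y.
Proof. by move=> ll; rewrite /weval tlift_linear//; exact: wev_multilinear. Qed.

End Words.

(** Unbundled linear maps: that [tlift f] or an extension to the completion is
    linear depends on a property of the map extended. *)
Section LinearMaps.
Variables (K : fieldType) (U W : lmodType K).
Lemma lin0 (f : U -> W) : linear f -> f 0 = 0.
Proof. by move=> fl; have := fl (-1) 0 0; rewrite scaler0 addr0 scaleN1r addNr. Qed.
Lemma linZ (f : U -> W) a x : linear f -> f (a *: x) = a *: f x.
Proof. by move=> fl; rewrite -[a *: x]addr0 fl lin0// addr0. Qed.
Lemma linD (f : U -> W) x y : linear f -> f (x + y) = f x + f y.
Proof. by move=> fl; rewrite -[x]scale1r fl !scale1r. Qed.
Lemma linB (f : U -> W) x y : linear f -> f (x - y) = f x - f y.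
Proof. by move=> fl; rewrite addrC -scaleN1r fl scaleN1r addrC. Qed.
Lemma lin_sum (f : U -> W) (I : Type) (r : seq I) (P : pred I) (F : I -> U) :
  linear f -> f (\sum_(i <- r | P i) F i) = \sum_(i <- r | P i) f (F i).
Proof.
move=> fl; apply: (big_morph f (fun x y => linD x y fl)); exact: lin0.
Qed.
End LinearMaps.

Section Span.
Variables (K : fieldType) (V : lmodType K).
Local Notation T := (tensor_alg V).

Lemma tensor_span (X : T) :
  exists s : seq (K * seq V), X = \sum_(p <- s) p.1 *: tpure p.2.
Proof.
exists [seq (coeff w (trepr X), w) | w <- dom (trepr X)].
rewrite big_map -{1}(treprK X) -{1}(freeg_sumE (trepr X)).
elim: (dom _) => [|w s IH].
  rewrite !big_nil; apply: (addrI (tclass 0)).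
  by rewrite -tclassD !addr0.
rewrite !big_cons tclassD IH /=; congr (_ + _).
rewrite /tpure -tclassZE; congr (tclass _).
by apply/eqP/freeg_eqP => k; rewrite coeffZ !coeffU mul1r.
Qed.

Lemma tensor_ind (P : T -> Prop) :
  P 0 -> (forall a x Y, P Y -> P (a *: tpure x + Y)) -> forall X, P X.
Proof.
move=> P0 PS X; have [s ->] := tensor_span X.
by elim: s => [|p s IH]; rewrite ?big_nil// big_cons; exact: PS.
Qed.

Lemma tensor_lin_eq (W : lmodType K) (f g : T -> W) : linear f -> linear g ->
  (forall x, f (tpure x) = g (tpure x)) -> f =1 g.
Proof.
move=> fl gl fg; apply: tensor_ind => [|a x Y IH]; first by rewrite !lin0.
by rewrite fl gl fg IH.
Qed.

End Span.

(** * Positive Hermitian forms *)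

Section PosHerm.
Variables (R : realType) (U : lmodType R[i]).
Local Notation K := R[i].

(** The algebraic part of [cont_pos_herm], shared by forms on [V] and the forms they
    induce on tensors. *)
Record pos_herm (a : U -> U -> K) : Prop := {
  ph_linr : forall u c v w, a u (c *: v + w) = c * a u v + a u w;
  ph_linl : forall u c v w, a (c *: v + w) u = c^* * a v u + a w u;
  ph_herm : forall v w, a w v = (a v w)^*;
  ph_pos : forall v, 0 <= a v v }.

Definition hn (a : U -> U -> K) v : R := Num.sqrt (complex.Re (a v v)).

Variable a : U -> U -> K.
Hypothesis aP : pos_herm a.

Lemma ph0r u : a u 0 = 0.
Proof. by have := ph_linr aP u (-1) 0 0; rewrite scaler0 addr0 mulN1r addNr. Qed.
Lemma ph0l u : a 0 u = 0.
Proof. by rewrite (ph_herm aP) ph0r rmorph0. Qed.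
Lemma phZr u c v : a u (c *: v) = c * a u v.
Proof. by rewrite -[c *: v]addr0 (ph_linr aP) ph0r addr0. Qed.
Lemma phZl u c v : a (c *: v) u = c^* * a v u.
Proof. by rewrite -[c *: v]addr0 (ph_linl aP) ph0l addr0. Qed.
Lemma phDr u v w : a u (v + w) = a u v + a u w.
Proof. by rewrite -[v]scale1r (ph_linr aP) mul1r scale1r. Qed.
Lemma phDl u v w : a (v + w) u = a v u + a w u.
Proof. by rewrite -[v]scale1r (ph_linl aP) rmorph1 mul1r scale1r. Qed.
Lemma phNr u v : a u (- v) = - a u v.
Proof. by rewrite -scaleN1r phZr mulN1r. Qed.
Lemma phNl u v : a (- v) u = - a v u.
Proof. by rewrite -scaleN1r phZl rmorphN1 mulN1r. Qed.
Lemma phBr u v w : a u (v - w) = a u v - a u w.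
Proof. by rewrite phDr phNr. Qed.
Lemma phBl u v w : a (v - w) u = a v u - a w u.
Proof. by rewrite phDl phNl. Qed.
Lemma ph_suml u (I : Type) (r : seq I) (P : pred I) (F : I -> U) :
  a (\sum_(i <- r | P i) F i) u = \sum_(i <- r | P i) a (F i) u.
Proof. by apply: (big_morph (a^~ u)); [exact: phDl|exact: ph0l]. Qed.

Lemma ph_Re v : a v v = (complex.Re (a v v))%:C%C.
Proof. by apply: ge0_ReE; exact: ph_pos. Qed.
Lemma ph_Re_ge0 v : 0 <= complex.Re (a v v).
Proof. by apply: ge0_Re; exact: ph_pos. Qed.
Lemma hn_ge0 v : 0 <= hn a v. Proof. exact: sqrtr_ge0. Qed.
Lemma sqr_hn v : hn a v ^+ 2 = complex.Re (a v v).
Proof. by rewrite sqr_sqrtr// ph_Re_ge0. Qed.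

(** The form is nonnegative on [s v - t <w|v> w] for real [s] and [t]; when [w] is
    a null vector, [s = 1] and a large [t] show that [<v|w>] is zero. *)
Lemma ph_CS_sqr v w :
  normc (a v w) ^+ 2 <= complex.Re (a v v) * complex.Re (a w w).
Proof.
set p := complex.Re (a v v); set q := complex.Re (a w w).
set N := _ ^+ 2.
have key (s t : R) : 0 <= s * s * p - s * t * N - s * t * N + t * t * N * q.
  pose z := a w v; have zE : z^* * z = (N%:C)%C.
    by rewrite /N (ph_herm aP) normc_conj sqr_normcC.
  clearbody N; have := ph_Re_ge0 ((s%:C)%C *: v - (t%:C * z)%C *: w).
  suff -> : a ((s%:C)%C *: v - (t%:C * z)%C *: w)
      ((s%:C)%C *: v - (t%:C * z)%C *: w) =
      ((s * s * p - s * t * N - s * t * N + t * t * N * q)%:C)%C by [].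
  rewrite phBl !phBr !phZl !phZr -/z (ph_herm aP w v) -/z.
  rewrite (ph_Re v) (ph_Re w) -/p -/q !rmorphM /= !conj_real.
  rewrite !(rmorphD, rmorphN, rmorphM) /= -zE.
  by ring.
have p0 : 0 <= p by exact: ph_Re_ge0.
have q0 : 0 <= q by exact: ph_Re_ge0.
have [q00|qn0] := eqVneq q 0; last first.
  have qp : 0 < q by rewrite lt_def qn0.
  by rewrite -(ler_pM2r qp); have := key q 1; lra.
rewrite q00 mulr0; have [->//|n0] := eqVneq N 0.
have := key 1 ((p + 1) / N); rewrite q00 mulr0 addr0 !mul1r divfK// => H.
by exfalso; lra.
Qed.

Lemma ph_CS v w : normc (a v w) <= hn a v * hn a w.
Proof.
rewrite -ler_sqr ?nnegrE ?normc_ge0 ?mulr_ge0 ?hn_ge0//.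
by rewrite exprMn !sqr_hn ph_CS_sqr.
Qed.

Lemma ph_null v w : complex.Re (a v v) = 0 -> a v w = 0.
Proof.
move=> v0; apply/eqP; rewrite -normc_eq0 -sqrf_eq0 eq_le sqr_ge0 andbT.
by apply: le_trans (ph_CS_sqr _ _) _; rewrite v0 mul0r.
Qed.

Lemma hnD v w : hn a (v + w) <= hn a v + hn a w.
Proof.
rewrite -ler_sqr ?nnegrE ?addr_ge0 ?hn_ge0// sqrrD !sqr_hn.
rewrite phDl !phDr !raddfD /= (ph_herm aP v w) -!addrA lerD2l !addrA lerD2r.
have h := le_trans (Re_le_normc _) (ph_CS v w).
have -> : complex.Re (a v w)^* = complex.Re (a v w) by case: (a v w).
have := le_trans (ler_norm _) h; set x := complex.Re _.
by move=> ?; exact: lerD.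
Qed.

Lemma sqr_hnZ c v : complex.Re (a (c *: v) (c *: v)) =
  normc c ^+ 2 * complex.Re (a v v).
Proof. by rewrite phZl phZr mulrA -sqr_normcC Re_mulr. Qed.

Lemma hnZ c v : hn a (c *: v) = normc c * hn a v.
Proof.
by rewrite /hn sqr_hnZ sqrtrM ?sqr_ge0// sqrtr_sqr ger0_norm ?normc_ge0.
Qed.

Lemma hn0 : hn a 0 = 0.
Proof. by rewrite /hn ph0r sqrtr0. Qed.

End PosHerm.

Section FormOperations.
Variables (R : realType) (U : lmodType R[i]).
Local Notation K := R[i].
Implicit Types a b : U -> U -> K.

Lemma pos_hermD a b : pos_herm a -> pos_herm b ->
  pos_herm (fun v w => a v w + b v w).
Proof.
move=> aP bP; split=> [u c v w|u c v w|v w|v].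
- by rewrite (ph_linr aP) (ph_linr bP); ring.
- by rewrite (ph_linl aP) (ph_linl bP); ring.
- by rewrite (ph_herm aP) (ph_herm bP) rmorphD.
- by rewrite addr_ge0 ?(ph_pos aP) ?(ph_pos bP).
Qed.

Lemma pos_hermZ a (c : R) : pos_herm a -> 0 <= c ->
  pos_herm (fun v w => (c%:C)%C * a v w).
Proof.
move=> aP c0; split=> [u d v w|u d v w|v w|v].
- by rewrite (ph_linr aP); ring.
- by rewrite (ph_linl aP); ring.
- by rewrite (ph_herm aP) rmorphM /= conj_real.
- by rewrite mulr_ge0 ?(ph_pos aP)// lecR.
Qed.

End FormOperations.

(** * Sums over words *)

Section Words.
Variable A : Type.

(** The words of length [k] in the letters [s], as a list, so that sums over
    words can be taken for infinite letter types as well. *)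
Fixpoint words (s : seq A) k : seq (seq A) :=
  if k is k'.+1 then [seq i :: t | i <- s, t <- words s k'] else [:: [::]].

Lemma sum_wordsS (W : nmodType) (s : seq A) k (F : seq A -> W) :
  \sum_(t <- words s k.+1) F t = \sum_(i <- s) \sum_(t <- words s k) F (i :: t).
Proof. by rewrite /= big_allpairs_dep. Qed.

Lemma sum_words0 (W : nmodType) (s : seq A) (F : seq A -> W) :
  \sum_(t <- words s 0) F t = F [::].
Proof. by rewrite /= big_seq1. Qed.

Lemma sum_words_cat (W : nmodType) (s : seq A) k m (F : seq A -> W) :
  \sum_(t <- words s (k + m)) F t =
  \sum_(t <- words s k) \sum_(t' <- words s m) F (t ++ t').
Proof.
elim: k F => [|k IH] F; first by rewrite sum_words0.
by rewrite addSn !sum_wordsS; apply: eq_bigr => i _; rewrite IH.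
Qed.

Lemma eq_sum_words (W : nmodType) (s : seq A) k (F G : seq A -> W) :
  (forall t, size t = k -> F t = G t) ->
  \sum_(t <- words s k) F t = \sum_(t <- words s k) G t.
Proof.
elim: k F G => [|k IH] F G FG; first by rewrite !sum_words0 FG.
by rewrite !sum_wordsS; apply: eq_bigr => i _; apply: IH => t tk; rewrite FG/= ?tk.
Qed.

Lemma sum_words_catl (R : numDomainType) (s s' : seq A) k (F : seq A -> R) :
  (forall t, 0 <= F t) ->
  \sum_(t <- words s k) F t <= \sum_(t <- words (s ++ s') k) F t.
Proof.
elim: k F => [|k IH] F F0; first by rewrite !sum_words0.
rewrite !sum_wordsS big_cat /= -[leLHS]addr0 lerD//; last first.
  by apply: sumr_ge0 => i _; apply: sumr_ge0 => j _; exact: F0.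
by apply: ler_sum => i _; apply: IH => t; exact: F0.
Qed.

End Words.

Lemma words_map (A B : Type) (f : A -> B) s k :
  words (map f s) k = map (map f) (words s k).
Proof.
elim: k => //= k ->; rewrite allpairs_mapl allpairs_mapr map_allpairs.
by [].
Qed.

Lemma mem_words (A : eqType) (s : seq A) k t :
  (t \in words s k) = (size t == k) && all (mem s) t.
Proof.
elim: k t => [|k IH] [|i t]//=.
  by apply/negbTE/negP => /allpairsP[[i t] [_ _]].
rewrite eqSS; apply/allpairsP/idP => [[[i' t'] /= [i's]]|/and3P[tk is_ ts]].
  by rewrite IH => /andP[tk ts] [-> ->]; rewrite tk ts i's.
by exists (i, t); split => //=; rewrite IH tk ts.
Qed.

Lemma words_uniq (A : eqType) (s : seq A) k : uniq s -> uniq (words s k).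
Proof.
move=> us; elim: k => //= k IH; apply: allpairs_uniq => //.
by move=> [i t] [i' t'] _ _ /= [-> ->].
Qed.

(** * Finite Parseval and Bessel relations for tensors *)

Section Gram.
Variables (R : realType) (V : tvsType R[i]).
Local Notation K := R[i].
Implicit Types (a b r : V -> V -> K) (l ls ms : seq (V -> K)).

Definition fsum ls v w : K := \sum_(f <- ls) (f v)^* * f w.

(** Equivalently, [a - fsum ls] is positive. The functionals of [ls] play the part of
    coordinates with respect to an orthonormal family. *)
Definition bessel a ls :=
  forall v, \sum_(f <- ls) normc (f v) ^+ 2 <= complex.Re (a v v).

Lemma fsum_diag ls v :
  fsum ls v v = ((\sum_(f <- ls) normc (f v) ^+ 2)%:C)%C.
Proof. by rewrite /fsum rmorph_sum; apply: eq_bigr => f _; exact/esym/sqr_normcC. Qed.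

Lemma fsum_linr ls u c v w : all_lin ls ->
  fsum ls u (c *: v + w) = c * fsum ls u v + fsum ls u w.
Proof.
move=> ll; rewrite /fsum mulr_sumr -big_split big_seq [RHS]big_seq.
by apply: eq_bigr => f /ll fl /=; rewrite fl; ring.
Qed.

Lemma fsum_herm ls v w : fsum ls w v = (fsum ls v w)^*.
Proof.
rewrite /fsum rmorph_sum; apply: eq_bigr => f _.
by rewrite /= rmorphM /= conjCK mulrC.
Qed.

Lemma pos_herm_fsum ls : all_lin ls -> pos_herm (fsum ls).
Proof.
move=> ll; split => [u c v w|u c v w|v w|v].
- exact: fsum_linr.
- rewrite fsum_herm fsum_linr// rmorphD rmorphM /=.
  by congr (_ * _ + _); rewrite -fsum_herm.
- exact: fsum_herm.
- by rewrite fsum_diag lecR sumr_ge0// => f _; exact: sqr_ge0.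
Qed.

Lemma bessel_rest a ls : pos_herm a -> all_lin ls -> bessel a ls ->
  pos_herm (fun v w => a v w - fsum ls v w).
Proof.
move=> aP /pos_herm_fsum fP als; split => [u c v w|u c v w|v w|v].
- by rewrite (ph_linr aP) (ph_linr fP); ring.
- by rewrite (ph_linl aP) (ph_linl fP); ring.
- by rewrite (ph_herm aP) (ph_herm fP) rmorphB.
- by rewrite (ph_Re aP) fsum_diag -rmorphB lecR subr_ge0.
Qed.

(** Gram-Schmidt without orthonormal vectors: subtracting from [r] the rank
    one form of [r x0] scaled by the inverse of the norm of [x0] leaves a
    positive form with [x0] in its kernel, and Cauchy-Schwarz keeps [x0] in the
    kernel when smaller forms are considered later. *)
Lemma gram (xs : seq V) r : pos_herm r -> exists ms, [/\ all_lin ms, bessel r ms &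
  forall x y, x \in xs -> r x y = fsum ms x y].
Proof.
elim: xs r => [|x0 xs IH] r rP.
  by exists [::]; split=> // v; rewrite big_nil; exact: ph_Re_ge0.
pose n := complex.Re (r x0 x0); have n0 : 0 <= n by exact: ph_Re_ge0.
pose f v : K := (((Num.sqrt n)^-1)%:C)%C * r x0 v.
have flin : lin_fun f by move=> c v w; rewrite /f (ph_linr rP); ring.
have fn v : normc (f v) ^+ 2 = n^-1 * normc (r x0 v) ^+ 2.
  rewrite /f normcM normc_real exprMn ger0_norm ?invr_ge0 ?sqrtr_ge0//.
  by rewrite exprVn sqr_sqrtr.
have fx0 v : (f x0)^* * f v = r x0 v.
  rewrite /f rmorphM /= conj_real (ph_Re rP x0) -/n conj_real.
  have [n00|nn0] := eqVneq n 0.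
    by rewrite n00 mulr0 mul0r (ph_null rP).
  rewrite -!rmorphM mulrA -rmorphM /= -[RHS]mul1r; congr (_ * _).
  have sn0 : Num.sqrt n != 0 by rewrite sqrtr_eq0 -ltNge lt_def nn0.
  rewrite -{2}(sqr_sqrtr n0) -[RHS](rmorph1 (real_complex R)); congr (_%:C)%C.
  by field.
have r1P : pos_herm (fun v w => r v w - fsum [:: f] v w).
  apply: bessel_rest => // [g|v]; first by rewrite inE => /eqP ->.
  rewrite big_seq1 fn; have [->|nn0] := eqVneq n 0.
    by rewrite invr0 mul0r; exact: ph_Re_ge0.
  have np : 0 < n by rewrite lt_def nn0.
  by rewrite mulrC ler_pdivrMr// mulrC; exact: ph_CS_sqr.
have [ms [ml rm msx]] := IH _ r1P; exists (f :: ms).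
have fml : all_lin (f :: ms) by apply/all_lin_cons.
have consE v w : fsum (f :: ms) v w = fsum [:: f] v w + fsum ms v w.
  by rewrite /fsum big_cons big_seq1.
split=> // [v|x y].
  have := rm v; rewrite raddfB /= fsum_diag big_seq1 /= lerBrDl.
  by rewrite big_cons.
have r2P := bessel_rest r1P ml rm.
rewrite inE => /orP[/eqP->|/msx]; last by rewrite consE => <-; rewrite addrC subrK.
have /(ph_null r2P y) : complex.Re (r x0 x0 - fsum [:: f] x0 x0 - fsum ms x0 x0) = 0.
  apply/eqP; rewrite eq_le; apply/andP; split; last exact: (ph_Re_ge0 r2P).
  rewrite /fsum big_seq1 fx0 subrr sub0r raddfN oppr_le0 -/(fsum ms x0 x0).
  by rewrite fsum_diag sumr_ge0// => g _; exact: sqr_ge0.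
by move=> /= /eqP; rewrite -addrA -opprD -consE subr_eq0 => /eqP.
Qed.

End Gram.

Section TensorForm.
Variables (R : realType) (V : tvsType R[i]).
Local Notation K := R[i].
Local Notation T := (tensor_alg V).
Implicit Types (a b r : V -> V -> K) (l ls ms : seq (V -> K)) (x y : seq V).
Implicit Types (X Y Z : T).

Lemma weval0 l : all_lin l -> weval l 0 = 0 :> K.
Proof.
by move=> ll; have := weval_lin (-1) 0 0 ll; rewrite scaler0 addr0 mulN1r addNr.
Qed.
Lemma weval_linear l : all_lin l -> linear (weval l : T -> K^o).
Proof. by move=> ll a X Y; rewrite weval_lin. Qed.

Lemma weval_sum l (I : Type) (s : seq I) (P : pred I) (c : I -> K) (F : I -> T) :
  all_lin l -> weval l (\sum_(i <- s | P i) c i *: F i) =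
  \sum_(i <- s | P i) c i * weval l (F i).
Proof.
move=> /weval_linear wl; rewrite (lin_sum _ _ _ wl); apply: eq_bigr => i _.
by rewrite (linZ _ _ wl).
Qed.

Lemma weval_letter l1 l2 (f g h : V -> K) (c : K) X :
  all_lin l1 -> all_lin l2 -> lin_fun f -> lin_fun g ->
  (forall v, h v = c * f v + g v) ->
  weval (l1 ++ h :: l2) X =
  c * weval (l1 ++ f :: l2) X + weval (l1 ++ g :: l2) X.
Proof.
move=> ll1 ll2 fl gl hE.
have hl : lin_fun h by move=> d v w; rewrite !hE fl gl; ring.
have [L1 L2 L3] : [/\ all_lin (l1 ++ f :: l2), all_lin (l1 ++ g :: l2) &
    all_lin (l1 ++ h :: l2)].
  by split; apply/all_lin_cat; split=> //; apply/all_lin_cons.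
move: X; apply: tensor_ind => [|d x Y IH]; first by rewrite !weval0// mulr0 addr0.
rewrite !weval_lin// IH !weval_pure//.
suff -> : wev (l1 ++ h :: l2) x =
    c * wev (l1 ++ f :: l2) x + wev (l1 ++ g :: l2) x by ring.
elim: l1 x {ll1 L1 L2 L3 IH} => [|k l1 IHl] [|v x] /=; rewrite ?hE ?IHl; ring.
Qed.

Lemma weval_scale l (d : K) X : all_lin l ->
  weval [seq (fun v => d * f v) | f <- l] X = d ^+ size l * weval l X.
Proof.
move=> ll; have ll' : all_lin [seq (fun v => d * f v) | f <- l].
  by move=> _ /mapP[f /ll fl ->] c v w; rewrite fl; ring.
move: X; apply: tensor_ind => [|c x Y IH]; first by rewrite !weval0// mulr0.
rewrite !weval_lin// IH !weval_pure//.
suff -> : wev [seq (fun v => d * f v) | f <- l] x = d ^+ size l * wev l x by ring.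
elim: l x {ll ll' IH} => [|f l IHl] [|v x] /=; rewrite ?IHl ?exprS ?expr0; ring.
Qed.

Lemma word_formE a x y : word_form a x y = (size x)`!%:R * wev (map a x) y.
Proof.
rewrite /word_form; case: eqP => [xy|/eqP xy]; last first.
  by rewrite wev_size ?mulr0// size_map.
congr (_ * _); elim: x y xy => [|v x IH] [|w y]//=; first by rewrite big_nil.
by rewrite big_cons /= => -[/IH ->].
Qed.

Section Fixed.
Variable a : V -> V -> K.
Hypothesis aP : pos_herm a.

Lemma ph_lin v : lin_fun (a v).
Proof. by move=> c u w; rewrite (ph_linr aP). Qed.

Lemma all_lin_map x : all_lin (map a x).
Proof. by move=> _ /mapP[v _ ->]; exact: ph_lin. Qed.
Arguments all_lin_map x f _ : clear implicits.

Lemma word_form_multilinear x : multilinear (fun y => word_form a x y : K^o).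
Proof.
move=> u v c y z; rewrite !word_formE (wev_multilinear (all_lin_map x)).
by rewrite mulrDr /GRing.scale /= mulrCA.
Qed.

Lemma word_form_lift x Y :
  tlift (fun y => word_form a x y : K^o) Y = (size x)`!%:R * weval (map a x) Y.
Proof.
have fl := tlift_linear (word_form_multilinear x).
have wl := weval_linear (all_lin_map x).
move: Y; apply: tensor_ind => [|c y Y IH].
  by rewrite (lin0 fl) (lin0 wl) mulr0.
rewrite fl wl IH tlift_pure; last exact: word_form_multilinear.
rewrite (weval_pure _ (all_lin_map x)) word_formE /GRing.scale /=; ring.
Qed.

(** Conjugating the scalars of the target turns antilinearity in the first
    argument into linearity. *)
Lemma tensor_form_multilinear Y : multilinear
  (fun x => tlift (fun y => word_form a x y : K^o) Y : conj_space K^o).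
Proof.
rewrite (_ : (fun x => _) = fun x => (size x)`!%:R * weval (map a x) Y); last first.
  by apply/funext => x; exact: word_form_lift.
move=> u v c y z; rewrite !map_cat [map a (_ :: _)]/= [in LHS]size_cat.
rewrite (@weval_letter _ _ (a y) (a z) _ c^*) => [|||||w].
- by rewrite mulrDr mulrCA !size_cat.
- exact: all_lin_map.
- exact: all_lin_map.
- exact: ph_lin.
- exact: ph_lin.
- by rewrite (ph_linl aP).
Qed.

Lemma tensor_form_pure x Y :
  tensor_form a (tpure x) Y = (size x)`!%:R * weval (map a x) Y.
Proof.
apply: etrans (word_form_lift x Y).
exact: (tlift_pure (tensor_form_multilinear Y) x).
Qed.

Lemma tensor_form_linl Y c X Z :
  tensor_form a (c *: X + Z) Y = c^* * tensor_form a X Y + tensor_form a Z Y.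
Proof. exact: (tlift_linear (tensor_form_multilinear Y) c X Z). Qed.

Lemma tensor_form0l Y : tensor_form a 0 Y = 0.
Proof. exact: (lin0 (tlift_linear (tensor_form_multilinear Y))). Qed.

Lemma tensor_form_linr X c Y Z :
  tensor_form a X (c *: Y + Z) = c * tensor_form a X Y + tensor_form a X Z.
Proof.
move: X; apply: tensor_ind => [|d x X IH]; first by rewrite !tensor_form0l; ring.
rewrite !tensor_form_linl IH !tensor_form_pure (weval_lin _ _ _ (all_lin_map x)).
by ring.
Qed.

Lemma tensor_form_suml (I : Type) (s : seq I) (c : I -> K) (F : I -> T) Y :
  tensor_form a (\sum_(i <- s) c i *: F i) Y =
  \sum_(i <- s) (c i)^* * tensor_form a (F i) Y.
Proof.
elim: s => [|i s IH]; first by rewrite !big_nil tensor_form0l.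
by rewrite !big_cons tensor_form_linl IH.
Qed.

(** Distributivity: a product over letters of sums of rank one terms is a sum over
    words of functionals. *)
Lemma wev_fsum ls x y : (forall v w, v \in x -> a v w = fsum ls v w) ->
  wev (map a x) y = \sum_(l <- words ls (size x)) (wev l x)^* * wev l y.
Proof.
elim: x y => [|v x IH] y H.
  by rewrite sum_words0 /=; case: y => [|? ?]; rewrite ?rmorph1 ?mulr0 ?mul1r.
rewrite sum_wordsS /=; case: y => [|w y] /=.
  rewrite big1 // => f _; rewrite (eq_bigr (fun=> 0)) ?big1//= => l _.
  by rewrite mulr0.
rewrite IH => [|u t ux]; last by apply: H; rewrite inE ux orbT.
rewrite H ?inE ?eqxx// /fsum mulr_suml; apply: eq_bigr => f _.
rewrite mulr_sumr; apply: eq_bigr => l _; rewrite rmorphM /=; ring.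
Qed.

Lemma tensor_form_words ls N (s : seq (K * seq V)) Y : all_lin ls ->
  (forall p, p \in s -> (size p.2 < N)%N) ->
  (forall p v w, p \in s -> v \in p.2 -> a v w = fsum ls v w) ->
  tensor_form a (\sum_(p <- s) p.1 *: tpure p.2) Y =
  \sum_(k < N) k`!%:R * \sum_(l <- words ls k)
    (weval l (\sum_(p <- s) p.1 *: tpure p.2))^* * weval l Y.
Proof.
move=> ll sN sls; rewrite tensor_form_suml.
have lw k l : l \in words ls k -> all_lin l.
  by rewrite mem_words => /andP[_ /allP lls] f /lls /ll.
transitivity (\sum_(p <- s) \sum_(k < N) k`!%:R * \sum_(l <- words ls k)
    (p.1 * wev l p.2)^* * weval l Y); last first.
  rewrite exchange_big; apply: eq_bigr => k _ /=; rewrite -mulr_sumr.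
  congr (_ * _); rewrite exchange_big /= big_seq [RHS]big_seq.
  apply: eq_bigr => l /lw al; rewrite -mulr_suml weval_sum// rmorph_sum.
  by congr (_ * _); apply: eq_bigr => p _; rewrite weval_pure.
rewrite big_seq [RHS]big_seq; apply: eq_bigr => p ps.
rewrite tensor_form_pure (bigD1 (Ordinal (sN p ps)))//= [X in _ + X]big1.
  rewrite addr0 mulrCA; congr (_ * _).
  have al := all_lin_map p.2; move: Y; apply: tensor_ind => [|c y Y IH].
    rewrite weval0// mulr0 big_seq big1// => l /lw /weval0 ->.
    by rewrite mulr0.
  rewrite (weval_lin _ _ _ al) mulrDr IH weval_pure//.
  rewrite (wev_fsum _ (fun v w => sls p v w ps)) !mulr_sumr -big_split.
  rewrite big_seq [RHS]big_seq; apply: eq_bigr => l /lw ll'.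
  rewrite weval_lin// weval_pure// rmorphM /=; ring.
move=> k /eqP kp; rewrite big_seq big1 ?mulr0// => l.
rewrite mem_words => /andP[/eqP lk _]; rewrite wev_size ?mulr0 ?rmorph0 ?mul0r//.
by rewrite lk; apply/eqP => kE; apply: kp; apply: val_inj; rewrite /= kE.
Qed.

(** The letters of [X] are finite in number, so [gram], applied to [a] minus the
    rank one forms of [ls], yields functionals [ms] such that [ls ++ ms]
    represents [a] on these letters. Keeping [ls] among the functionals is what
    turns this identity into an inequality for [ls]. *)
Lemma tensor_parseval ls X : all_lin ls -> bessel a ls ->
  exists ms N0, [/\ all_lin (ls ++ ms), bessel a (ls ++ ms) &
  forall N Y, (N0 <= N)%N -> tensor_form a X Y =
  \sum_(k < N) k`!%:R * \sum_(l <- words (ls ++ ms) k)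
     (weval l X)^* * weval l Y].
Proof.
move=> ll als; have [s ->] := tensor_span X.
have [ms [ml bm msE]] := gram (flatten (map snd s)) (bessel_rest aP ll als).
have ll' : all_lin (ls ++ ms) by apply/all_lin_cat.
exists ms, (\max_(p <- s) size p.2).+1; split=> // [v|N Y N0].
  have := bm v; rewrite big_cat /= raddfB /= fsum_diag /=.
  by rewrite lerBrDl.
apply: tensor_form_words => // [p ps|p v w ps vp].
  apply: leq_trans N0; rewrite ltnS.
  by rewrite (big_rem p) //= leq_maxl.
rewrite /fsum big_cat /= -/(fsum ls v w) -/(fsum ms v w) -msE; last first.
  by apply/flatten_mapP; exists p.
by rewrite addrC subrK.
Qed.

Lemma tensor_parseval_diag ls X : all_lin ls -> bessel a ls ->
  exists ms N0, [/\ all_lin (ls ++ ms), bessel a (ls ++ ms) &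
  forall N, (N0 <= N)%N -> tensor_form a X X =
  ((\sum_(k < N) k`!%:R * \sum_(l <- words (ls ++ ms) k)
     normc (weval l X) ^+ 2)%:C)%C].
Proof.
move=> ll als; have [ms [N0 [ml mb mE]]] := tensor_parseval X ll als.
exists ms, N0; split=> // N /mE ->; rewrite rmorph_sum; apply: eq_bigr => k _.
rewrite rmorphM rmorph_nat rmorph_sum /=; congr (_ * _).
by apply: eq_bigr => l _; exact/esym/sqr_normcC.
Qed.

Lemma tensor_form_herm X Y : tensor_form a Y X = (tensor_form a X Y)^*.
Proof.
move: X; apply: tensor_ind => [|c x X IH].
  by rewrite tensor_form0l (lin0 (fun c X Z => tensor_form_linr Y c X Z)) rmorph0.
rewrite tensor_form_linl tensor_form_linr rmorphD rmorphM /= conjCK -IH.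
congr (_ * _ + _); move: Y {IH}; apply: tensor_ind => [|d y Y IH].
  rewrite tensor_form0l (lin0 (fun c X Z => tensor_form_linr (tpure x) c X Z)).
  by rewrite rmorph0.
rewrite tensor_form_linl tensor_form_linr rmorphD rmorphM /= -IH.
congr (_ * _ + _); rewrite !tensor_form_pure !weval_pure; try exact: all_lin_map.
rewrite -!word_formE /word_form eq_sym; case: eqP => [xy|]; last by rewrite rmorph0.
rewrite xy rmorphM /= rmorph_nat rmorph_prod /=; congr (_ * _).
elim: x y xy {X IH} => [|v x IHx] [|w y]//=; first by rewrite !big_nil.
by case=> /IHx; rewrite !big_cons /= => ->; rewrite (ph_herm aP).
Qed.

(** Positivity is read off the expansion as a sum of squares. *)
Lemma pos_herm_tensor : pos_herm (tensor_form a).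
Proof.
split=> [|||X].
- by move=> X c Y Z; exact: tensor_form_linr.
- by move=> X c Y Z; exact: tensor_form_linl.
- exact: tensor_form_herm.
have [||ms [N [_ _ H]]] := @tensor_parseval_diag [::] X.
- by [].
- by move=> v; rewrite big_nil; exact: ph_Re_ge0.
rewrite (H N)// lecR sumr_ge0// => k _; rewrite mulr_ge0//.
by apply: sumr_ge0 => l _; exact: sqr_ge0.
Qed.

(** The words in [ls] are among the words of a Parseval expansion. *)
Lemma tensor_bessel ls N X : all_lin ls -> bessel a ls ->
  \sum_(k < N) k`!%:R * \sum_(l <- words ls k) normc (weval l X) ^+ 2
  <= tensor_norm a X ^+ 2.
Proof.
move=> ll als; rewrite (sqr_hn pos_herm_tensor).
have [ms [N0 [ml mb mE]]] := tensor_parseval_diag X ll als.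
rewrite (mE (maxn N N0)) ?leq_maxr//=.
have pos F k : 0 <= \sum_(l <- words F k) normc (weval l X) ^+ 2.
  by apply: sumr_ge0 => l _; exact: sqr_ge0.
rewrite (big_ord_widen _ (fun k => k`!%:R * \sum_(l <- words ls k)
  normc (weval l X) ^+ 2) (leq_maxl N N0)) big_mkcond.
apply: ler_sum => k _; case: ifP => _; last by rewrite mulr_ge0.
rewrite ler_wpM2l//; apply: sum_words_catl => l; exact: sqr_ge0.
Qed.

End Fixed.
End TensorForm.

Arguments all_lin_map {R V a} aP x f _.

(** * Permutations of words *)

Section Perm.
Variable A : Type.

Definition perm_word (x0 : A) k (s : 'S_k) (t : seq A) :=
  [seq nth x0 t (s i) | i <- enum 'I_k].

Lemma size_perm_word x0 k (s : 'S_k) t : size (perm_word x0 s t) = k.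
Proof. by rewrite size_map size_enum_ord. Qed.

Lemma nth_perm_word x0 k (s : 'S_k) t (i : 'I_k) :
  nth x0 (perm_word x0 s t) i = nth x0 t (s i).
Proof. by rewrite (nth_map i) ?size_enum_ord// nth_ord_enum. Qed.

Lemma perm_wordM x0 k (s p : 'S_k) t :
  perm_word x0 s (perm_word x0 p t) = perm_word x0 (s * p)%g t.
Proof. by apply: eq_map => i; rewrite nth_perm_word permM. Qed.

Lemma rev_perm_word x0 k (s : 'S_k) t :
  rev (perm_word x0 s t) = perm_word x0 (perm (@rev_ord_inj k) * s)%g t.
Proof.
apply: (@eq_from_nth _ x0) => [|i]; first by rewrite size_rev !size_perm_word.
rewrite size_rev size_perm_word => ik; rewrite nth_rev size_perm_word//.
have rk : (k - i.+1 < k)%N by rewrite ltn_subrL /= (leq_ltn_trans _ ik).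
rewrite (nth_perm_word x0 s t (Ordinal rk)).
rewrite (nth_perm_word x0 _ t (Ordinal ik)) permM permE.
by congr (nth _ _ (s _)); exact: val_inj.
Qed.

Lemma perm_word_rev x0 k (s : 'S_k) t : size t = k ->
  perm_word x0 s (rev t) = perm_word x0 (s * perm (@rev_ord_inj k))%g t.
Proof.
move=> tk; apply: eq_map => i; rewrite nth_rev tk; last exact: ltn_ord.
by rewrite permM permE.
Qed.

Lemma sum_words_rev (W : nmodType) (s : seq A) k (F : seq A -> W) :
  \sum_(t <- words s k) F (rev t) = \sum_(t <- words s k) F t.
Proof.
elim: k F => [|k IH] F; first by rewrite !sum_words0.
rewrite -[in RHS]addn1 sum_words_cat exchange_big sum_wordsS /=.
under eq_bigr => i _ do under eq_bigr => t _ do rewrite rev_cons.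
under eq_bigr => i _ do rewrite (IH (fun t => F (rcons t i))).
rewrite exchange_big [RHS]exchange_big /=; apply: eq_bigr => t _.
rewrite (sum_wordsS _ 0 (fun t' => F (t ++ t'))).
by apply: eq_bigr => i _; rewrite sum_words0 cats1.
Qed.

End Perm.

Lemma map_perm_word (A B : Type) (f : A -> B) x0 y0 k (s : 'S_k) t : size t = k ->
  map f (perm_word x0 s t) = perm_word y0 s (map f t).
Proof.
by move=> tk; rewrite -map_comp; apply: eq_map => i /=; rewrite (nth_map x0)// tk.
Qed.

Lemma perm_perm_word (A : eqType) (x0 : A) k (s : 'S_k) t : size t = k ->
  perm_eq (perm_word x0 s t) t.
Proof.
move=> tk; subst k; apply/(tuple_permP (t := in_tuple t)).
by exists s; apply: eq_map => i /=; rewrite (tnth_nth x0).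
Qed.

Lemma perm_eq_word (A : eqType) (x0 : A) (t t' : seq A) : perm_eq t t' ->
  exists s : 'S_(size t'), t = perm_word x0 s t'.
Proof.
move=> tt'; have sz := perm_size tt'.
have /tuple_permP[s sE] : perm_eq (Tuple (introT eqP sz)) (in_tuple t') by [].
exists s; rewrite -[LHS]/(tval (Tuple (introT eqP sz))) sE /=.
by apply: eq_map => i; rewrite (tnth_nth x0).
Qed.

(** * Comparison of tensor norms *)

Section TensorNorm.
Variables (R : realType) (V : tvsType R[i]).
Local Notation K := R[i].
Local Notation T := (tensor_alg V).
Implicit Types (a b r : V -> V -> K) (l ls ms : seq (V -> K)) (x y : seq V).
Implicit Types (X Y Z : T).

Definition fle a b := forall v, complex.Re (a v v) <= complex.Re (b v v).

(** The functionals of a Parseval expansion for [a] satisfy Bessel's inequality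
    for [b] as well. *)
Lemma tensor_norm_le a b X : pos_herm a -> pos_herm b -> fle a b ->
  tensor_norm a X <= tensor_norm b X.
Proof.
move=> aP bP ab; have [||ms [N [ml mb mE]]] := @tensor_parseval_diag _ _ _ aP [::] X.
- by [].
- by move=> v; rewrite big_nil; exact: ph_Re_ge0.
rewrite -ler_sqr ?nnegrE ?sqrtr_ge0// [leLHS](sqr_hn (pos_herm_tensor aP)).
rewrite (mE N)//; apply: tensor_bessel => // v.
by apply: le_trans (ab v); exact: mb.
Qed.

(** Scaling a form by [d ^+ 2] multiplies the norm in degree [k] by [d ^+ k], which
    absorbs factors exponential in the degree. *)
Definition scale_form (c : R) a v w : K := (c%:C)%C * a v w.

Lemma tensor_bessel_scale a (d : R) ls N X : pos_herm a -> all_lin ls ->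
  bessel a ls ->
  \sum_(k < N) k`!%:R * ((d ^+ 2) ^+ k *
     \sum_(l <- words ls k) normc (weval l X) ^+ 2)
  <= tensor_norm (scale_form (d ^+ 2) a) X ^+ 2.
Proof.
move=> aP ll lb; have bP := pos_hermZ aP (sqr_ge0 d).
pose g (f : V -> K) v := (d%:C)%C * f v.
have gl : all_lin (map g ls).
  by move=> _ /mapP[f /ll fl ->] c v w; rewrite /g fl; ring.
apply: le_trans (tensor_bessel bP N X gl _); last first.
  move=> v; rewrite big_map /scale_form Re_mulr.
  under eq_bigr do rewrite /g normcM normc_real exprMn real_normK ?num_real//.
  by rewrite -mulr_sumr ler_wpM2l// sqr_ge0.
apply: ler_sum => k _; rewrite ler_wpM2l// words_map big_map mulr_sumr.
rewrite le_eqVlt; apply/orP; left; apply/eqP.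
rewrite big_seq [RHS]big_seq; apply: eq_bigr => l.
rewrite mem_words => /andP[/eqP lk /allP lls].
rewrite weval_scale => [|f /lls/ll//]; rewrite normcM normcX normc_real lk.
by rewrite [in RHS]exprMn -[in RHS]exprM mulnC exprM real_normK ?num_real.
Qed.

Lemma word_bound a (d : R) ls l X : pos_herm a -> all_lin ls -> bessel a ls ->
  0 <= d -> {subset l <= ls} ->
  d ^+ size l * normc (weval l X) <= tensor_norm (scale_form (d ^+ 2) a) X.
Proof.
move=> aP ll lb d0 lls.
rewrite -ler_sqr ?nnegrE ?sqrtr_ge0 ?mulr_ge0 ?exprn_ge0 ?normc_ge0//.
apply: le_trans (tensor_bessel_scale d (size l).+1 X aP ll lb).
rewrite big_ord_recr /= -[leLHS]add0r lerD//.
  apply: sumr_ge0 => k _; rewrite mulr_ge0// mulr_ge0 ?exprn_ge0 ?sqr_ge0//.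
  by apply: sumr_ge0 => m _; exact: sqr_ge0.
rewrite [leLHS]exprMn -exprM mulnC exprM.
have lw : l \in words ls (size l) by rewrite mem_words eqxx; apply/allP.
rewrite -[leLHS]mul1r; apply: ler_pM => //.
- by rewrite mulr_ge0 ?sqr_ge0.
- by rewrite ler1n fact_gt0.
rewrite ler_wpM2l ?sqr_ge0//.
rewrite (big_rem l lw) /= lerDl; apply: sumr_ge0 => m _; exact: sqr_ge0.
Qed.

(** * Symmetrisation *)

Lemma wevE k l x f0 : size l = k -> size x = k ->
  wev l x = \prod_(i < k) nth f0 l i (nth 0 x i).
Proof.
elim: l x k => [|f l IH] [|v x] k <- //= => [_|[xl]]; first by rewrite big_ord0.
by rewrite big_ord_recl /=; congr (_ * _); apply: IH.
Qed.

Lemma wev_perm k (s : 'S_k) l x f0 : size l = k -> size x = k ->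
  wev l (perm_word 0 s x) = wev (perm_word f0 s^-1%g l) x.
Proof.
move=> lk xk; rewrite (wevE f0 lk) ?size_perm_word//.
rewrite (wevE f0 _ xk) ?size_perm_word//.
rewrite (reindex_inj (@perm_inj _ s^-1%g)); apply: eq_bigr => i _.
by rewrite !nth_perm_word permKV.
Qed.

Lemma Sym_linear : linear (@Sym _ V : T -> T).
Proof. by apply: tlift_linear; exact: sym_word_multilinear. Qed.

Lemma Sym_pure x : Sym (tpure x) = sym_word x :> T.
Proof. by rewrite /Sym tlift_pure//; exact: sym_word_multilinear. Qed.

Lemma all_lin_perm k (s : 'S_k) l f0 : size l = k -> all_lin l ->
  all_lin (perm_word f0 s l).
Proof. by move=> lk ll f /mapP[i _ ->]; apply: ll; rewrite mem_nth ?lk. Qed.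

Arguments all_lin_perm [k] s [l] f0 _ _ _ _.

Lemma weval_Sym k l X f0 : size l = k -> all_lin l ->
  weval l (Sym X) = (k`!%:R)^-1 * \sum_(s : 'S_k) weval (perm_word f0 s l) X.
Proof.
move=> lk ll; have lin s := weval_linear (all_lin_perm s f0 lk ll).
have lin' := weval_linear ll.
move: X; apply: tensor_ind => [|c x X IH].
  rewrite (lin0 Sym_linear) (lin0 lin') big1 ?mulr0// => s _.
  by rewrite (lin0 (lin s)).
rewrite Sym_linear lin' IH.
rewrite (eq_bigr _ (fun s _ => lin s c (tpure x) X)) big_split /= mulrDr; congr (_ + _).
rewrite -scaler_sumr /GRing.scale /= mulrCA; congr (_ * _).
rewrite Sym_pure /sym_word (linZ _ _ lin') (lin_sum _ _ _ lin').
have [xk|xk] := eqVneq (size x) k; last first.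
  rewrite !big1 => [|s _|s _]; first by rewrite mulr0 scaler0.
    rewrite weval_pure ?wev_size ?size_perm_word 1?eq_sym//.
    exact: all_lin_perm.
  by rewrite weval_pure// wev_size// size_map size_enum_ord lk eq_sym.
rewrite /GRing.scale /= xk; congr (_ * _).
have vinj : injective (fun s : 'S_k => s^-1)%g by exact: invg_inj.
rewrite [RHS](reindex_inj vinj) /=; apply: eq_bigr => s _.
rewrite !weval_pure//; last exact: all_lin_perm.
exact: wev_perm.
Qed.

Lemma weval_Sym_perm l l' X : all_lin l -> perm_eq l l' ->
  weval l (Sym X) = weval l' (Sym X).
Proof.
move=> ll ll'; have al' : all_lin l' by move=> f; rewrite -(perm_mem ll'); exact: ll.
pose f0 : V -> K := fun=> 0; have [s sE] := perm_eq_word f0 ll'.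
rewrite (weval_Sym X f0 (perm_size ll') ll) (weval_Sym X f0 erefl al').
congr (_ * _); rewrite [RHS](reindex_inj (mulIg s : injective (fun p : 'S_(size l') => p * s)%g)) /=; apply: eq_bigr => p _.
by rewrite {1}sE perm_wordM.
Qed.

Lemma tensor_form_Sym a X Y : pos_herm a ->
  tensor_form a X (Sym Y) = tensor_form a (Sym X) Y.
Proof.
move=> aP; move: X; apply: tensor_ind => [|c x X IH].
  by rewrite (lin0 Sym_linear) !(tensor_form0l aP).
rewrite Sym_linear !(tensor_form_linl aP) IH; congr (_ * _ + _).
pose f0 := a 0.
rewrite (tensor_form_pure aP) (weval_Sym Y f0 (size_map _ _) (all_lin_map aP x)).
rewrite mulVKf ?pnatr_eq0 -?lt0n ?fact_gt0//.
have fP := pos_herm_tensor aP.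
rewrite Sym_pure /sym_word (phZl fP) rmorphV ?unitfE ?pnatr_eq0 -?lt0n ?fact_gt0//.
rewrite rmorph_nat (ph_suml fP) mulr_sumr; apply: eq_bigr => s _.
rewrite (tensor_form_pure aP) size_map size_enum_ord.
rewrite mulKf ?pnatr_eq0 -?lt0n ?fact_gt0//; congr (weval _ _).
by rewrite -(map_perm_word a 0).
Qed.

(** [Sym] is idempotent and self-adjoint, hence an orthogonal projection. *)
Lemma tensor_norm_Sym a X : pos_herm a -> tensor_norm a (Sym X) <= tensor_norm a X.
Proof.
move=> aP; have fP := pos_herm_tensor aP.
have idem Z : tensor_form a Z (Sym (Sym X)) = tensor_form a Z (Sym X).
  move: Z; apply: tensor_ind => [|c x Z IH]; first by rewrite !(ph0l fP).
  rewrite !(tensor_form_linl aP) IH; congr (_ * _ + _).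
  have al := all_lin_map aP x; pose f0 := a 0.
  rewrite !(tensor_form_pure aP) (weval_Sym _ f0 (size_map _ _) al).
  rewrite (eq_bigr (fun=> weval (map a x) (Sym X))) => [|s _]; last first.
    symmetry; apply: weval_Sym_perm => //; rewrite perm_sym.
    by apply: perm_perm_word; rewrite size_map.
  by rewrite sumr_const card_Sn -[X in _^-1 * X]mulr_natl mulKf.
have [->|n0] := eqVneq (tensor_norm a (Sym X)) 0; first exact: sqrtr_ge0.
have np : 0 < tensor_norm a (Sym X) by rewrite lt_def n0 sqrtr_ge0.
rewrite -(ler_pM2r np) -expr2 [leLHS](sqr_hn fP).
rewrite -tensor_form_Sym// idem.
apply: le_trans (ph_CS fP _ _); apply: le_trans (Re_le_normc _); exact: ler_norm.
Qed.

(** * Products *)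

Lemma tmul_multilinear u : multilinear (fun v => tpure (u ++ v) : T).
Proof. by move=> v w c x y; rewrite !catA tpure_multilinear. Qed.

Lemma tmul_multilinear2 Y :
  multilinear (fun u => tlift (fun v => tpure (u ++ v)) Y : T).
Proof.
have fl u := tlift_linear (@tmul_multilinear u).
move=> u v c x y; move: Y; apply: tensor_ind => [|d w Y IH].
  by rewrite !(lin0 (fl _)) scaler0 addr0.
rewrite !fl IH !tlift_pure; try exact: tmul_multilinear.
rewrite -!catA !cat_cons tpure_multilinear !scalerDr !scalerA (mulrC d).
by rewrite addrACA.
Qed.

Lemma tmul_pure u v : tmul (tpure u) (tpure v) = tpure (u ++ v) :> T.
Proof.
rewrite /tmul tlift_pure; last exact: tmul_multilinear2.
by rewrite tlift_pure//; exact: tmul_multilinear.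
Qed.

Lemma tmul_linl Y : linear (fun X => tmul X Y : T).
Proof. exact: (tlift_linear (@tmul_multilinear2 Y)). Qed.

Lemma tmul_linr X : linear (tmul X : T -> T).
Proof.
move=> c Y Z; move: X; apply: tensor_ind => [|d u X IH].
  by rewrite !(lin0 (tmul_linl _)) scaler0 addr0.
rewrite !(tmul_linl _ d) IH.
have uE W : tmul (tpure u) W = tlift (fun v => tpure (u ++ v)) W.
  by rewrite /tmul tlift_pure//; exact: tmul_multilinear2.
rewrite !uE (tlift_linear (@tmul_multilinear u)).
by rewrite !scalerDr !scalerA (mulrC d) addrACA.
Qed.

Lemma wev_split l u v :
  wev l (u ++ v) = \sum_(i < (size l).+1) wev (take i l) u * wev (drop i l) v.
Proof.
have [lu|ul] := ltnP (size l) (size u).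
  rewrite wev_size ?size_cat ?ltn_eqF ?(leq_trans lu) ?leq_addr//.
  rewrite big1// => i _; rewrite [wev _ u]wev_size ?mul0r// size_takel.
    by rewrite ltn_eqF// (leq_ltn_trans _ lu)// -ltnS.
  by rewrite -ltnS.
have ui : (size u < (size l).+1)%N by [].
rewrite (bigD1 (Ordinal ui))//= [X in _ + X]big1 ?addr0.
  by rewrite -wev_cat ?cat_take_drop// size_takel.
by move=> i iu; rewrite [wev _ u]wev_size ?mul0r// size_takel -1?ltnS//.
Qed.

Lemma all_lin_take l i : all_lin l -> all_lin (take i l).
Proof. by move=> ll f /mem_take; exact: ll. Qed.
Lemma all_lin_drop l i : all_lin l -> all_lin (drop i l).
Proof. by move=> ll f /mem_drop; exact: ll. Qed.
Arguments all_lin_take [l] i _ _ _.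
Arguments all_lin_drop [l] i _ _ _.

Lemma weval_tmul l X Y : all_lin l -> weval l (tmul X Y) =
  \sum_(i < (size l).+1) weval (take i l) X * weval (drop i l) Y.
Proof.
move=> ll; have lin := weval_linear ll.
have lt i := weval_linear (all_lin_take i ll).
have ld i := weval_linear (all_lin_drop i ll).
move: X; apply: tensor_ind => [|c x X IH].
  rewrite (lin0 (tmul_linl _)) (lin0 lin) big1// => i _.
  by rewrite (lin0 (lt i)) mul0r.
rewrite tmul_linl lin IH.
rewrite [RHS](eq_bigr (fun i : 'I_(size l).+1 =>
    c * (weval (take i l) (tpure x) * weval (drop i l) Y) +
    weval (take i l) X * weval (drop i l) Y)) => [|i _]; last first.
  by rewrite (weval_lin c (tpure x) X (all_lin_take i ll)) mulrDl -mulrA.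
rewrite big_split /= -mulr_sumr; congr (_ + _).
rewrite /GRing.scale /=.
congr (_ * _); move: Y {IH}; apply: tensor_ind => [|d y Y IH].
  rewrite (lin0 (tmul_linr _)) (lin0 lin) big1// => i _.
  by rewrite (lin0 (ld i)) mulr0.
rewrite tmul_linr lin IH.
rewrite [RHS](eq_bigr (fun i : 'I_(size l).+1 =>
    d * (weval (take i l) (tpure x) * weval (drop i l) (tpure y)) +
    weval (take i l) (tpure x) * weval (drop i l) Y)) => [|i _]; last first.
  by rewrite (weval_lin d (tpure y) Y (all_lin_drop i ll)) mulrDr mulrCA.
rewrite big_split /= -mulr_sumr; congr (_ + _).
rewrite /GRing.scale /=.
congr (_ * _); rewrite tmul_pure weval_pure// wev_split; apply: eq_bigr => i _.
by rewrite !weval_pure//; [exact: all_lin_drop|exact: all_lin_take].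
Qed.

Lemma triangle_sum (N : nat) (G H : nat -> R) :
  (forall i, 0 <= G i) -> (forall i, 0 <= H i) ->
  \sum_(k < N) \sum_(i < k.+1) G i * H (k - i)%N <=
  (\sum_(k < N) G k) * (\sum_(k < N) H k).
Proof.
move=> G0 H0; rewrite mulr_suml.
have -> : \sum_(k < N) \sum_(i < k.+1) G i * H (k - i)%N =
    \sum_(k < N) \sum_(i < N | (i <= k)%N) G i * H (k - i)%N.
  apply: eq_bigr => k _.
  by rewrite (big_ord_widen _ (fun i => G i * H (k - i)%N) (ltn_ord k)).
rewrite (exchange_big_dep xpredT)//=; apply: ler_sum => i _.
rewrite -mulr_sumr ler_wpM2l//.
rewrite -(big_mkord (fun k => (i <= k)%N) (fun k => H (k - i)%N)).
rewrite (big_cat_nat (n := i))//=; last exact: ltnW.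
rewrite big_nat_cond big1 ?add0r => [|k /andP[/andP[_ ki] ik]]; last first.
  by rewrite leqNgt ki in ik.
rewrite big_nat_cond (eq_bigl (fun k => (i <= k < N)%N)); last first.
  by move=> k /=; rewrite andbAC andbb.
rewrite -big_nat -{1}[nat_of_ord i]add0n big_addn.
under eq_bigr do rewrite addnK.
rewrite -(big_mkord xpredT H) [leRHS](big_cat_nat (n := (N - i)%N))//= ?leq_subr//.
by rewrite lerDl sumr_ge0.
Qed.

(** Parseval for the product, Cauchy-Schwarz over the [k + 1] ways to cut a word
    of length [k], and the estimate [(k + 1) 'C(k, i) <= 4 ^ k], which the scaled
    forms absorb. *)
Lemma tensor_norm_tmul a X Y : pos_herm a -> tensor_norm a (tmul X Y) <=
  tensor_norm (scale_form (2 ^+ 2) a) X * tensor_norm (scale_form (2 ^+ 2) a) Y.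
Proof.
move=> aP; have [||ms [N [ml mb mE]]] := @tensor_parseval_diag _ _ _ aP [::] (tmul X Y).
- by [].
- by move=> v; rewrite big_nil; exact: ph_Re_ge0.
rewrite -ler_sqr ?nnegrE ?mulr_ge0 ?sqrtr_ge0//.
rewrite [leLHS](sqr_hn (pos_herm_tensor aP)) (mE N)//= exprMn.
pose S Z k := \sum_(l <- words ms k) normc (weval l Z) ^+ 2.
have S0 Z k : 0 <= S Z k by apply: sumr_ge0 => l _; exact: sqr_ge0.
pose G Z k := k`!%:R * ((2 ^+ 2) ^+ k * S Z k).
have G0 Z k : 0 <= G Z k by rewrite mulr_ge0// mulr_ge0// exprn_ge0.
apply: le_trans (_ : _ <= (\sum_(k < N) G X k) * (\sum_(k < N) G Y k)) _; last first.
  by apply: ler_pM; rewrite ?sumr_ge0//; apply: tensor_bessel_scale.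
apply: le_trans (triangle_sum _ (G0 X) (G0 Y)); apply: ler_sum => k _.
have lw l : l \in words ms k -> size l = k /\ all_lin l.
  rewrite mem_words => /andP[/eqP ? /allP lms]; split=> // f /lms; exact: ml.
apply: le_trans (_ : _ <= k`!%:R * \sum_(l <- words ms k)
    (k.+1%:R * \sum_(i < k.+1) normc (weval (take i l) X) ^+ 2 *
       normc (weval (drop i l) Y) ^+ 2)) _.
  rewrite ler_wpM2l// big_seq [leRHS]big_seq; apply: ler_sum => l /lw[lk al].
  rewrite weval_tmul// lk.
  under eq_bigr do rewrite -[weval (take _ _) _ * _]mul1r.
  apply: le_trans (normc_sum_CS _ _ _) _.
  rewrite normc1 expr1n sumr_const card_ord ler_wpM2l//.
  by apply: ler_sum => i _; rewrite normcM exprMn.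
rewrite -mulr_sumr exchange_big /= mulrA !mulr_sumr; apply: ler_sum => i _.
have ik : (i <= k)%N by rewrite -ltnS.
have -> : \sum_(l <- words ms k) normc (weval (take i l) X) ^+ 2 *
    normc (weval (drop i l) Y) ^+ 2 = S X i * S Y (k - i)%N.
  rewrite -{1}(subnKC ik) sum_words_cat /S mulr_suml.
  apply: eq_sum_words => l li; rewrite mulr_sumr; apply: eq_bigr => l' _.
  by rewrite take_size_cat// drop_size_cat.
have e4 : (2 ^+ 2 : R) ^+ k = (2 ^+ 2) ^+ i * (2 ^+ 2) ^+ (k - i).
  by rewrite -exprD subnKC.
rewrite [leRHS](_ : _ = i`!%:R * (k - i)`!%:R * (2 ^+ 2) ^+ k *
    (S X i * S Y (k - i)%N)); last first.
  rewrite e4 /G; move: ((2 ^+ 2) ^+ i) ((2 ^+ 2) ^+ (k - i)) => p q; ring.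
rewrite ler_wpM2r ?mulr_ge0// -natrM.
have -> : ((2 : R) ^+ 2) ^+ k = (2 ^ k * 2 ^ k)%:R.
  by rewrite natrM natrX -expr2 -!exprM mulnC.
rewrite -!natrM ler_nat -(bin_fact ik).
rewrite [leqLHS](_ : _ = (i`! * (k - i)`!) * ('C(k, i) * k.+1))%N; last first.
  by ring.
rewrite leq_mul2l; apply/orP; right; apply: leq_mul; last by rewrite ltn_expl.
apply: leq_trans (_ : \sum_(j < k.+1) 'C(k, j) <= _)%N.
  by rewrite (bigD1 (inord i))//= inordK// leq_addr.
have := expnDn 1 1 k; rewrite addn1 => ->; apply: leq_sum => j _.
by rewrite !exp1n !muln1.
Qed.

(** * Involution *)

Section Star.
Variable bar : V -> V.
Hypothesis bar_anti : forall c v w, bar (c *: v + w) = c^* *: bar v + bar w.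

Lemma star_multilinear :
  multilinear (fun x => tpure (rev (map bar x)) : conj_space T).
Proof.
move=> u v c x y; rewrite !map_cat /= !rev_cat !rev_cons !cat_rcons.
by rewrite bar_anti tpure_multilinear.
Qed.

Lemma tensor_star_pure x : tensor_star bar (tpure x) = tpure (rev (map bar x)).
Proof. exact: (tlift_pure star_multilinear x). Qed.

Lemma tensor_star_lin c X Y :
  tensor_star bar (c *: X + Y) = c^* *: tensor_star bar X + tensor_star bar Y.
Proof. exact: (tlift_linear star_multilinear c X Y). Qed.

Lemma tensor_star0 : tensor_star bar 0 = 0.
Proof. exact: (lin0 (tlift_linear star_multilinear)). Qed.

Definition fbar (f : V -> K) v := (f (bar v))^*.

Lemma fbar_lin f : lin_fun f -> lin_fun (fbar f).
Proof.
by move=> fl c v w; rewrite /fbar bar_anti fl rmorphD rmorphM /= conjCK.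
Qed.

Lemma all_lin_rev_fbar l : all_lin l -> all_lin (rev (map fbar l)).
Proof. by move=> ll f; rewrite mem_rev => /mapP[g /ll gl ->]; exact: fbar_lin. Qed.
Arguments all_lin_rev_fbar [l] _ _ _.

Lemma weval_star l X : all_lin l ->
  weval l (tensor_star bar X) = (weval (rev (map fbar l)) X)^*.
Proof.
move=> ll; have lin := weval_linear ll.
have lr := weval_linear (all_lin_rev_fbar ll).
move: X; apply: tensor_ind => [|c x X IH].
  by rewrite tensor_star0 (lin0 lin) (lin0 lr) rmorph0.
rewrite tensor_star_lin lin lr IH rmorphD rmorphM /=; congr (_ * _ + _).
rewrite tensor_star_pure !weval_pure//; last exact: all_lin_rev_fbar.
elim/last_ind: x l {ll lin lr IH} => [|x v IHx] [|f l].
- by rewrite /= rmorph1.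
- by rewrite !wev_size ?rmorph0// ?size_rev ?size_map.
- by rewrite !wev_size ?rmorph0// ?size_rev ?size_map size_rcons.
rewrite map_rcons rev_rcons [LHS]/= IHx /= rev_cons -!cats1.
have [xl|xl] := eqVneq (size l) (size x).
  rewrite wev_cat ?size_rev ?size_map//= rmorphM /= mulr1 /fbar conjCK mulrC.
  by [].
by rewrite !wev_size ?rmorph0 ?mulr0// ?size_cat ?size_rev ?size_map ?addn1.
Qed.

(** As the form is real, the conjugated functionals satisfy Bessel's inequality
    too; reversing words permutes the terms of the sum. *)
Lemma tensor_norm_star a X : pos_herm a ->
  (forall v w, (a v w)^* = a (bar v) (bar w)) ->
  tensor_norm a (tensor_star bar X) <= tensor_norm a X.
Proof.
move=> aP areal.
have [||ms [N [ml mb mE]]] := @tensor_parseval_diag _ _ _ aP [::] (tensor_star bar X).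
- by [].
- by move=> v; rewrite big_nil; exact: ph_Re_ge0.
have ml' : all_lin (map fbar ms).
  by move=> f /mapP[g /ml gl ->]; exact: fbar_lin.
have mb' : bessel a (map fbar ms).
  move=> v; rewrite big_map; under eq_bigr do rewrite /fbar normc_conj.
  by apply: le_trans (mb _) _; rewrite -areal; case: (a v v).
rewrite -ler_sqr ?nnegrE ?sqrtr_ge0// [leLHS](sqr_hn (pos_herm_tensor aP)).
rewrite (mE N)//=; apply: le_trans (tensor_bessel aP N X ml' mb').
apply: ler_sum => k _; rewrite ler_wpM2l// -(sum_words_rev (map fbar ms)).
rewrite words_map big_map le_eqVlt; apply/orP; left; apply/eqP.
rewrite big_seq [RHS]big_seq; apply: eq_bigr => l.
rewrite mem_words => /andP[_ /allP lms].
by rewrite weval_star ?normc_conj// => f /lms; exact: ml.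
Qed.

(** Reversal is itself a permutation of the letters, and conjugating by it
    permutes the symmetric group. *)
Lemma tensor_star_Sym X :
  tensor_star bar (Sym X) = Sym (tensor_star bar X).
Proof.
move: X; apply: tensor_ind => [|c x X IH].
  by rewrite (lin0 Sym_linear) tensor_star0 (lin0 Sym_linear).
rewrite Sym_linear (tensor_star_lin c (Sym (tpure x)) (Sym X)).
rewrite (tensor_star_lin c (tpure x) X).
rewrite (Sym_linear c^* (tensor_star bar (tpure x)) (tensor_star bar X)).
apply: (congr2 (fun A B => c^* *: A + B) _ IH).
rewrite tensor_star_pure !Sym_pure /sym_word.
set k := size x; set y := rev (map bar x).
have yk : size y = k by rewrite size_rev size_map.
rewrite yk -[_ *: _ in LHS]addr0 (tensor_star_lin _ _ 0) tensor_star0 addr0.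
rewrite fmorphV rmorph_nat; congr (_ *: _).
rewrite (big_morph (tensor_star bar) (id1 := 0) (op1 := +%R)); first last.
- exact: tensor_star0.
- by move=> Y Z; rewrite -[Y]scale1r tensor_star_lin rmorph1 !scale1r.
pose r := perm (@rev_ord_inj k).
have inj : injective (fun s : 'S_k => r * s * r)%g.
  by move=> s s' /mulIg /mulgI.
rewrite [RHS](reindex_inj inj) /=; apply: eq_bigr => s _.
rewrite tensor_star_pure; congr tpure.
rewrite -/(perm_word 0 s x) -/(perm_word 0 (r * s * r)%g y).
transitivity (rev (perm_word 0 s (map bar x))).
  by congr rev; exact: map_perm_word.
transitivity (perm_word 0 (r * s) (map bar x))%g; first exact: rev_perm_word.
have xk : size (map bar x) = k by rewrite size_map.
rewrite /y (perm_word_rev 0 _ xk).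
congr (perm_word _ _ _); rewrite -mulgA -[LHS]mulg1; congr (_ * _)%g.
by apply/permP => i; rewrite permM !permE rev_ordK.
Qed.

End Star.

End TensorNorm.

(** * Evaluation at a functional *)

Section Delta.
Variables (R : realType) (V : tvsType R[i]).
Local Notation K := R[i].
Local Notation T := (tensor_alg V).
Implicit Types (x y : seq V) (X Y : T).
Variable rho : V -> K.
Hypothesis rho_lin : lin_fun rho.

Lemma D_multilinear : multilinear (Dword rho).
Proof.
move=> u v c x y.
have rconsE w z : Dword rho (rcons w z) = ((size w).+1%:R * rho z) *: tpure w.
  case: w => [|w0 w] /=; first by [].
  by rewrite last_rcons size_rcons belast_rcons.
elim/last_ind: v => [|v z _].
  rewrite !cats1 !rconsE rho_lin scalerA -scalerDl; congr (_ *: _); ring.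
rewrite -!rcons_cons -!rcons_cat !rconsE tpure_multilinear !size_cat /=.
by rewrite scalerDr !scalerA; congr (_ *: _ + _); rewrite mulrC.
Qed.

Lemma D_linear : linear (Defs.D rho : T -> T).
Proof. exact: (tlift_linear D_multilinear). Qed.

Lemma D_rcons x v :
  Defs.D rho (tpure (rcons x v)) = ((size x).+1%:R * rho v) *: tpure x.
Proof.
rewrite /Defs.D tlift_pure; last exact: D_multilinear.
by case: x => [|x0 x] //=; rewrite last_rcons size_rcons belast_rcons.
Qed.

Lemma D_nil : Defs.D rho (tpure [::]) = 0.
Proof. by rewrite /Defs.D tlift_pure//; exact: D_multilinear. Qed.

Lemma iterD_linear t : linear (iter t (Defs.D rho) : T -> T).
Proof. by elim: t => [|t IH] c X Y //=; rewrite IH D_linear. Qed.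

Lemma degree0_linear : linear (@degree0 _ V : T -> K^o).
Proof.
apply: tlift_linear => u v c x y.
by case: u => [|? ?] /=; rewrite mulr0n scaler0 addr0.
Qed.

Lemma degree0_pure x : degree0 (tpure x) = (x == [::])%:R.
Proof.
rewrite /degree0 tlift_pure// => u v c y z.
by case: u => [|? ?] /=; rewrite mulr0n scaler0 addr0.
Qed.

(** [D] removes the last letter, so a word of length [t] reaches degree 0 after
    exactly [t] steps, having collected the factors [t], [t - 1], ..., [1]. *)
Lemma degree0_iterD t x : degree0 (iter t (Defs.D rho) (tpure x)) =
  (t == size x)%:R * t`!%:R * \prod_(v <- x) rho v.
Proof.
elim: t x => [|t IH] x.
  rewrite degree0_pure fact0 mulr1.
  by case: x => [|? ?]; rewrite ?mul0r// big_nil mulr1.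
case/lastP: x => [|x v].
  by rewrite iterSr D_nil (lin0 (iterD_linear _)) (lin0 degree0_linear) !mul0r.
rewrite iterSr D_rcons (linZ _ _ (iterD_linear _)) (linZ _ _ degree0_linear).
rewrite IH size_rcons eqSS -cats1 big_cat big_seq1 /= /GRing.scale /=.
case: eqP => [<-|_]; last by rewrite !mul0r mulr0.
by rewrite factS natrM; move: t.+1%:R (t`!%:R) => p q; ring.
Qed.

(** Hence the series defining [tau_star] is a finite sum. *)
Lemma iterD_vanish X : exists N, forall t, (N <= t)%N -> iter t (Defs.D rho) X = 0.
Proof.
have pure x t : (size x < t)%N -> iter t (Defs.D rho) (tpure x) = 0.
  elim: t x => // t IH x; case/lastP: x => [|x v].
    by rewrite iterSr D_nil (lin0 (iterD_linear _)).
  rewrite size_rcons ltnS => xt.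
  by rewrite iterSr D_rcons (linZ _ _ (iterD_linear _)) IH// scaler0.
move: X; apply: tensor_ind => [|c x X [N HN]].
  by exists 0%N => t _; rewrite (lin0 (iterD_linear _)).
exists (maxn N (size x).+1) => t; rewrite geq_max => /andP[Nt xt].
by rewrite iterD_linear pure// HN// scaler0 addr0.
Qed.

Lemma deltaE X : exists N, forall M, (N <= M)%N ->
  delta rho X = \sum_(t < M) (t`!%:R)^-1 * degree0 (iter t (Defs.D rho) X).
Proof.
have [N HN] := iterD_vanish X; exists N => M NM.
rewrite /delta /tau_star -(fsbig_widen `I_M setT)//=; last first.
  move=> t [_ /= /negP]; rewrite -leqNgt => Mt.
  by rewrite HN ?scaler0// (leq_trans NM).
rewrite -fsbig_ord (lin_sum _ _ _ degree0_linear); apply: eq_bigr => t _.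
by rewrite (linZ _ _ degree0_linear).
Qed.

Lemma delta_pure x : delta rho (tpure x) = \prod_(v <- x) rho v.
Proof.
have [N HN] := deltaE (tpure x); rewrite (HN (maxn N (size x).+1)) ?leq_maxl//.
have xN : (size x < maxn N (size x).+1)%N by rewrite leq_max ltnS leqnn orbT.
rewrite (bigD1 (Ordinal xN))//= degree0_iterD eqxx mul1r mulrA mulVf.
  rewrite mul1r [X in _ + X]big1 ?addr0// => t /eqP tx; rewrite degree0_iterD.
  case: eqP => [te|_]; last by rewrite !mul0r mulr0.
  by exfalso; apply: tx; exact: val_inj.
by rewrite pnatr_eq0 -lt0n fact_gt0.
Qed.

Lemma delta_linear : linear (delta rho : T -> K^o).
Proof.
move=> c X Y; have [N1 H1] := deltaE X; have [N2 H2] := deltaE Y.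
have [N3 H3] := deltaE (c *: X + Y).
pose M := maxn N1 (maxn N2 N3).
rewrite (H1 M) ?leq_maxl// (H2 M) ?leq_max ?leqnn ?orbT//.
rewrite (H3 M) ?leq_max ?leqnn ?orbT// /GRing.scale /= mulr_sumr -big_split.
apply: eq_bigr => t _ /=; rewrite iterD_linear degree0_linear /GRing.scale /=.
by ring.
Qed.

Lemma delta_Sym X : delta rho (Sym X) = delta rho X.
Proof.
have lin : linear (fun X : T => delta rho (Sym X) : K^o).
  by move=> c Y Z; rewrite Sym_linear delta_linear.
move: X; apply: (tensor_lin_eq lin delta_linear) => x.
rewrite Sym_pure /sym_word (linZ _ _ delta_linear) (lin_sum _ _ _ delta_linear).
rewrite (eq_bigr (fun=> delta rho (tpure x))) => [|s _]; last first.
  rewrite !delta_pure; apply: perm_big; exact: (@perm_perm_word _ 0 (size x)).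
by rewrite sumr_const card_Sn /GRing.scale /= -[X in _ * X]mulr_natl mulKf.
Qed.

Lemma delta_tmul X Y : delta rho (tmul X Y) = delta rho X * delta rho Y.
Proof.
have lin1 : linear (fun X : T => delta rho (tmul X Y) : K^o).
  by move=> c Z Z'; rewrite tmul_linl delta_linear.
have lin2 : linear (fun X : T => delta rho X * delta rho Y : K^o).
  by move=> c Z Z'; rewrite delta_linear mulrDl /GRing.scale /= mulrA.
move: X; apply: (tensor_lin_eq lin1 lin2) => x.
have lin3 : linear (fun Y : T => delta rho (tmul (tpure x) Y) : K^o).
  by move=> c Z Z'; rewrite tmul_linr delta_linear.
have lin4 : linear (fun Y : T => delta rho (tpure x) * delta rho Y : K^o).
  by move=> c Z Z'; rewrite delta_linear mulrDr /GRing.scale /= mulrCA.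
move: Y {lin1 lin2}; apply: (tensor_lin_eq lin3 lin4) => y.
by rewrite tmul_pure !delta_pure big_cat.
Qed.

End Delta.

(** * Tensors with real letters *)

Section RealTensors.
Variables (R : realType) (V : tvsType R[i]) (bar : V -> V).
Local Notation K := R[i].
Local Notation T := (tensor_alg V).
Hypothesis bar_anti : forall c v w, bar (c *: v + w) = c^* *: bar v + bar w.
Hypothesis barK : involutive bar.

Lemma bar0 : bar 0 = 0.
Proof.
by have := bar_anti (-1) 0 0; rewrite scaler0 addr0 rmorphN1 scaleN1r addNr.
Qed.
Lemma barZ c v : bar (c *: v) = c^* *: bar v.
Proof. by rewrite -[c *: v]addr0 bar_anti bar0 addr0. Qed.
Lemma barD v w : bar (v + w) = bar v + bar w.
Proof. by rewrite -[v]scale1r bar_anti rmorph1 !scale1r. Qed.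
Lemma barN v : bar (- v) = - bar v.
Proof. by rewrite -scaleN1r barZ rmorphN1 scaleN1r. Qed.

Lemma real_imag v : exists p : V * V,
  [/\ bar p.1 = p.1, bar p.2 = p.2 & v = 'i *: p.2 + p.1].
Proof.
have n2 : (2 : K) != 0 by rewrite pnatr_eq0.
exists (2^-1 *: (v + bar v), (- 'i / 2) *: (v - bar v)); split=> /=.
- by rewrite barZ barD barK addrC fmorphV rmorph_nat.
- rewrite barZ barD barN barK rmorphM rmorphN /= conjCi opprK fmorphV rmorph_nat.
  by rewrite -[bar v - v]opprB scalerN -scaleNr mulNr.
rewrite scalerA mulrA mulrN -expr2 sqrCi opprK mul1r -scalerDr.
have -> : v - bar v + (v + bar v) = (2 : K) *: v.
  by rewrite addrACA addNr addr0 scaler_nat mulr2n.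
by rewrite scalerA mulVf// scale1r.
Qed.

(** Real letters matter since [a v] belongs to the real dual only for real [v]. *)
Lemma tensor_span_real X : exists s : seq (K * seq V),
  X = \sum_(p <- s) p.1 *: tpure p.2 /\
  forall p v, p \in s -> v \in p.2 -> bar v = v.
Proof.
pose P (X : T) := exists s : seq (K * seq V),
  X = \sum_(p <- s) p.1 *: tpure p.2 /\
  forall p v, p \in s -> v \in p.2 -> bar v = v.
have P0 : P 0 by exists [::]; rewrite big_nil.
have PD c Y Z : P Y -> P Z -> P (c *: Y + Z).
  move=> [s [-> sr]] [s' [-> s'r]].
  exists ([seq (c * p.1, p.2) | p <- s] ++ s'); split.
    rewrite big_cat big_map /=; congr (_ + _).
    by rewrite scaler_sumr; apply: eq_bigr => p _; rewrite scalerA.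
  by move=> p v; rewrite mem_cat => /orP[/mapP[q /sr qr ->]/qr|/s'r]; apply.
suff PT u x : (forall v, v \in u -> bar v = v) -> P (tpure (u ++ x)).
  by apply: (tensor_ind P0) => c x Y PY; apply: PD => //; exact: (PT [::]).
elim: x u => [|v x IH] u ur.
  exists [:: (1, u)]; rewrite big_seq1 scale1r cats0; split=> // p w.
  by rewrite inE => /eqP ->; exact: ur.
have [[v1 v2] /= [r1 r2 ->]] := real_imag v.
rewrite tpure_multilinear; apply: PD; rewrite -cat_rcons; apply: IH => w;
  by rewrite mem_rcons inE => /orP[/eqP->//|/ur].
Qed.

End RealTensors.

(** * Derivatives of the polynomial of a tensor *)

Section Derivatives.
Variables (R : realType) (V : tvsType R[i]).
Local Notation K := R[i].
Local Notation T := (tensor_alg V).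
Implicit Types (l w ls es : seq (V -> K)) (x y : seq V) (X Y : T) (s : V -> K).

(** The iterated derivative at [s] in the directions [w] of the polynomial function
    of a symmetric tensor: in degree [n] it evaluates [w] followed by [n - size w]
    copies of [s], once for each injection of [w] into the letters. *)
Definition Qd s w X : K := tlift (fun x =>
  (size x ^_ size w)%:R * wev (w ++ nseq (size x - size w) s) x : K^o) X.

Lemma all_lin_nseq s n : lin_fun s -> all_lin (nseq n s).
Proof. by move=> sl f; rewrite mem_nseq => /andP[_ /eqP->]. Qed.

Lemma all_lin_Q s w n : lin_fun s -> all_lin w -> all_lin (w ++ nseq n s).
Proof. by move=> sl wl; apply/all_lin_cat; split=> //; exact: all_lin_nseq. Qed.

Arguments all_lin_nseq [s] n _ _ _.
Arguments all_lin_Q [s w] n _ _ _ _.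

Lemma Qd_multilinear s w : lin_fun s -> all_lin w -> multilinear (fun x =>
  (size x ^_ size w)%:R * wev (w ++ nseq (size x - size w) s) x : K^o).
Proof.
move=> sl wl u v c x y; rewrite !size_cat /=.
rewrite (wev_multilinear (all_lin_Q _ sl wl)) mulrDr /GRing.scale /=.
by rewrite mulrCA.
Qed.

Lemma Qd_linear s w : lin_fun s -> all_lin w -> linear (Qd s w : T -> K^o).
Proof. by move=> sl wl; apply: tlift_linear; exact: Qd_multilinear. Qed.

Lemma Qd_pure s w x : lin_fun s -> all_lin w -> Qd s w (tpure x) =
  (size x ^_ size w)%:R * wev (w ++ nseq (size x - size w) s) x.
Proof. by move=> sl wl; rewrite /Qd tlift_pure//; exact: Qd_multilinear. Qed.

Lemma Qd_sum X : exists N0, forall N s w, (N0 <= N)%N -> lin_fun s -> all_lin w ->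
  Qd s w X = \sum_(n < N) (n ^_ size w)%:R * weval (w ++ nseq (n - size w) s) X.
Proof.
move: X; apply: tensor_ind => [|c x X [N0 HN]].
  exists 0%N => N s w _ sl wl; rewrite (lin0 (Qd_linear sl wl)) big1// => n _.
  by rewrite weval0 ?mulr0//; exact: all_lin_Q.
exists (maxn N0 (size x).+1) => N s w; rewrite geq_max => /andP[N0N xN] sl wl.
rewrite (Qd_linear sl wl) (HN N)// Qd_pure//.
under [RHS]eq_bigr => n _.
  rewrite weval_lin; last exact: all_lin_Q.
  rewrite mulrDr mulrCA weval_pure; last exact: all_lin_Q.
  over.
rewrite big_split /=; congr (_ + _); rewrite -mulr_sumr; congr (_ * _).
rewrite (bigD1 (Ordinal xN))//= big1 ?addr0// => n nx.
have [nw|wn] := ltnP n (size w); first by rewrite ffact_small ?mul0r.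
rewrite wev_size ?mulr0// size_cat size_nseq subnKC//.
Qed.

Lemma Qd_delta s X : lin_fun s -> Qd s [::] X = delta s X.
Proof.
move=> sl; have nl : all_lin ([::] : seq (V -> K)) by [].
apply: (tensor_lin_eq (Qd_linear sl nl) (delta_linear sl)) => x.
rewrite Qd_pure// delta_pure// ffactn0 mul1r subn0 /=.
by elim: x => [|v x IH] /=; rewrite ?big_nil// big_cons IH.
Qed.

(** At the origin only the component of degree [size w] remains: in higher degree
    a copy of the zero functional is evaluated. *)
Lemma Qd0 w X : all_lin w -> Qd (fun=> 0) w X = (size w)`!%:R * weval w X.
Proof.
move=> wl; have zl : lin_fun (fun _ : V => 0 : K) by move=> *; rewrite mulr0 addr0.
have lin : linear (fun X => (size w)`!%:R * weval w X : K^o).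
  by move=> c Y Z; rewrite weval_lin// /GRing.scale /=; ring.
apply: (tensor_lin_eq (Qd_linear zl wl) lin) => x.
rewrite Qd_pure// weval_pure//.
have [xw|wx|->] := ltngtP (size x) (size w).
- by rewrite ffact_small// mul0r wev_size ?mulr0// gtn_eqF.
- rewrite [X in _ = _ * X]wev_size ?mulr0 ?ltn_eqF// [wev _ _](_ : _ = 0) ?mulr0//.
  have -> : x = take (size w) x ++ drop (size w) x by rewrite cat_take_drop.
  rewrite wev_cat ?size_takel//; last exact: ltnW.
  rewrite size_cat size_takel ?size_drop ?subnKC//; try exact: ltnW.
  have := size_drop (size w) x; case: (drop _ _) => [|v x'].
    by move/esym/eqP; rewrite subn_eq0 leqNgt wx.
  by move=> <- /=; rewrite mul0r mulr0.
- by rewrite ffactnn subnn cats0.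
Qed.

Lemma geo_half N : \sum_(n < N) (2^-1 : R) ^+ n <= 2.
Proof.
suff -> : \sum_(n < N) (2^-1 : R) ^+ n = 2 - 2 * (2^-1) ^+ N.
  by rewrite gerBl mulr_ge0// exprn_ge0.
elim: N => [|N IH]; first by rewrite big_ord0 expr0; ring.
by rewrite big_ord_recr /= IH exprS; field.
Qed.

Lemma bin_le n k : ('C(n, k) <= 2 ^ n)%N.
Proof.
have [nk|kn] := ltnP n k; first by rewrite bin_small.
have := expnDn 1 1 n; rewrite addn1 => ->.
rewrite (bigD1 (inord k))//= inordK// !exp1n !muln1; exact: leq_addr.
Qed.

Lemma ffact_le n k : (n ^_ k)%:R <= k`!%:R * 2 ^+ n :> R.
Proof. by rewrite -bin_ffact natrM mulrC ler_wpM2l// -natrX ler_nat bin_le. Qed.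

(** In degree [n] the falling factorial is at most [k! 2 ^ n], while the scaling
    by [4 ^ 2] bounds values of words of length [n] by [4 ^- n]: a geometric series
    remains. *)
Lemma Qd_bound a ls s w X : pos_herm a -> all_lin ls -> bessel a ls ->
  s \in ls -> {subset w <= ls} ->
  normc (Qd s w X) <= (size w)`!%:R * 2 * tensor_norm (scale_form (4 ^+ 2) a) X.
Proof.
move=> aP ll lb sls wls; have [N0 HN] := Qd_sum X.
have sl := ll _ sls; have wl : all_lin w by move=> f /wls /ll.
rewrite (HN N0)//; apply: le_trans (normc_sum _ _ _) _.
set M := tensor_norm _ _.
have M0 : 0 <= M by exact: sqrtr_ge0.
apply: le_trans (_ : _ <= \sum_(n < N0) (size w)`!%:R * 2^-1 ^+ n * M) _.
  apply: ler_sum => n _; rewrite normcM normc_nat.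
  have [nw|wn] := ltnP n (size w).
    by rewrite ffact_small// mul0r mulr_ge0// mulr_ge0// exprn_ge0.
  have sz : size (w ++ nseq (n - size w) s) = n by rewrite size_cat size_nseq subnKC.
  have := @word_bound _ _ a 4 ls (w ++ nseq (n - size w) s) X aP ll lb (ler0n _ _).
  have sub : {subset w ++ nseq (n - size w) s <= ls}.
    by move=> f; rewrite mem_cat mem_nseq => /orP[/wls//|/andP[_ /eqP->]].
  move=> /(_ sub); rewrite sz -/M => H.
  apply: le_trans (_ : _ <= (size w)`!%:R * 2 ^+ n * (4 ^- n * M)) _.
    apply: ler_pM => //; [exact: normc_ge0|exact: ffact_le|].
    by rewrite mulrC ler_pdivlMr ?exprn_gt0// mulrC.
  rewrite !mulrA ler_wpM2r// -mulrA ler_wpM2l// -exprVn -exprMn.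
  by rewrite (_ : 2 * 4^-1 = 2^-1 :> R)//; field.
rewrite -mulr_suml ler_wpM2r// -mulr_sumr ler_wpM2l//; exact: geo_half.
Qed.

Section Remainder.
Variables (Y : T) (s r : V -> K) (t : R) (ls : seq (V -> K)) (n : nat) (B : R).
Hypotheses (sym : forall l l', all_lin l -> perm_eq l l' -> weval l Y = weval l' Y).
Hypotheses (ll : all_lin ls) (sls : s \in ls) (rls : r \in ls).
Hypothesis t1 : `|t| <= 1.
Hypothesis AB : forall l, {subset l <= ls} -> size l = n -> normc (weval l Y) <= B.

Let st v := s v + (t%:C)%C * r v.
Let sl := ll sls.
Let rl := ll rls.

Local Lemma st_lin : lin_fun st.
Proof. by move=> c v w; rewrite /st sl rl; ring. Qed.

Local Lemma st_expand w m : all_lin w ->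
  weval (w ++ nseq m.+1 st) Y =
  (t%:C)%C * weval (rcons w r ++ nseq m st) Y + weval (rcons w s ++ nseq m st) Y.
Proof.
move=> wl; rewrite !cat_rcons; apply: weval_letter => //.
- exact: all_lin_nseq st_lin.
- by move=> v; rewrite /st addrC.
Qed.

Local Lemma sub_rcons w f : {subset w <= ls} -> f \in ls -> {subset rcons w f <= ls}.
Proof. by move=> wl fl g; rewrite mem_rcons inE => /orP[/eqP->|/wl]. Qed.

Local Lemma sub_lin w : {subset w <= ls} -> all_lin w.
Proof. by move=> wl f /wl /ll. Qed.

(** The three estimates split the [m] copies of [s + t r] one at a time; each split
    doubles the number of terms, and [rem2] collects the linear terms. *)
Lemma rem0 m w : {subset w <= ls} -> (size w + m = n)%N ->
  normc (weval (w ++ nseq m st) Y) <= 2 ^+ m * B.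
Proof.
elim: m w => [|m IH] w wls wm.
  by rewrite cats0 mul1r; apply: AB => //; rewrite -wm addn0.
rewrite st_expand; last exact: sub_lin.
apply: le_trans (normcD _ _) _; rewrite normcM normc_real exprS -mulrA mulrDl mul1r.
have sz f : (size (rcons w f) + m = n)%N by rewrite size_rcons addSnnS.
rewrite lerD ?IH//; try exact: sub_rcons.
rewrite -[leRHS]mul1r; apply: ler_pM => //; first exact: normc_ge0.
by apply: IH => //; exact: sub_rcons.
Qed.

Lemma rem1 m w : {subset w <= ls} -> (size w + m = n)%N ->
  normc (weval (w ++ nseq m st) Y - weval (w ++ nseq m s) Y) <= `|t| * (2 ^+ m * B).
Proof.
elim: m w => [|m IH] w wls wm.
  rewrite subrr normc0 mulr_ge0// mulr_ge0// (le_trans (normc_ge0 _) (AB wls _))//.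
  by rewrite -wm addn0.
rewrite st_expand; last exact: sub_lin.
have sz f : (size (rcons w f) + m = n)%N by rewrite size_rcons addSnnS.
rewrite -[nseq m.+1 s]/(s :: nseq m s) -cat_rcons -addrA.
apply: le_trans (normcD _ _) _; rewrite normcM normc_real exprS -mulrA mulrDl mul1r.
rewrite mulrDr lerD// ?IH//; try exact: sub_rcons.
by rewrite ler_wpM2l// rem0//; exact: sub_rcons.
Qed.

Lemma rem2 m w : {subset w <= ls} -> (size w + m = n)%N ->
  normc (weval (w ++ nseq m st) Y - weval (w ++ nseq m s) Y -
    (t%:C)%C * (m%:R * weval (r :: w ++ nseq m.-1 s) Y)) <= t ^+ 2 * (2 ^+ m * B).
Proof.
elim: m w => [|m IH] w wls wm.
  rewrite subrr mul0r mulr0 subrr normc0 mulr_ge0 ?sqr_ge0// mulr_ge0//.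
  by rewrite (le_trans (normc_ge0 _) (AB wls _))// -wm addn0.
rewrite st_expand; last exact: sub_lin.
have sz f : (size (rcons w f) + m = n)%N by rewrite size_rcons addSnnS.
rewrite -[nseq m.+1 s]/(s :: nseq m s) -cat_rcons /=.
have wl := sub_lin wls.
have sE : weval (rcons w r ++ nseq m s) Y = weval (r :: w ++ nseq m s) Y.
  apply: sym; first by apply: all_lin_Q => //; apply: sub_lin; exact: sub_rcons.
  by rewrite -cat_cons perm_cat2r perm_rcons.
have sE2 : m%:R * weval (r :: rcons w s ++ nseq m.-1 s) Y =
    m%:R * weval (r :: w ++ nseq m s) Y.
  by case: m {IH wm sz sE} => [|m]; rewrite ?mul0r// cat_rcons.
set u := weval (rcons w r ++ nseq m st) Y; set u' := weval (rcons w s ++ nseq m st) Y.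
rewrite (_ : _ - _ = (u' - weval (rcons w s ++ nseq m s) Y -
    (t%:C)%C * (m%:R * weval (r :: rcons w s ++ nseq m.-1 s) Y)) +
    (t%:C)%C * (u - weval (rcons w r ++ nseq m s) Y)); last first.
  by rewrite sE sE2 -natr1; ring.
apply: le_trans (normcD _ _) _; rewrite normcM normc_real.
rewrite [2 ^+ m.+1]exprS -mulrA mulrDl mul1r mulrDr lerD// ?IH//; try exact: sub_rcons.
rewrite -(real_normK (num_real t)) expr2 -[leRHS]mulrA ler_wpM2l// rem1//.
exact: sub_rcons.
Qed.

End Remainder.

(** The remainder is bounded by a seminorm of the tensor, uniformly in the
    direction of the increment: this lets differentiation pass to the
    completion. Degree by degree it is [rem2]; the scaling by [8 ^ 2] beats the
    factor [4 ^ n] of the falling factorial and of [rem2]. *)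
Lemma Qd_remainder a ls s r (t : R) w (Y : T) : pos_herm a -> all_lin ls ->
  bessel a ls -> s \in ls -> r \in ls -> {subset w <= ls} -> `|t| <= 1 ->
  (forall l l', all_lin l -> perm_eq l l' -> weval l Y = weval l' Y) ->
  normc (Qd (fun v => s v + (t%:C)%C * r v) w Y - Qd s w Y -
         (t%:C)%C * Qd s (r :: w) Y) <=
  t ^+ 2 * ((size w)`!%:R * 2 * tensor_norm (scale_form (8 ^+ 2) a) Y).
Proof.
move=> aP ll lb sls rls wls t1 sym; have [N0 HN] := Qd_sum Y.
have sl := ll _ sls; have rl := ll _ rls.
have wl : all_lin w by move=> f /wls /ll.
have stl : lin_fun (fun v => s v + (t%:C)%C * r v).
  by move=> c v v'; rewrite sl rl; ring.
have rwl : all_lin (r :: w) by apply/all_lin_cons.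
rewrite !(HN N0)// -sumrB mulr_sumr -sumrB; apply: le_trans (normc_sum _ _ _) _.
set M := tensor_norm _ _; have M0 : 0 <= M by exact: sqrtr_ge0.
apply: le_trans (_ : _ <= \sum_(n < N0) t ^+ 2 * ((size w)`!%:R * 2^-1 ^+ n * M)) _.
  apply: ler_sum => n _; have [nw|wn] := ltnP n (size w).
    rewrite !ffact_small//= 1?ltnW// !mul0r mulr0 !subr0 normc0.
    by rewrite mulr_ge0 ?sqr_ge0// mulr_ge0// mulr_ge0// exprn_ge0.
  pose m := (n - size w)%N.
  have bnd l : {subset l <= ls} -> size l = n -> normc (weval l Y) <= 8 ^- n * M.
    move=> lls <-; have := @word_bound _ _ a 8 ls l Y aP ll lb (ler0n _ _) lls.
    by rewrite -/M => H; rewrite mulrC ler_pdivlMr ?exprn_gt0// mulrC.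
  have wm : (size w + m = n)%N by rewrite subnKC.
  have := rem2 sym ll sls rls t1 bnd wls wm.
  move: (t ^+ 2) (sqr_ge0 t) => q q0; rewrite [size (r :: w)]/= ffactnSr natrM subnS -/m -!mulrA => H.
  rewrite (mulrCA (t%:C)%C) -!mulrBr normcM normc_nat.
  apply: le_trans (_ : _ <= (size w)`!%:R * 2 ^+ n * (q * (2 ^+ m * (8 ^- n * M)))) _.
    by apply: ler_pM => //; [exact: normc_ge0|exact: ffact_le].
  rewrite mulrCA ler_wpM2l// -!mulrA ler_wpM2l//.
  rewrite !mulrA ler_wpM2r// -exprD.
  apply: le_trans (_ : 2 ^+ (n + n) * 8 ^- n <= _).
    rewrite ler_wpM2r ?invr_ge0 ?exprn_ge0// -!natrX ler_nat leq_exp2l//.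
    by rewrite leq_add2l leq_subr.
  rewrite exprD -exprVn -!exprMn.
  by rewrite (_ : 2 * 2 * 8^-1 = 2^-1 :> R)//; field.
rewrite -mulr_sumr ler_wpM2l ?sqr_ge0// -mulr_suml ler_wpM2r//.
rewrite -mulr_sumr ler_wpM2l//; exact: geo_half.
Qed.

Lemma sum_words_nseq (A : Type) (x : A) (es : seq A) n (F : seq A -> R) :
  (forall z, 0 <= F z) -> F (nseq n x) <= \sum_(z <- words (x :: es) n) F z.
Proof.
elim: n F => [|n IH] F F0; first by rewrite sum_words0.
rewrite sum_wordsS big_cons (le_trans (IH (fun z => F (x :: z)) _))//.
by rewrite lerDl sumr_ge0// => i _; rewrite sumr_ge0.
Qed.

(** For different [j] the words [t ++ nseq (n - j) x] differ, the head [x] of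
    [x :: es] being told apart from the entries of [es] by its position. *)
Lemma sum_words_pad (A : Type) (x : A) (es : seq A) n k (F : seq A -> R) :
  (forall z, 0 <= F z) ->
  \sum_(j < k | (j <= n)%N) \sum_(t <- words es j) F (t ++ nseq (n - j) x)
  <= \sum_(z <- words (x :: es) n) F z.
Proof.
elim: n k F => [|n IH] [|k] F F0.
- by rewrite big_ord0 sumr_ge0.
- rewrite big_mkcond big_ord_recl /= [X in _ + X]big1 ?addr0 => [|i _]; last by [].
  by rewrite !big_seq1.
- by rewrite big_ord0 sumr_ge0.
rewrite [leRHS]sum_wordsS [leRHS]big_cons big_mkcond big_ord_recl /=.
rewrite big_seq1 lerD//.
  exact: (@sum_words_nseq _ x es n (fun z => F (x :: z))).
rewrite (eq_bigr (fun j : 'I_k => \sum_(i <- es) if (j <= n)%N then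
   \sum_(t <- words es j) F (i :: t ++ nseq (n - j) x) else 0)) => [|j _]; last first.
  rewrite /bump leq0n add1n ltnS subSS; case: ifP => _; last by rewrite big1.
  by rewrite sum_wordsS.
rewrite exchange_big; apply: ler_sum => i _; rewrite -big_mkcond /=.
exact: (IH k (fun z => F (i :: z))).
Qed.

(** On degree [n] the derivative is a falling factorial times the value of a word
    padded by [s]. Cauchy-Schwarz with the weights [2 ^ n] separates the degrees;
    since the square of [n ^_ k] divided by [k!] is at most [2 ^ n n!], all terms
    fit into one Bessel sum for [s :: es]. *)
Lemma Qd_HS a es s X k0 : pos_herm a -> all_lin (s :: es) -> bessel a (s :: es) ->
  \sum_(k < k0) (k`!%:R)^-1 * \sum_(t <- words es k) normc (Qd s t X) ^+ 2
  <= 2 * tensor_norm (scale_form (2 ^+ 2) a) X ^+ 2.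
Proof.
move=> aP ll lb; have [N0 HN] := Qd_sum X.
have [sl el] := (all_lin_cons _ _).1 ll.
apply: le_trans (_ : _ <= 2 * \sum_(n < N0) n`!%:R * ((2 ^+ 2) ^+ n *
    \sum_(l <- words (s :: es) n) normc (weval l X) ^+ 2)) _; last first.
  by rewrite ler_wpM2l//; exact: tensor_bessel_scale.
pose F l := normc (weval l X) ^+ 2.
have F0 l : 0 <= F l by exact: sqr_ge0.
pose c n : R := n`!%:R * (2 ^+ 2) ^+ n.
have c0 n : 0 <= c n by rewrite mulr_ge0// exprn_ge0.
apply: le_trans (_ : _ <= 2 * \sum_(n < N0) c n *
   \sum_(j < k0 | (j <= n)%N) \sum_(t <- words es j) F (t ++ nseq (n - j) s)) _; last first.
  rewrite ler_wpM2l//; apply: ler_sum => n _; rewrite [leRHS]mulrA ler_wpM2l//.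
  exact: sum_words_pad.
under [X in _ <= 2 * X]eq_bigr do rewrite mulr_sumr.
rewrite mulr_sumr (eq_bigr (fun n : 'I_N0 => \sum_(j < k0) if (j <= n)%N then
   2 * (c n * \sum_(t <- words es j) F (t ++ nseq (n - j) s)) else 0)); last first.
  by move=> n _; rewrite mulr_sumr big_mkcond.
rewrite exchange_big; apply: ler_sum => k _ /=.
rewrite [leRHS](_ : _ = \sum_(t <- words es k)
    2 * \sum_(n < N0 | (k <= n)%N) c n * F (t ++ nseq (n - k) s)); last first.
  under [RHS]eq_bigr do rewrite mulr_sumr.
  rewrite exchange_big -big_mkcond /=; apply: eq_bigr => n _.
  by rewrite !mulr_sumr.
rewrite mulr_sumr /= big_seq [leRHS]big_seq.
apply: ler_sum => t; rewrite mem_words => /andP[/eqP tk /allP tes].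
have tl : all_lin t by move=> f /tes /el.
rewrite (HN N0)// tk.
have half n : (Num.sqrt (2^-1 ^+ n) * Num.sqrt (2 ^+ n) : R) = 1.
  by rewrite -sqrtrM ?exprn_ge0// -exprMn mulVf// expr1n sqrtr1.
rewrite (eq_bigr (fun n : 'I_N0 => ((Num.sqrt (2^-1 ^+ n))%:C)%C *
  (((Num.sqrt (2 ^+ n))%:C)%C * ((n ^_ k)%:R *
     weval (t ++ nseq (n - k) s) X)))); last first.
  by move=> n _; rewrite mulrA -rmorphM half rmorph1 mul1r.
rewrite mulrC.
apply: le_trans (_ : _ <= (2 * \sum_(n < N0) 2 ^+ n * ((n ^_ k)%:R ^+ 2 *
   F (t ++ nseq (n - k) s))) / k`!%:R) _.
  rewrite ler_wpM2r ?invr_ge0//; apply: le_trans (normc_sum_CS _ _ _) _.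
  apply: ler_pM; try by apply: sumr_ge0 => n _; exact: sqr_ge0.
    apply: le_trans (geo_half N0); apply: ler_sum => n _.
    by rewrite normc_real real_normK ?num_real// sqr_sqrtr// exprn_ge0.
  apply: ler_sum => n _; rewrite !normcM normc_real !exprMn.
  by rewrite real_normK ?num_real// sqr_sqrtr ?exprn_ge0// normc_nat.
rewrite -mulrA ler_wpM2l// mulr_suml [leRHS]big_mkcond; apply: ler_sum => n _.
case: leqP => [kn|nk]; last by rewrite ffact_small// expr0n mul0r mulr0 mul0r.
rewrite [leLHS](_ : _ = (2 ^+ n * ((n ^_ k)%:R ^+ 2 / k`!%:R)) *
    F (t ++ nseq (n - k) s)); last by ring.
rewrite ler_wpM2r// /c.
have -> : (2 ^+ 2 : R) ^+ n = 2 ^+ n * 2 ^+ n by rewrite -exprM mulnC exprM expr2.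
rewrite [leRHS]mulrCA ler_wpM2l ?exprn_ge0// ler_pdivrMr ?ltr0n ?fact_gt0//.
rewrite expr2 -{1}bin_ffact natrM [leRHS](_ : _ = 2 ^+ n * k`!%:R * n`!%:R); last by ring.
apply: ler_pM => //; first by rewrite ler_wpM2r// -natrX ler_nat bin_le.
by rewrite ler_nat -(ffact_fact kn) leq_pmulr// fact_gt0.
Qed.

End Derivatives.

(** * Continuous forms *)

Section ContForms.
Variables (R : realType) (V : tvsType R[i]).
Local Notation K := R[i].
Local Notation C := (R[i]^o).
Implicit Types (a b : V -> V -> K).

Lemma cph_pos a : cont_pos_herm a -> pos_herm a.
Proof. by case=> lr ll h p _; split. Qed.

Lemma cph_scale a (c : R) : cont_pos_herm a -> 0 <= c ->
  cont_pos_herm (scale_form c a).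
Proof.
move=> ac c0; have [lr ll h p] := pos_hermZ (cph_pos ac) c0; split=> // x.
rewrite /scale_form.
have -> : (fun p : V * V => (c%:C)%C * a p.1 p.2 : C) =
    (fun p : V * V => ((c%:C)%C : C) *: (a p.1 p.2 : C)) by [].
by apply: cvgZr; exact: (form_cont ac).
Qed.

Definition add_form a b v w : K := a v w + b v w.

Lemma cph_add a b : cont_pos_herm a -> cont_pos_herm b ->
  cont_pos_herm (add_form a b).
Proof.
move=> ac bc; have [lr ll h p] := pos_hermD (cph_pos ac) (cph_pos bc).
split=> // x; apply: (@cvgD K C); [exact: (form_cont ac)|exact: (form_cont bc)].
Qed.

Lemma form_norm_near a v (eps : R) : cont_pos_herm a -> 0 < eps ->
  \forall w \near v, form_norm a (w - v) < eps.
Proof.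
move=> ac e0; have aP := cph_pos ac.
have sub U : nbhs (0 : V) U -> \forall w \near v, U (w - v).
  move=> nU; have : nbhs (v, v) [set p : V * V | U (p.1 - p.2)].
    by apply: (@sub_continuous V (v, v)); rewrite /= subrr.
  case=> [[N1 N2] /= [n1 n2] NB]; apply: filterS n1 => w N1w.
  by apply: (NB (w, v)); split=> //=; exact: nbhs_singleton.
have ca : forall p : V * V, (fun q : V * V => a q.1 q.2 : C) @ p --> (a p.1 p.2 : C).
  exact: form_cont ac.
move: (ca (0, 0)) => /cvgC_normc => /(_ (eps ^+ 2)).
rewrite exprn_gt0// => /(_ isT) [[N1 N2] /= [n1 n2] NB].
apply: filterS (sub _ (filterI n1 n2)) => w [w1 w2].
have := NB (w - v, w - v) (conj w1 w2); rewrite /= (ph0r aP) subr0 => H.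
rewrite -ltr_sqr ?nnegrE ?sqrtr_ge0 ?(ltW e0)// [ltLHS](sqr_hn aP).
apply: le_lt_trans H; apply: le_trans (Re_le_normc _); exact: ler_norm.
Qed.

Lemma bounded_continuous a (f : V -> K) (M : R) : cont_pos_herm a -> lin_fun f ->
  (forall v, normc (f v) <= M * form_norm a v) -> continuous (f : V -> C).
Proof.
move=> ac fl fM v; apply/cvgC_normc => e e0.
have M0 : 0 < `|M| + 1 by rewrite ltr_wpDl.
have /(form_norm_near v ac) : 0 < e / (`|M| + 1) by rewrite divr_gt0.
apply: filterS => w; rewrite ltr_pdivlMr// => H.
have -> : f w - f v = f (w - v).
  by rewrite (addrC w) -[- v]scaleN1r fl mulN1r addrC.
apply: le_lt_trans (fM _) _; apply: le_lt_trans H; rewrite mulrC.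
by rewrite ler_wpM2l ?sqrtr_ge0// (le_trans (ler_norm _))// lerDl.
Qed.

End ContForms.

(** From the completeness of the real line, for the real and imaginary parts. *)
Lemma cauchy_cvgC (R : realType) (T : Type) (F : set_system T) (f : T -> R[i]) :
  ProperFilter F ->
  (forall eps : R, 0 < eps ->
    exists2 A, F A & forall x y, A x -> A y -> normc (f x - f y) < eps) ->
  exists z : R[i]^o, (f : T -> R[i]^o) @ F --> z.
Proof.
move=> FF fC.
have part (g : R[i] -> R) : (forall x y, g (x - y) = g x - g y) ->
    (forall x, `|g x| <= normc x) -> cvg ((g \o f) @ F).
  move=> gB gn; apply/cauchy_cvgP/cauchy_exP => e e0.
  have [A FA HA] := fC e e0; have [x Ax] := filter_ex FA.
  exists (g (f x)); rewrite /fmap /=; apply: filterS FA => y Ay.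
  by rewrite /ball /= -gB (le_lt_trans (gn _))// HA.
have [[l1 h1] [l2 h2]] : (exists l1 : R, (@complex.Re R \o f) @ F --> l1) /\
    (exists l2 : R, (@complex.Im R \o f) @ F --> l2).
  split.
    have /cvg_ex[l hl] : cvg ((@complex.Re R \o f) @ F).
      by apply: part => [x y|x]; [rewrite raddfB|exact: Re_le_normc].
    by exists l.
  have /cvg_ex[l hl] : cvg ((@complex.Im R \o f) @ F).
    apply: part => [x y|[u v]]; first by rewrite raddfB.
    by rewrite /normc /= -sqrtr_sqr ler_wsqrtr// lerDr sqr_ge0.
  by exists l.
exists (Complex l1 l2); apply/cvgC_normc => e e0.
have e2 : 0 < e / 2 by rewrite divr_gt0.
move/cvgrPdist_lt/(_ _ e2): h1 => h1; move/cvgrPdist_lt/(_ _ e2): h2 => h2.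
near=> x; apply: le_lt_trans (normc_le_ReIm _) _.
have /= H1 : `|l1 - complex.Re (f x)| < e / 2 by near: x.
have /= H2 : `|l2 - complex.Im (f x)| < e / 2 by near: x.
move: H1 H2; case: (f x) => u v /=; rewrite distrC => H1; rewrite distrC => H2.
by rewrite [ltRHS]splitr ltrD.
Unshelve. all: by end_near. Qed.

(** * Extension by continuity *)

Section Completion.
Variables (R : realType) (V : tvsType R[i]).
Variables (W : tvsType R[i]) (iota : sym_alg V -> W).
Hypothesis cpl : is_completion sym_nbhs0 iota.
Local Notation K := R[i].
Local Notation C := (R[i]^o).
Local Notation S := (sym_alg V).
Implicit Types (a b : V -> V -> K) (X : W) (Y : S).

Let iota_lin := completion_linear cpl.

Lemma iotaB Y Y' : iota (Y - Y') = iota Y - iota Y'.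
Proof. exact: linB iota_lin. Qed.

Definition snorm a Y : R := tensor_norm a (sym_val Y).

Lemma snorm_ge0 a Y : 0 <= snorm a Y.
Proof. exact: sqrtr_ge0. Qed.

Lemma snorm_nbhs a (eps : R) : cont_pos_herm a -> 0 < eps ->
  sym_nbhs0 [set Y : S | snorm a Y < eps].
Proof.
by move=> ac e0; exists 1%N, (fun=> a), eps; split=> // Y; apply; exact: ord0.
Qed.

Global Instance trace_proper X : ProperFilter (trace_nbhs iota X).
Proof.
apply: filter_from_proper; last first.
  move=> B /nbhs_interior; rewrite nbhsE; case=> O [Oo OX] OB.
  have [|y [Oy [Y _ Yy]]] := completion_dense cpl _ Oo; first by exists X.
  by exists Y; apply: interior_subset; apply: OB; rewrite Yy.
apply: filter_from_filter; first by exists setT; exact: filterT.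
by move=> A B nA nB; exists (A `&` B) => //; exact: filterI.
Qed.

Lemma iota_trace X : iota @ trace_nbhs iota X --> X.
Proof. by move=> B nB; exists B. Qed.

(** Differences of tensors near [X] are small because the topology of symmetric
    tensors is induced by [iota]. *)
Lemma cvg_close (G G' : set_system S) X a (eps : R) :
  ProperFilter G -> ProperFilter G' -> iota @ G --> X -> iota @ G' --> X ->
  cont_pos_herm a -> 0 < eps ->
  exists A A', [/\ G A, G' A' &
    forall Y Y', A Y -> A' Y' -> snorm a (Y - Y') < eps].
Proof.
move=> FG FG' GX GX' ac e0.
have [B nB BU] := (completion_initial cpl _).1 (snorm_nbhs ac e0).
have : nbhs (X, X) [set p : W * W | B (p.1 - p.2)].
  apply: (@sub_continuous W (X, X)); by rewrite /= subrr.
case=> [[N1 N2] /= [n1 n2] NB].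
exists (iota @^-1` N1), (iota @^-1` N2); split; [exact: GX|exact: GX'|].
move=> Y Y' /= y1 y2; apply: (BU (Y - Y')); rewrite /= iotaB.
exact: (NB (iota Y, iota Y')).
Qed.

Definition sym_cauchy (G : set_system S) := forall a (eps : R),
  cont_pos_herm a -> 0 < eps ->
  exists2 A, G A & forall Y Y', A Y -> A Y' -> snorm a (Y - Y') < eps.

Lemma cvg_sym_cauchy (G : set_system S) X : ProperFilter G -> iota @ G --> X ->
  sym_cauchy G.
Proof.
move=> FG GX a e ac e0.
have [A [A' [GA GA' AA']]] := cvg_close FG FG GX GX ac e0.
by exists (A `&` A') => [|Y Y' [Ay _] [_ Ay']]; [exact: filterI|exact: AA'].
Qed.

Lemma sym_cauchy_cvg (G : set_system S) : ProperFilter G -> sym_cauchy G ->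
  exists X, iota @ G --> X.
Proof.
move=> FG GC; apply: (completion_complete cpl) => U nU.
have [|n [b [e [bc e0 bU]]]] := (completion_initial cpl (iota @^-1` U)).2.
  by exists U.
have [A AP] : {A : 'I_n -> set S | forall i, G (A i) /\
    forall Y Y', A i Y -> A i Y' -> snorm (b i) (Y - Y') < e}.
  have ex i : exists A : set S, G A /\
      forall Y Y', A Y -> A Y' -> snorm (b i) (Y - Y') < e.
    by have [A GA HA] := GC (b i) e (bc i) e0; exists A.
  by exists (fun i => projT1 (cid (ex i))) => i; exact: (projT2 (cid (ex i))).
exists (iota @` [set Y | forall i, A i Y]).
  rewrite /fmap /=; apply: filterS (_ : G [set Y | forall i, A i Y]).
    by move=> Y AY; exists Y.
  by apply: filter_forall => i; exact: (AP i).1.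
move=> _ _ [Y AY <-] [Y' AY' <-]; rewrite -iotaB; apply: bU => i.
by apply: (AP i).2; [exact: AY|exact: AY'].
Qed.

Lemma snorm_bounded (G : set_system S) a : ProperFilter G -> sym_cauchy G ->
  cont_pos_herm a -> exists M : R, \forall Y \near G, snorm a Y <= M.
Proof.
move=> FG GC ac; have [A GA HA] := GC a 1 ac ltr01.
have [Y0 AY0] := filter_ex GA; exists (1 + snorm a Y0).
apply: filterS GA => Y AY; have aP := pos_herm_tensor (cph_pos ac).
rewrite /snorm -[sym_val Y](subrK (sym_val Y0)).
apply: le_trans (hnD aP _ _) _; rewrite lerD2r; apply: ltW; exact: HA.
Qed.

(** Continuity is recorded as a bound by one seminorm, which yields uniform
    continuity and thus an extension to the completion. *)
Definition cont_fun (f : S -> K) := linear (f : S -> C) /\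
  exists a (M : R), cont_pos_herm a /\ forall Y, normc (f Y) <= M * snorm a Y.

Lemma tvs_lim_cvg (Z : tvsType R[i]) (F : set_system Z) :
  (exists x : Z, F --> x) -> F --> tvs_lim F.
Proof. by move=> Fx; exact: (@xgetPex _ 0 [set x : Z | F --> x]). Qed.

Lemma cont_fun_small f (eps : R) : cont_fun f -> 0 < eps ->
  exists a (d : R), [/\ cont_pos_herm a, 0 < d &
    forall Y Y', snorm a (Y - Y') < d -> normc (f Y - f Y') < eps].
Proof.
move=> [fl [a [M [ac fM]]]] e0; exists a, (eps / (`|M| + 1)).
have M0 : 0 < `|M| + 1 by rewrite ltr_wpDl.
split=> // [|Y Y']; first by rewrite divr_gt0.
rewrite ltr_pdivlMr// => H; rewrite -[f Y - f Y'](linB _ _ fl).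
apply: le_lt_trans (fM _) _; apply: le_lt_trans H; rewrite mulrC.
by rewrite ler_wpM2l ?snorm_ge0// (le_trans (ler_norm _))// lerDl.
Qed.

Lemma cont_fun_cvg (G : set_system S) f : ProperFilter G -> sym_cauchy G ->
  cont_fun f -> exists z : C, (f : S -> C) @ G --> z.
Proof.
move=> FG GC fc; apply: cauchy_cvgC => e e0.
have [a [d [ac d0 H]]] := cont_fun_small fc e0.
have [A GA HA] := GC a d ac d0; exists A => // Y Y' AY AY'; apply: H.
exact: HA.
Qed.

(** The extension is defined by the trace filter, but every filter of tensors
    that converges to [X] computes it. *)
Lemma ext_cvg (G : set_system S) X f : ProperFilter G -> iota @ G --> X ->
  cont_fun f -> (f : S -> C) @ G --> (extend iota (f : S -> C) X : C).
Proof.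
move=> FG GX fc; have [z fz] := cont_fun_cvg FG (cvg_sym_cauchy FG GX) fc.
have fe : (f : S -> C) @ trace_nbhs iota X --> (extend iota (f : S -> C) X : C).
  apply: tvs_lim_cvg; apply: cont_fun_cvg => //.
  exact: cvg_sym_cauchy (@iota_trace X).
suff -> : (extend iota (f : S -> C) X : C) = z by [].
apply/eqP; rewrite -subr_eq0 -normc_eq0 eq_le normc_ge0 andbT.
apply/ler_addgt0Pl => e e0; rewrite addr0.
have e3 : 0 < e / 3 by rewrite divr_gt0.
have [a [d [ac d0 H]]] := cont_fun_small fc e3.
have [A [A' [GA GA' AA']]] := cvg_close FG (trace_proper X) GX (@iota_trace X) ac d0.
have /cvgC_normc/(_ _ e3) fzn := fz.
have /cvgC_normc/(_ _ e3) fen := fe.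
have [Y [AY fY]] := filter_ex (filterI GA fzn).
have [Y' [AY' fY']] := filter_ex (filterI GA' fen).
set x := extend _ _ _ in fY' *.
have -> : x - z = - (f Y' - x) + (f Y' - f Y) + (f Y - z) by ring.
apply: le_trans (normcD _ _) _.
have := normcD (- (f Y' - x)) (f Y' - f Y); rewrite normc_opp (normcB (f Y')).
have := H _ _ (AA' _ _ AY AY').
move: fY fY' => /= ? ? ? ?; lra.
Qed.

Lemma ext_unique (G : set_system S) X f z : ProperFilter G -> iota @ G --> X ->
  cont_fun f -> (f : S -> C) @ G --> (z : C) -> extend iota (f : S -> C) X = z.
Proof. by move=> FG GX fc; apply: cvgC_unique; exact: ext_cvg. Qed.

Lemma ext_iota f Y : cont_fun f -> extend iota (f : S -> C) (iota Y) = f Y.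
Proof.
move=> fc; have FG : ProperFilter (globally [set Y]) by exact: (@globally_properfilter _ _ Y).
apply: (@ext_unique (globally [set Y])) => //.
  by move=> B /nbhs_singleton BY _ ->.
by move=> B /nbhs_singleton BY _ ->.
Qed.

Lemma ext_linear f : cont_fun f -> linear (extend iota (f : S -> C) : W -> C).
Proof.
move=> fc c X X'; have [fl _] := fc.
pose G := (fun p : S * S => c *: p.1 + p.2) @
  filter_prod (trace_nbhs iota X) (trace_nbhs iota X').
have GX : iota @ G --> c *: X + X'.
  move=> U nU; have := @add_continuous W (c *: X, X') U nU.
  case=> [[M1 M2] /= [m1 m2] MU].
  have := @scale_continuous _ W ((c : K^o), X) M1 m1.
  case=> [[P1 P2] /= [p1 p2] PM].
  exists (iota @^-1` P2, iota @^-1` M2); first by split; [exists P2|exists M2].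
  move=> [Y Y'] /= [PY MY']; rewrite /preimage /= iota_lin.
  apply: (MU (c *: iota Y, iota Y')); split=> //=; apply: (PM (c, iota Y)).
  by split=> //=; exact: (nbhs_singleton p1).
apply: (@ext_unique G) => //.
apply/cvgC_normc => e e0.
have M0 : 0 < normc c + 1 by rewrite ltr_wpDl ?normc_ge0.
have /cvgC_normc h1 := ext_cvg (trace_proper X) (@iota_trace X) fc.
have /cvgC_normc h2 := ext_cvg (trace_proper X') (@iota_trace X') fc.
exists ([set Y | normc (f Y - extend iota (f : S -> C) X) < e / 2 / (normc c + 1)],
  [set Y | normc (f Y - extend iota (f : S -> C) X') < e / 2]).
  by split; [apply: h1|apply: h2]; rewrite !divr_gt0.
move=> [Y Y'] /= [H1 H2]; rewrite fl.
set x := extend _ _ X in H1 *; set x' := extend _ _ X' in H2 *.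
rewrite [_ - _](_ : _ = c * (f Y - x) + (f Y' - x')); last first.
  by rewrite /GRing.scale /=; ring.
apply: le_lt_trans (normcD _ _) _; rewrite [ltRHS]splitr ler_ltD// normcM.
move: H1; rewrite ltr_pdivlMr// => /ltW; apply: le_trans.
by rewrite mulrC ler_wpM2l ?normc_ge0// lerDl.
Qed.

(** The trace filter of [X] then converges to 0 as well. *)
Lemma completion_eq0 X : (forall a (eps : R), cont_pos_herm a -> 0 < eps ->
    \forall Y \near trace_nbhs iota X, snorm a Y < eps) -> X = 0.
Proof.
move=> H; apply: (@cvg_unique _ (completion_hausdorff cpl) (iota @ trace_nbhs iota X)).
  exact: iota_trace.
move=> U nU.
have [|n [b [e [bc e0 bU]]]] := (completion_initial cpl (iota @^-1` U)).2.
  by exists U.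
have : \forall Y \near trace_nbhs iota X, forall i, snorm (b i) Y < e.
  by apply: filter_forall => i; exact: H.
by apply: filterS.
Qed.

(** * The operations on the completion *)

Lemma sym_valD Y Y' : sym_val (Y + Y') = sym_val Y + sym_val Y'.
Proof. by []. Qed.

Lemma snormD a Y Y' : cont_pos_herm a -> snorm a (Y + Y') <= snorm a Y + snorm a Y'.
Proof.
move=> ac; rewrite /snorm sym_valD.
exact: (hnD (pos_herm_tensor (cph_pos ac)) (sym_val Y) (sym_val Y')).
Qed.

Lemma snorm_vee a Y Y' : cont_pos_herm a ->
  snorm a (vee Y Y') <= snorm (scale_form (2 ^+ 2) a) Y * snorm (scale_form (2 ^+ 2) a) Y'.
Proof.
move=> ac; have aP := cph_pos ac; apply: le_trans (tensor_norm_Sym _ aP) _.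
exact: tensor_norm_tmul.
Qed.

Lemma vee_linl Y : linear (fun Z => vee Z Y : S).
Proof.
move=> c Z Z'; apply: val_inj; rewrite /= (tmul_linl (sym_val Y) c (sym_val Z)).
exact: Sym_linear.
Qed.

Lemma vee_linr Y : linear (fun Z => vee Y Z : S).
Proof.
move=> c Z Z'; apply: val_inj; rewrite /= (tmul_linr (sym_val Y) c (sym_val Z)).
exact: Sym_linear.
Qed.

Lemma vee_diff a Y1 Y1' Y2 Y2' (b := scale_form (2 ^+ 2) a) : cont_pos_herm a ->
  snorm a (vee Y1 Y2 - vee Y1' Y2') <=
  snorm b (Y1 - Y1') * snorm b Y2 + snorm b Y1' * snorm b (Y2 - Y2').
Proof.
move=> ac; have -> : vee Y1 Y2 - vee Y1' Y2' =
    vee (Y1 - Y1') Y2 + vee Y1' (Y2 - Y2').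
  rewrite [vee (Y1 - Y1') Y2](linB _ _ (vee_linl Y2)).
  by rewrite [vee Y1' (Y2 - Y2')](linB _ _ (vee_linr Y1')) addrA subrK.
by apply: le_trans (snormD _ _ ac) _; rewrite lerD// snorm_vee.
Qed.

Let pairs X X' := filter_prod (trace_nbhs iota X) (trace_nbhs iota X').

Lemma vee_cauchy X X' :
  sym_cauchy ((fun p : S * S => vee p.1 p.2) @ pairs X X').
Proof.
move=> a e ac e0; set b := scale_form (2 ^+ 2) a.
have bc : cont_pos_herm b by apply: cph_scale => //; exact: sqr_ge0.
have cX := cvg_sym_cauchy (trace_proper X) (@iota_trace X).
have cX' := cvg_sym_cauchy (trace_proper X') (@iota_trace X').
have [M HM] := snorm_bounded (trace_proper X) cX bc.
have [M' HM'] := snorm_bounded (trace_proper X') cX' bc.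
pose N := `|M| + `|M'| + 1; have N0 : 0 < N by rewrite ltr_wpDl ?addr_ge0.
have d0 : 0 < e / 2 / N by rewrite !divr_gt0.
have [A GA HA] := cX b _ bc d0; have [A' GA' HA'] := cX' b _ bc d0.
pose E := (A `&` [set Y | snorm b Y <= M]) `*` (A' `&` [set Y | snorm b Y <= M']).
exists ((fun p : S * S => vee p.1 p.2) @` E).
  exists (A `&` [set Y | snorm b Y <= M], A' `&` [set Y | snorm b Y <= M']).
    by split; apply: filterI.
  by move=> p Ep; exists p.
move=> _ _ [[Y1 Y2] [/= [AY1 MY1] [AY2 MY2]] <-] [[Z1 Z2] [/= [AZ1 MZ1] [AZ2 MZ2]] <-].
apply: le_lt_trans (vee_diff _ _ _ _ ac) _; rewrite -/b.
have := HA _ _ AY1 AZ1; have := HA' _ _ AY2 AZ2.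
have := snorm_ge0 b (Y1 - Z1); have := snorm_ge0 b (Y2 - Z2).
move: (snorm b (Y1 - Z1)) (snorm b (Y2 - Z2)) => p q q0 p0 qd pd.
have MN : snorm b Y2 <= N.
  by rewrite (le_trans MY2)// (le_trans (ler_norm _))// /N -addrA addrCA lerDl addr_ge0.
have MN' : snorm b Z1 <= N.
  by rewrite (le_trans MZ1)// (le_trans (ler_norm _))// /N -addrA lerDl addr_ge0.
have step (u w : R) : 0 <= u -> u < e / 2 / N -> w <= N -> u * w < e / 2.
  by move=> u0 ud wN; apply: le_lt_trans (ler_wpM2l u0 wN) _; rewrite -ltr_pdivlMr.
rewrite [ltRHS]splitr; apply: ltrD; first exact: step.
by rewrite [ltLHS]mulrC; exact: step.
Qed.

Lemma vee_cpl_cvg X X' :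
  iota @ ((fun p : S * S => vee p.1 p.2) @ pairs X X') --> vee_cpl iota X X'.
Proof. by apply: tvs_lim_cvg; exact: sym_cauchy_cvg (@vee_cauchy X X'). Qed.

(** Both sides are limits along the product of the trace filters. *)
Lemma ext_vee f X X' : cont_fun f -> (forall Y Y', f (vee Y Y') = f Y * f Y') ->
  extend iota (f : S -> C) (vee_cpl iota X X') =
  extend iota (f : S -> C) X * extend iota (f : S -> C) X'.
Proof.
move=> fc fM; apply: (ext_unique _ (@vee_cpl_cvg X X') fc).
apply/cvgC_normc => e e0.
have h1 := ext_cvg (trace_proper X) (@iota_trace X) fc.
have h2 := ext_cvg (trace_proper X') (@iota_trace X') fc.
have : (fun p : S * S => (f p.1 : C) * (f p.2 : C)) @ pairs X X' -->
    (extend iota (f : S -> C) X : C) * (extend iota (f : S -> C) X' : C).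
  by apply: cvgM; [apply: cvg_comp h1; exact: cvg_fst|apply: cvg_comp h2; exact: cvg_snd].
move=> /cvgC_normc/(_ e e0); apply: filterS => p /=.
by rewrite fM.
Qed.

Section Involution.
Variable bar : V -> V.
Hypothesis bar_inv : cont_antilinear_involution bar.
Let bar_anti := bar_antilinear bar_inv.

Lemma conjcE (z : K) : conjc z = z^*. Proof. by []. Qed.

Definition real_form a v w : K := a v w + (a (bar v) (bar w))^*.

Lemma real_form_real a : cont_pos_herm a -> real_cont_pos_herm bar (real_form a).
Proof.
move=> ac; have aP := cph_pos ac; have bK := barK bar_inv.
split; last first.
  by move=> v w; rewrite conjcE /real_form rmorphD /= conjCK !bK addrC.
split=> [u c v w|u c v w|v w|v|p].
- by rewrite /real_form bar_anti !(ph_linr aP) rmorphD rmorphM /= conjCK; ring.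
- by rewrite /real_form bar_anti !(ph_linl aP) rmorphD rmorphM /= conjCK; ring.
- rewrite conjcE /real_form rmorphD /= conjCK (ph_herm aP v w).
  by rewrite (ph_herm aP (bar v) (bar w)) conjCK.
- rewrite /real_form addr_ge0 ?(ph_pos aP)// (ph_Re aP (bar v)) conj_real.
  by rewrite lecR; exact: ph_Re_ge0.
have ca : forall q : V * V, (fun q : V * V => a q.1 q.2 : C) @ q --> (a q.1 q.2 : C).
  exact: form_cont ac.
apply: (@cvgD K C); first exact: ca.
apply/cvgC_normc => e e0; have := ca (bar p.1, bar p.2); move/cvgC_normc => /(_ e e0).
case=> [[N1 N2] /= [n1 n2] NB].
exists (bar @^-1` N1, bar @^-1` N2).
  have bc : forall v, bar @ v --> bar v by exact: bar_cont bar_inv.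
  by split; [exact: (bc p.1 _ n1)|exact: (bc p.2 _ n2)].
move=> [v w] /= [v1 w2]; rewrite -rmorphB normc_conj.
exact: (NB (bar v, bar w)).
Qed.

(** So the seminorms of real forms define the same topology. *)
Lemma real_form_fle a : cont_pos_herm a -> fle a (real_form a).
Proof.
move=> ac v; rewrite raddfD /= lerDl (ph_Re (cph_pos ac) (bar v)) conj_real.
exact: (ph_Re_ge0 (cph_pos ac)).
Qed.

Lemma sym_starE Y : sym_val (sym_star bar Y) = tensor_star bar (sym_val Y).
Proof.
rewrite /sym_star [LHS]insubdK//; case: Y => Z /= /asboolP[X _ <-].
by rewrite (tensor_star_Sym bar_anti); exact: Sym_in.
Qed.

Lemma sym_starB Y Y' : sym_star bar (Y - Y') = sym_star bar Y - sym_star bar Y'.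
Proof.
apply: val_inj; rewrite /= !sym_starE /=.
have := tensor_star_lin bar_anti (-1) (sym_val Y') (sym_val Y).
by rewrite rmorphN1 !scaleN1r addrC => ->; rewrite addrC.
Qed.

Lemma snorm_le a b Y : cont_pos_herm a -> cont_pos_herm b -> fle a b ->
  snorm a Y <= snorm b Y.
Proof. by move=> ac bc; apply: tensor_norm_le; exact: cph_pos. Qed.

Lemma star_cauchy X : sym_cauchy ((fun Y => sym_star bar Y) @ trace_nbhs iota X).
Proof.
move=> a e ac e0; have [rc rr] := real_form_real ac.
have [A GA HA] := cvg_sym_cauchy (trace_proper X) (@iota_trace X) rc e0.
exists ((fun Y => sym_star bar Y) @` A).
  by rewrite /fmap /=; apply: filterS GA => Y AY; exists Y.
move=> _ _ [Y AY <-] [Y' AY' <-]; rewrite -sym_starB.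
apply: le_lt_trans (HA _ _ AY AY'); apply: le_trans (snorm_le _ ac rc (real_form_fle ac)) _.
by rewrite /snorm sym_starE; apply: tensor_norm_star => //; exact: cph_pos.
Qed.

Lemma star_cpl_cvg X :
  iota @ ((fun Y => sym_star bar Y) @ trace_nbhs iota X) --> star_cpl bar iota X.
Proof. by apply: tvs_lim_cvg; exact: sym_cauchy_cvg (@star_cauchy X). Qed.

Lemma ext_star f X : cont_fun f -> (forall Y, f (sym_star bar Y) = (f Y)^*) ->
  extend iota (f : S -> C) (star_cpl bar iota X) = (extend iota (f : S -> C) X)^*.
Proof.
move=> fc fS; apply: (ext_unique _ (@star_cpl_cvg X) fc).
have /cvgC_conj/cvgC_normc h := ext_cvg (trace_proper X) (@iota_trace X) fc.
by apply/cvgC_normc => e /h; apply: filterS => Y /=; rewrite fS.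
Qed.

End Involution.

(** * Continuity of the derivative functionals *)

Lemma cph_fsum (ls : seq (V -> K)) : all_lin ls ->
  (forall f, f \in ls -> continuous (f : V -> C)) -> cont_pos_herm (fsum ls).
Proof.
move=> ll lc; have [h1 h2 h3 h4] := pos_herm_fsum ll; split=> //.
elim: ls ll lc {h1 h2 h3 h4} => [|f ls IH] ll lc p.
  have -> : (fun p : V * V => fsum [::] p.1 p.2 : C) = fun=> 0.
    by apply/funext => q; rewrite /fsum big_nil.
  exact: cvg_cst.
have -> : (fun p : V * V => fsum (f :: ls) p.1 p.2 : C) =
    (fun p : V * V => ((f p.1)^* : C) * (f p.2 : C) + (fsum ls p.1 p.2 : C)).
  by apply/funext => q; rewrite /fsum big_cons.
have fc : forall v : V, (f : V -> C) @ v --> (f v : C) by apply: lc; rewrite inE eqxx.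
apply: (@cvgD K C); last first.
  apply: IH => [g gl|g gl]; [apply: ll|apply: lc]; by rewrite inE gl orbT.
apply: cvgM.
  by apply: cvgC_conj; apply: cvg_comp (fc p.1); exact: cvg_fst.
by apply: cvg_comp (fc p.2); exact: cvg_snd.
Qed.

Lemma bessel_fsum (ls : seq (V -> K)) : bessel (fsum ls) ls.
Proof. by move=> v; rewrite fsum_diag. Qed.

(** The form [fsum (s :: w)] is continuous and its functionals satisfy Bessel's
    inequality for it, so [Qd_bound] applies. *)
Lemma Qd_cont_fun s w : lin_fun s -> all_lin w -> continuous (s : V -> C) ->
  (forall f, f \in w -> continuous (f : V -> C)) ->
  cont_fun (fun Y => Qd s w (sym_val Y)).
Proof.
move=> sl wl sc wc; split.
  by move=> c Y Y'; exact: (Qd_linear sl wl c (sym_val Y) (sym_val Y')).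
have ll : all_lin (s :: w) by apply/all_lin_cons.
have ac : cont_pos_herm (fsum (s :: w)).
  by apply: (cph_fsum ll) => f; rewrite inE => /orP[/eqP->|/wc].
exists (scale_form (4 ^+ 2) (fsum (s :: w))), ((size w)`!%:R * 2).
split=> [|Y]; first by apply: cph_scale => //; exact: sqr_ge0.
apply: Qd_bound (cph_pos ac) ll (@bessel_fsum _) _ _; first by rewrite inE eqxx.
by move=> f fw; rewrite inE fw orbT.
Qed.

End Completion.

(** * Smoothness of the Gelfand transform *)

Section RealDual.
Variables (R : realType) (V : tvsType R[i]) (bar : V -> V).
Local Notation K := R[i].
Local Notation C := (R[i]^o).
Local Notation E := (real_dual bar).
Implicit Types (rho sigma : E) (w : seq E).

(** [dual_fun] with values in the field [R[i]] rather than in a real vector space. *)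
Definition fn rho : V -> K := dual_fun rho.

Lemma fn_dual rho : is_real_dual bar (fn rho).
Proof. by apply/asboolP; exact: (valP rho). Qed.

Lemma fn_lin rho : lin_fun (fn rho).
Proof. exact: dual_linear (fn_dual rho). Qed.

Lemma fn_cont rho : continuous (fn rho : V -> C).
Proof. exact: dual_cont (fn_dual rho). Qed.

Lemma fn_real rho v : (fn rho v)^* = fn rho (bar v).
Proof. exact: dual_real (fn_dual rho) v. Qed.

Lemma rscaleE (t : R) (z : Rcomplex R) : t *: z = ((t%:C)%C : K) * z.
Proof. by case: z => x y /=; simpc. Qed.

Lemma fnDZ rho sigma (t : R) :
  fn (sigma + t *: rho) = (fun v => fn sigma v + (t%:C)%C * fn rho v).
Proof.
apply/funext => v.
by rewrite -(rscaleE t (fn rho v)).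
Qed.

Lemma fnZD rho sigma (t : R) v :
  fn (t *: rho + sigma) v = (t%:C)%C * fn rho v + fn sigma v.
Proof. by rewrite -(rscaleE t (fn rho v)). Qed.

Lemma fn_inj rho sigma : fn rho =1 fn sigma -> rho = sigma.
Proof. by move=> H; apply: val_inj; apply/funext. Qed.

Lemma all_lin_fn w : all_lin (map fn w).
Proof. by move=> _ /mapP[rho _ ->]; exact: fn_lin. Qed.
Arguments all_lin_fn w f _ : clear implicits.

Lemma cont_map_fn w f : f \in map fn w -> continuous (f : V -> C).
Proof. by move=> /mapP[rho _ ->]; exact: fn_cont. Qed.

End RealDual.
Arguments all_lin_fn {R V bar} w f _.

Lemma weval_sym_alg (R : realType) (V : tvsType R[i]) (Y : sym_alg V)
    (l l' : seq (V -> R[i])) : all_lin l -> perm_eq l l' ->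
  weval l (sym_val Y) = weval l' (sym_val Y).
Proof. by case: Y => Z /= /asboolP[X _ <-]; exact: weval_Sym_perm. Qed.

Section Smooth.
Variables (R : realType) (V : tvsType R[i]) (bar : V -> V).
Variables (W : tvsType R[i]) (iota : sym_alg V -> W).
Hypothesis cpl : is_completion sym_nbhs0 iota.
Local Notation K := R[i].
Local Notation C := (R[i]^o).
Local Notation S := (sym_alg V).
Local Notation E := (real_dual bar).
Implicit Types (rho sigma : E) (w : seq E) (X : W) (Y : S).

Definition Qe sigma w Y : K := Qd (fn sigma) (map (@fn _ _ _) w) (sym_val Y).

Lemma Qe_cont sigma w : cont_fun (Qe sigma w).
Proof.
apply: Qd_cont_fun; [exact: fn_lin|exact: all_lin_fn|exact: fn_cont|].
exact: cont_map_fn.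
Qed.

(** The value at [sigma] of the derivative of the transform of [X] in the directions
    [w], as [iterD_gelfand] shows. *)
Definition Qhat sigma w X : C := extend iota (Qe sigma w : S -> C) X.

Lemma Qhat_cvg sigma w X : (Qe sigma w : S -> C) @ trace_nbhs iota X --> Qhat sigma w X.
Proof. by apply: (ext_cvg cpl); [exact: trace_proper|exact: iota_trace|exact: Qe_cont]. Qed.

Lemma gelfandE X rho : gelfand bar iota X rho = Qhat rho [::] X.
Proof.
rewrite /gelfand /Qhat; congr (extend iota _ X); apply/funext => Y.
by rewrite /Qe Qd_delta//; exact: fn_lin.
Qed.

Lemma form_sum (l : seq (V -> V -> K)) : (forall a, a \in l -> cont_pos_herm a) ->
  exists b, cont_pos_herm b /\
    forall v, complex.Re (b v v) = \sum_(a <- l) complex.Re (a v v).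
Proof.
elim: l => [|a l IH] lc.
  exists (fsum [::]); split; first by apply: cph_fsum.
  by move=> v; rewrite /fsum !big_nil.
have [c cl|b [bc bE]] := IH; first by apply: lc; rewrite inE cl orbT.
exists (add_form a b); split; first by apply: cph_add => //; apply: lc; rewrite inE eqxx.
by move=> v; rewrite big_cons -bE /add_form raddfD.
Qed.

#[local] Instance FT X : ProperFilter (trace_nbhs iota X) := trace_proper cpl X.

Lemma trace_bounded X a : cont_pos_herm a ->
  exists M : R, 0 <= M /\ \forall Y \near trace_nbhs iota X, snorm a Y <= M.
Proof.
move=> ac; have GC := cvg_sym_cauchy cpl (FT X) (@iota_trace _ _ _ iota X).
have [M HM] := snorm_bounded (FT X) GC ac; exists `|M|; split=> //.
apply: filterS HM => Y /le_trans; apply; exact: ler_norm.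
Qed.

(** The bound of [Qd_remainder] is a seminorm, and seminorms are bounded on
    tensors close to [X]. *)
Lemma Qhat_remainder rho sigma w X : exists M : R, 0 <= M /\ forall t : R, `|t| <= 1 ->
  normc (Qhat (sigma + t *: rho) w X - Qhat sigma w X -
     (t%:C)%C * Qhat sigma (rho :: w) X) <= t ^+ 2 * M.
Proof.
pose ls := map (@fn _ _ _) (sigma :: rho :: w).
have ll : all_lin ls by exact: all_lin_fn.
have ac : cont_pos_herm (fsum ls).
  by apply: cph_fsum => // f; exact: cont_map_fn.
pose b := scale_form (8 ^+ 2) (fsum ls).
have bc : cont_pos_herm b by apply: cph_scale => //; exact: sqr_ge0.
have [M [M0 HM]] := trace_bounded X bc.
exists ((size (map (@fn _ _ _) w))`!%:R * 2 * M); split=> [|t t1].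
  by rewrite mulr_ge0.
have cv : (fun Y => (Qe (sigma + t *: rho) w Y - Qe sigma w Y -
     (t%:C)%C * Qe sigma (rho :: w) Y : C)) @ trace_nbhs iota X -->
   (Qhat (sigma + t *: rho) w X - Qhat sigma w X -
     (t%:C)%C * Qhat sigma (rho :: w) X : C).
  apply: (@cvgB K C); first by apply: (@cvgB K C); exact: Qhat_cvg.
  by apply: (@cvgM K); [exact: cvg_cst|exact: Qhat_cvg].
refine (@cvgC_le _ _ _ (FT X) _ _ _ cv _); apply: filterS HM => Y YM.
have := @Qd_remainder _ _ (fsum ls) ls (fn sigma) (fn rho) t (map (@fn _ _ _) w)
  (sym_val Y) (cph_pos ac) ll (@bessel_fsum _ _ _).
rewrite /ls /= !inE !eqxx orbT /Qe fnDZ => /(_ isT isT _ t1) H.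
apply: le_trans (H _ _) _.
- by move=> f fw; rewrite !inE fw !orbT.
- by move=> l l'; exact: weval_sym_alg.
by rewrite ler_wpM2l ?sqr_ge0// ler_wpM2l// mulr_ge0.
Qed.

Lemma Qhat_diff rho sigma w X :
  diff_quotient rho (fun s => Qhat s w X) sigma t @[t --> (0 : R)^'] -->
  Qhat sigma (rho :: w) X.
Proof.
have [M [M0 HM]] := Qhat_remainder rho sigma w X.
apply/cvgC_normc => e e0.
have M1 : 0 < M + 1 by rewrite ltr_wpDl.
have d0 : 0 < Num.min 1 (e / (M + 1)) by rewrite lt_min ltr01 divr_gt0.
near=> t; have t0 : t != 0 by near: t; exact: nbhs_dnbhs_neq.
have : `|t| < Num.min 1 (e / (M + 1)) by near: t; exact: dnbhs0_lt.
rewrite lt_min => /andP[/ltW t1]; rewrite ltr_pdivlMr// => te.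
have tC : (t%:C)%C != 0 :> K by rewrite -normc_eq0 normc_real normr_eq0.
rewrite /diff_quotient -(ltr_pM2l (_ : 0 < `|t|)) ?normr_gt0//.
rewrite -{1}(normc_real t) -normcM mulrBr mulVKf//.
apply: le_lt_trans (HM t t1) _; rewrite -real_normK ?num_real// expr2 -mulrA.
rewrite ltr_pM2l ?normr_gt0//; apply: le_lt_trans te.
by rewrite ler_wpM2l// lerDl.
Unshelve. all: by end_near. Qed.

Lemma iterD_gelfand w X : iterD w (gelfand bar iota X) = fun sigma => Qhat sigma w X.
Proof.
elim: w => [|rho w IH]; first by apply/funext => s; exact: gelfandE.
apply/funext => sigma; rewrite /= IH.
rewrite /dirD; apply: (cvg_lim (@norm_hausdorff _ C)).
exact: Qhat_diff.
Qed.

Lemma map_fn_sub sigma w : {subset map (@fn _ _ bar) w <= map (@fn _ _ _) (sigma :: w)}.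
Proof. by move=> f; rewrite inE => ->; rewrite orbT. Qed.

Lemma Qe_perm sigma w w' Y : perm_eq w w' -> Qe sigma w Y = Qe sigma w' Y.
Proof.
move=> ww'; rewrite /Qe; have [N HN] := Qd_sum (sym_val Y).
have sl := @fn_lin _ _ _ sigma.
rewrite !(HN N)//; try exact: all_lin_fn.
have pm : perm_eq (map (@fn _ _ _) w) (map (@fn _ _ _) w') by exact: perm_map.
rewrite (perm_size pm); apply: eq_bigr => n _; congr (_ * _).
apply: weval_sym_alg; first by apply: all_lin_Q => //; exact: all_lin_fn.
by rewrite perm_cat2r.
Qed.

Lemma Qe_multilinear sigma u v (t : R) rho rho' Y :
  Qe sigma (u ++ (t *: rho + rho') :: v) Y =
  (t%:C)%C * Qe sigma (u ++ rho :: v) Y + Qe sigma (u ++ rho' :: v) Y.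
Proof.
rewrite /Qe; have [N HN] := Qd_sum (sym_val Y).
have sl := @fn_lin _ _ _ sigma.
rewrite !(HN N)//; try exact: all_lin_fn.
rewrite !map_cat /= !size_cat /= mulr_sumr -big_split; apply: eq_bigr => n _ /=.
rewrite -!catA /=.
rewrite (@weval_letter _ _ _ _ (fn rho) (fn rho') _ (t%:C)%C) => [|||||x].
- by ring.
- exact: all_lin_fn.
- by apply: all_lin_Q => //; exact: all_lin_fn.
- exact: fn_lin.
- exact: fn_lin.
- exact: fnZD.
Qed.

(** For boundedness, letters bounded by the forms [a i] satisfy Bessel's
    inequality for the sum of these forms, and [Qd_bound] applies near [X]. *)
Lemma gelfand_smooth X : smooth (gelfand bar iota X).
Proof.
split.
- move=> s rho sigma; rewrite iterD_gelfand.
  by apply/cvg_ex; exists (Qhat sigma (rho :: s) X); exact: Qhat_diff.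
- move=> sigma s s' ss'; rewrite !iterD_gelfand /Qhat; congr (extend iota _ X).
  by apply/funext => Y; exact: Qe_perm.
- move=> sigma u v t rho rho'; rewrite !iterD_gelfand rscaleE.
  apply: (ext_unique cpl (FT X) (@iota_trace _ _ _ iota X)); first exact: Qe_cont.
  rewrite (_ : (Qe _ _ : S -> C) = fun Y => ((t%:C)%C : C) * (Qe sigma (u ++ rho :: v) Y : C) +
     (Qe sigma (u ++ rho' :: v) Y : C)); last first.
    by apply/funext => Y; exact: Qe_multilinear.
  apply: (@cvgD K C); last exact: Qhat_cvg.
  by apply: (@cvgM K); [exact: cvg_cst|exact: Qhat_cvg].
move=> sigma k B Bb.
pose a i := projT1 (cid2 (Bb i)).
have aP i : real_cont_pos_herm bar (a i) by rewrite /a; case: cid2.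
have aB i (rho : E) v : B i rho -> normc (fn rho v) <= form_norm (a i) v.
  by rewrite /a; case: cid2 => c ? /= H /H.
have [|b [bc bE]] := @form_sum (fsum [:: fn sigma] :: [seq a i | i <- enum 'I_k]).
  move=> c; rewrite inE => /orP[/eqP->|/mapP[i _ ->]]; last by case: (aP i).
  apply: cph_fsum => f; rewrite inE => /eqP ->; [exact: fn_lin|exact: fn_cont].
have b4c : cont_pos_herm (scale_form (4 ^+ 2) b).
  by apply: cph_scale => //; exact: sqr_ge0.
have [M [M0 HM]] := trace_bounded X b4c.
exists (k`!%:R * 2 * M) => s sB; rewrite iterD_gelfand.
refine (@cvgC_le _ _ _ (FT X) _ _ _ (@Qhat_cvg sigma s X) _).
apply: filterS HM => Y YM.
have ll : all_lin (map (@fn _ _ _) (sigma :: s)) by exact: all_lin_fn.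
apply: le_trans (Qd_bound (sym_val Y) (cph_pos bc) ll _ _ (@map_fn_sub sigma s)) _.
- move=> v; rewrite bE [map _ (_ :: _)]map_cons !big_cons (big_map (@fn _ _ bar)) (big_map a) fsum_diag.
  rewrite big_seq1 [complex.Re (_%:C)%C]/= lerD2l.
  rewrite -[X in \sum_(_ <- X) _](map_tnth_enum s) big_map.
  apply: ler_sum => i _; have aPi := cph_pos (aP i).1.
  rewrite -(sqr_hn aPi) ler_sqr ?nnegrE ?normc_ge0 ?sqrtr_ge0//; exact: aB.
- by rewrite inE eqxx.
by rewrite size_map size_tuple ler_wpM2l// mulr_ge0.
Qed.

End Smooth.

(** * The Hilbert space of a real form *)

Section HilbertVectors.
Variables (R : realType) (V : tvsType R[i]) (bar : V -> V).
Hypothesis bar_inv : cont_antilinear_involution bar.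
Variable a : V -> V -> R[i].
Hypothesis ar : real_cont_pos_herm bar a.
Local Notation K := R[i].
Local Notation C := (R[i]^o).
Local Notation hv := (hilbert_vector bar a).
Local Notation dot := (hilbert_dot a).
Local Notation nm := (form_norm a).
Implicit Types (u v w : nat -> V) (x y : V).

Let aP := cph_pos ar.1.
Let bar_anti : forall (c : K) x y, bar (c *: x + y) = c^* *: bar x + bar y :=
  bar_antilinear bar_inv.

Lemma conj_fixed (z : K) : z^* = z -> z = (complex.Re z)%:C%C.
Proof.
rewrite -conjcE; case: z => p q /= [qq]; congr Complex.
by apply/eqP; rewrite -eqNr qq.
Qed.

Lemma form_real x y : bar x = x -> bar y = y -> a x y = (complex.Re (a x y))%:C%C.
Proof. by move=> xr yr; apply: conj_fixed; rewrite -conjcE ar.2 xr yr. Qed.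

Lemma nm_ge0 x : 0 <= nm x. Proof. exact: sqrtr_ge0. Qed.

Lemma hv_const x : bar x = x -> hv (fun=> x).
Proof.
move=> xr; split=> // e e0; exists 0%N => m n _ _.
by rewrite subrr (hn0 aP : nm 0 = 0).
Qed.

Lemma hv_lin (c : R) u v : hv u -> hv v -> hv (fun n => (c%:C)%C *: u n + v n).
Proof.
move=> [ur uC] [vr vC]; split=> [n|e e0]; first by rewrite bar_anti ur vr conj_real.
have c0 : 0 < `|c| + 1 by rewrite ltr_wpDl.
have [|N HN] := uC (e / 2 / (`|c| + 1)); first by rewrite !divr_gt0.
have [|N' HN'] := vC (e / 2); first by rewrite divr_gt0.
exists (maxn N N') => m n; rewrite !geq_max => /andP[m1 m2] /andP[n1 n2].
have -> : (c%:C)%C *: u m + v m - ((c%:C)%C *: u n + v n) =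
    (c%:C)%C *: (u m - u n) + (v m - v n) by rewrite scalerBr opprD addrACA.
apply: le_lt_trans (hnD aP _ _) _; rewrite [ltRHS]splitr ler_ltD//; last exact: HN'.
rewrite (hnZ aP) normc_real; have := HN m n m1 n1.
rewrite ltr_pdivlMr// => /ltW; apply: le_trans.
by rewrite mulrC ler_wpM2l ?nm_ge0// lerDl.
Qed.

Lemma hv0 : hv (fun=> 0).
Proof. exact: hv_const (bar0 bar_anti). Qed.

Lemma hv_sum (I : Type) (s : seq I) (c : I -> R) (e : I -> nat -> V) :
  (forall i, hv (e i)) -> hv (fun n => \sum_(i <- s) ((c i)%:C)%C *: e i n).
Proof.
move=> eh; elim: s => [|i s IH].
  by rewrite (_ : (fun _ => _) = fun=> 0); [exact: hv0|apply/funext => n; rewrite big_nil].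
rewrite (_ : (fun _ => _) = fun n => ((c i)%:C)%C *: e i n +
   \sum_(j <- s) ((c j)%:C)%C *: e j n); first exact: hv_lin.
by apply/funext => n; rewrite big_cons.
Qed.

Lemma hv_sub u v : hv u -> hv v -> hv (fun n => u n - v n).
Proof.
move=> uh vh; have := hv_lin (-1) vh uh.
by congr (hilbert_vector _ _ _); apply/funext => n; rewrite rmorphN1 scaleN1r addrC.
Qed.

Lemma hv_bounded u : hv u -> exists M N, 0 < M /\ forall n, (N <= n)%N -> nm (u n) <= M.
Proof.
move=> [_ uC]; have [N HN] := uC 1 ltr01.
exists (nm (u N) + 1), N; split=> [|n Nn]; first by rewrite ltr_wpDl ?nm_ge0.
rewrite -[u n](subrK (u N)) [leRHS]addrC; apply: le_trans (hnD aP _ _) _.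
by apply: lerD => //; apply: ltW; exact: HN.
Qed.

Lemma hv_joint u v (eps : R) : hv u -> hv v -> 0 < eps -> exists N, forall m n m' n',
  (N <= m)%N -> (N <= n)%N -> (N <= m')%N -> (N <= n')%N ->
  normc (a (u m) (v n) - a (u m') (v n')) < eps.
Proof.
move=> uh vh e0; have [M [N1 [M0 HM]]] := hv_bounded uh.
have [M' [N2 [M0' HM']]] := hv_bounded vh.
have [|N3 H3] := uh.2 (eps / 2 / M'); first by rewrite !divr_gt0.
have [|N4 H4] := vh.2 (eps / 2 / M); first by rewrite !divr_gt0.
exists (maxn (maxn N1 N2) (maxn N3 N4)) => m n m' n'; rewrite !geq_max.
move=> /andP[/andP[m1 m2] /andP[m3 m4]] /andP[/andP[n1 n2] /andP[n3 n4]].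
move=> /andP[/andP[m1' m2'] /andP[m3' m4']] /andP[/andP[n1' n2'] /andP[n3' n4']].
have -> : a (u m) (v n) - a (u m') (v n') =
    a (u m - u m') (v n) + a (u m') (v n - v n').
  by rewrite (phBl aP) (phBr aP) addrA subrK.
apply: le_lt_trans (normcD _ _) _; rewrite [ltRHS]splitr; apply: ltrD.
  apply: le_lt_trans (ph_CS aP _ _) _.
  apply: le_lt_trans (ler_wpM2l (nm_ge0 _) (HM' n n2)) _.
  by rewrite -ltr_pdivlMr//; exact: H3.
apply: le_lt_trans (ph_CS aP _ _) _.
apply: le_lt_trans (ler_wpM2r (nm_ge0 _) (HM m' m1')) _.
by rewrite mulrC -ltr_pdivlMr//; exact: H4.
Qed.

Lemma dot_joint u v (eps : R) : hv u -> hv v -> 0 < eps -> exists N, forall m n,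
  (N <= m)%N -> (N <= n)%N -> normc (a (u m) (v n) - ((dot u v)%:C)%C) < eps.
Proof.
move=> uh vh e0.
have dc : cvg ((complex.Re (a (u n) (v n)) : R) @[n --> \oo]).
  apply/cauchy_cvgP/cauchy_exP => e e1; have [N HN] := hv_joint uh vh e1.
  exists (complex.Re (a (u N) (v N))); exists N => // n /= Nn.
  rewrite /ball /= -raddfB (le_lt_trans (Re_le_normc _))//.
  by apply: HN => //.
have e2 : 0 < eps / 2 by rewrite divr_gt0.
have [N HN] := hv_joint uh vh e2; exists N => m n Nm Nn.
rewrite (form_real (uh.1 m) (vh.1 n)) -rmorphB normc_real.
move/cvgrPdist_lt/(_ _ e2): dc => -[N' _ HN'].
have := HN' (maxn N N') (leq_maxr _ _); rewrite -/(dot u v).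
have := HN m n _ _ Nm Nn (leq_maxl N N') (leq_maxl N N').
move/(le_lt_trans (Re_le_normc _)); rewrite raddfB /=.
set p := complex.Re (a (u m) _); set q := complex.Re (a (u _) _).
move=> h1 h2; rewrite [ltRHS]splitr -[p - _](subrKA q) .
by apply: le_lt_trans (ler_normD _ _) _; rewrite ltrD// distrC.
Qed.

Lemma dot_cvg u v : hv u -> hv v ->
  (fun n => a (u n) (v n) : C) @ \oo --> (((dot u v)%:C)%C : C).
Proof.
move=> uh vh; apply/cvgC_normc => e e0; have [N HN] := dot_joint uh vh e0.
by exists N => // n /= Nn; exact: HN.
Qed.

Lemma dot_eq u v (l : R) : hv u -> hv v ->
  (fun n => a (u n) (v n) : C) @ \oo --> ((l%:C)%C : C) -> dot u v = l.
Proof. by move=> uh vh /(cvgC_unique _ (dot_cvg uh vh)) []. Qed.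

Lemma dot_linl (c : R) u v w : hv u -> hv v -> hv w ->
  dot (fun n => (c%:C)%C *: u n + v n) w = c * dot u w + dot v w.
Proof.
move=> uh vh wh; apply: dot_eq => //; first exact: hv_lin.
rewrite (_ : (fun n => _) = fun n => ((c%:C)%C : C) * (a (u n) (w n) : C) + (a (v n) (w n) : C)).
  rewrite rmorphD rmorphM; apply: (@cvgD K C); last exact: dot_cvg.
  by apply: (@cvgM K); [exact: cvg_cst|exact: dot_cvg].
by apply/funext => n; rewrite (ph_linl aP) conj_real.
Qed.

Lemma dot_sym u v : hv u -> hv v -> dot u v = dot v u.
Proof.
move=> uh vh; apply: dot_eq => //.
rewrite (_ : (fun n => _) = fun n => a (v n) (u n) : C); first exact: dot_cvg.
apply/funext => n; rewrite (ph_herm aP) (form_real (vh.1 n) (uh.1 n)).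
by rewrite conj_real.
Qed.

Lemma dot0l w : hv w -> dot (fun=> 0) w = 0.
Proof.
move=> wh; apply: dot_eq => //; first exact: hv0.
rewrite (_ : (fun n => _) = fun=> 0); first exact: cvg_cst.
by apply/funext => n; rewrite (ph0l aP).
Qed.

Lemma dot_suml (I : Type) (s : seq I) (c : I -> R) (e : I -> nat -> V) w :
  (forall i, hv (e i)) -> hv w ->
  dot (fun n => \sum_(i <- s) ((c i)%:C)%C *: e i n) w = \sum_(i <- s) c i * dot (e i) w.
Proof.
move=> eh wh; elim: s => [|i s IH].
  rewrite big_nil (_ : (fun _ => _) = fun=> 0) ?dot0l//.
  by apply/funext => n; rewrite big_nil.
rewrite big_cons -IH -dot_linl//; last exact: hv_sum.
by congr (dot _ _); apply/funext => n; rewrite big_cons.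
Qed.

Lemma dot_subl u v w : hv u -> hv v -> hv w ->
  dot (fun n => u n - v n) w = dot u w - dot v w.
Proof.
move=> uh vh wh; rewrite addrC -[- _]mulN1r -dot_linl//.
by congr (dot _ _); apply/funext => n; rewrite rmorphN1 scaleN1r addrC.
Qed.

Lemma dot_ge0 u : hv u -> 0 <= dot u u.
Proof.
move=> uh; have /cvgC_Re h := dot_cvg uh uh.
rewrite /hilbert_dot; apply: limr_ge; first by apply/cvg_ex; exists (dot u u).
by exists 0%N => // n _; exact: ph_Re_ge0.
Qed.

Lemma nm_cvg u : hv u -> (nm (u n) : R) @[n --> \oo] --> (hilbert_norm a u : R).
Proof.
move=> uh; rewrite /hilbert_norm /form_norm.
have /cvgC_Re h := dot_cvg uh uh.
apply: continuous_cvg h.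
exact: sqrt_continuous.
Qed.

Lemma hnorm_le u (M : R) : hv u -> (exists N, forall n, (N <= n)%N -> nm (u n) <= M) ->
  hilbert_norm a u <= M.
Proof.
move=> uh [N HN]; have := nm_cvg uh => h; rewrite -(cvg_lim _ h)//.
by apply: limr_le; [apply/cvg_ex; eexists; exact: h|exists N].
Qed.

Lemma hnorm_eventually u (eps : R) : hv u -> 0 < eps ->
  exists N, forall n, (N <= n)%N -> nm (u n) < hilbert_norm a u + eps.
Proof.
move=> uh e0; have /cvgrPdist_lt/(_ _ e0) [N _ HN] := nm_cvg uh.
exists N => n /HN; rewrite distrC => /(le_lt_trans (ler_norm _)).
by rewrite ltrBlDl.
Qed.

Lemma sqr_hnorm u : hv u -> hilbert_norm a u ^+ 2 = dot u u.
Proof. by move=> uh; rewrite sqr_sqrtr// dot_ge0. Qed.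

Lemma hnorm_ge0 u : 0 <= hilbert_norm a u. Proof. exact: sqrtr_ge0. Qed.

Lemma hnormD_sub u v w : hv u -> hv v -> hv w ->
  hilbert_norm a (fun n => u n - w n) <=
  hilbert_norm a (fun n => u n - v n) + hilbert_norm a (fun n => v n - w n).
Proof.
move=> uh vh wh; apply/ler_addgt0Pl => e e0; apply: hnorm_le; first exact: hv_sub.
have e2 : 0 < e / 2 by rewrite divr_gt0.
have [N1 H1] := hnorm_eventually (hv_sub uh vh) e2.
have [N2 H2] := hnorm_eventually (hv_sub vh wh) e2.
exists (maxn N1 N2) => n; rewrite geq_max => /andP[/H1 h1 /H2 h2].
have -> : u n - w n = (u n - v n) + (v n - w n) by rewrite addrA subrK.
by apply: le_trans (hnD aP _ _) _; rewrite /form_norm in h1 h2 *; rewrite /hn; lra.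
Qed.

Lemma hnorm_sub_sym u v : hv u -> hv v ->
  hilbert_norm a (fun n => u n - v n) = hilbert_norm a (fun n => v n - u n).
Proof.
move=> uh vh; rewrite /hilbert_norm; congr Num.sqrt.
have h1 := hv_sub uh vh; have h2 := hv_sub vh uh.
apply: dot_eq => //; rewrite (_ : (fun n => _) = fun n => a (v n - u n) (v n - u n) : C).
  exact: dot_cvg.
by apply/funext => n; rewrite -opprB (phNl aP) (phNr aP) opprK.
Qed.

Lemma dot_CS u v : hv u -> hv v -> `|dot u v| <= hilbert_norm a u * hilbert_norm a v.
Proof.
move=> uh vh; have /cvgC_norm h := dot_cvg uh vh.
have h2 : (nm (u n) * nm (v n) : R) @[n --> \oo] -->
    (hilbert_norm a u * hilbert_norm a v : R) by apply: cvgM; exact: nm_cvg.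
rewrite normc_real in h; rewrite -(cvg_lim _ h)// -(cvg_lim _ h2)//.
apply: ler_lim; [by apply/cvg_ex; eexists; exact: h|by apply/cvg_ex; eexists; exact: h2|].
by exists 0%N => // n _; exact: ph_CS.
Qed.

(** Diagonal argument: the limit takes its [k]-th term from the [k]-th sequence, at an
    index from which on that sequence moves by less than [1 / (k + 1)]. *)
Lemma hilbert_complete (X : nat -> nat -> V) : (forall k, hv (X k)) ->
  (forall eps : R, 0 < eps -> exists N, forall k l, (N <= k)%N -> (N <= l)%N ->
     hilbert_norm a (fun n => X k n - X l n) < eps) ->
  exists2 w, hv w & forall eps : R, 0 < eps -> exists N, forall k, (N <= k)%N ->
     hilbert_norm a (fun n => X k n - w n) <= eps.
Proof.
move=> Xh XC.
have ex k : exists m0, forall m n, (m0 <= m)%N -> (m0 <= n)%N ->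
    nm (X k m - X k n) < k.+1%:R^-1.
  by apply: (Xh k).2; rewrite invr_gt0.
pose m0 k := projT1 (cid (ex k)).
have m0P k m n : (m0 k <= m)%N -> (m0 k <= n)%N -> nm (X k m - X k n) < k.+1%:R^-1.
  exact: (projT2 (cid (ex k))).
pose w k := X k (m0 k).
have inv_small (e : R) : 0 < e -> exists N, forall k, (N <= k)%N -> k.+1%:R^-1 < e.
  move=> e0; exists (Num.truncn e^-1) => k Nk; rewrite invf_plt ?posrE//.
  by apply: lt_le_trans (truncnS_gt _) _; rewrite ler_nat ltnS.
have key (e : R) : 0 < e -> exists N, forall k l, (N <= k)%N -> (N <= l)%N ->
    forall n, (m0 k <= n)%N -> nm (X k n - w l) < e.
  move=> e0; have e4 : 0 < e / 4 by rewrite divr_gt0.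
  have [N1 H1] := inv_small _ e4; have [N2 H2] := XC _ e4.
  exists (maxn N1 N2) => k l; rewrite !geq_max => /andP[k1 k2] /andP[l1 l2] n kn.
  have [P HP] := hnorm_eventually (hv_sub (Xh k) (Xh l)) e4.
  pose p := maxn P (maxn (m0 k) (m0 l)).
  have -> : X k n - w l = (X k n - X k p) + (X k p - X l p) + (X l p - w l).
    by rewrite !subrKA.
  have h1 : nm (X k n - X k p) < e / 4.
    by apply: lt_trans (H1 k k1); apply: m0P => //; rewrite /p !leq_max leqnn orbT.
  have h2 : nm (X l p - w l) < e / 4.
    by apply: lt_trans (H1 l l1); apply: m0P => //; rewrite /p !leq_max leqnn !orbT.
  have h3 := HP p (leq_maxl _ _); have h4 := H2 k l k2 l2.
  apply: le_lt_trans (hnD aP _ _) _.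
  have := hnD aP (X k n - X k p) (X k p - X l p).
  by rewrite /form_norm in h1 h2 h3 *; rewrite /hn; lra.
have wh : hv w.
  split=> [k|e e0]; first exact: (Xh k).1.
  have [N HN] := key e e0; exists N => k l Nk Nl; exact: HN.
exists w => // e e0; have [N HN] := key e e0; exists N => k Nk.
apply: hnorm_le; first exact: hv_sub.
exists (maxn N (m0 k)) => n; rewrite geq_max => /andP[Nn kn].
by apply: ltW; exact: HN.
Qed.

End HilbertVectors.

(** A substitute for limits along finite sets ordered by inclusion: from [x0] on,
    an increasing quantity [r] grows by at most [eps]. *)
Lemma near_sup (R : realType) (T : Type) (P : T -> Prop) (r : T -> R) (M eps : R) :
  (exists x, P x) -> (forall x, P x -> r x <= M) -> 0 < eps ->
  exists x0, P x0 /\ forall x, P x -> r x <= r x0 + eps.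
Proof.
move=> [x Px] rM e0; pose A := [set r x | x in [set x | P x]].
have A0 : has_sup A.
  by split; [exists (r x); exists x|exists M => _ [y Py <-]; exact: rM].
have [_ [x0 Px0 <-] h] := sup_adherent e0 A0; exists x0; split=> // y Py.
have : r y <= sup A by apply: ub_le_sup; [exact: A0.2|exists y].
by rewrite ltrBlDr in h; move/le_trans; apply; exact: ltW.
Qed.

Section Orthonormal.
Variables (R : realType) (V : tvsType R[i]) (bar : V -> V).
Hypothesis bar_inv : cont_antilinear_involution bar.
Variable a : V -> V -> R[i].
Hypothesis ar : real_cont_pos_herm bar a.
Local Notation K := R[i].
Local Notation C := (R[i]^o).
Local Notation hv := (hilbert_vector bar a).
Local Notation dot := (hilbert_dot a).
Local Notation hnorm := (hilbert_norm a).
Local Notation nm := (form_norm a).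

Let aP := cph_pos ar.1.

Section Family.
Variables (I : choiceType) (e : I -> nat -> V).
Hypothesis eh : forall i, hv (e i).
Hypothesis eo : forall i j, dot (e i) (e j) = (i == j)%:R.
Implicit Types (J : seq I) (c d : I -> R) (u : nat -> V).

Definition comb c J n := \sum_(j <- J) ((c j)%:C)%C *: e j n.

Lemma hv_comb c J : hv (comb c J).
Proof. exact: (hv_sum bar_inv ar). Qed.

Lemma dot_comb c J u : hv u -> dot (comb c J) u = \sum_(j <- J) c j * dot (e j) u.
Proof. exact: (dot_suml bar_inv ar). Qed.

Lemma sum_delta J i (F : I -> R) : uniq J ->
  \sum_(j <- J) F j * (j == i)%:R = if i \in J then F i else 0.
Proof.
move=> uJ; case: ifPn => iJ.
  rewrite (bigD1_seq i)//= eqxx mulr1 big1 ?addr0// => j /negbTE ->.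
  by rewrite mulr0.
rewrite big_seq big1// => j jJ; case: eqP => [ji|]; last by rewrite mulr0.
by rewrite -ji jJ in iJ.
Qed.

Lemma dot_comb_e c J i : uniq J -> dot (comb c J) (e i) = if i \in J then c i else 0.
Proof.
move=> uJ; rewrite dot_comb// -(sum_delta _ c)//.
by apply: eq_bigr => j _; rewrite eo.
Qed.

Lemma dot_comb2 c d J J' : uniq J' ->
  dot (comb c J) (comb d J') = \sum_(j <- J) c j * (if j \in J' then d j else 0).
Proof.
move=> uJ'; rewrite dot_comb; last exact: hv_comb.
apply: eq_bigr => j _; congr (_ * _).
by rewrite (dot_sym ar)//; [exact: dot_comb_e|exact: hv_comb].
Qed.

Lemma sqr_hnorm_comb c J : uniq J -> hnorm (comb c J) ^+ 2 = \sum_(j <- J) c j ^+ 2.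
Proof.
move=> uJ; rewrite (sqr_hnorm ar (hv_comb c J)) dot_comb2//.
by rewrite big_seq [RHS]big_seq; apply: eq_bigr => j ->; rewrite expr2.
Qed.

Definition coef u i := dot (e i) u.

Lemma dot_bessel u J : hv u -> uniq J -> \sum_(j <- J) coef u j ^+ 2 <= dot u u.
Proof.
move=> uh uJ; pose p := comb (coef u) J; have ph : hv p by exact: hv_comb.
have pu : dot p u = \sum_(j <- J) coef u j ^+ 2.
  by rewrite dot_comb//; apply: eq_bigr => j _; rewrite -expr2.
have pp : dot p p = \sum_(j <- J) coef u j ^+ 2.
  by rewrite -(sqr_hnorm ar ph) sqr_hnorm_comb.
have sh := hv_sub bar_inv ar uh ph.
have := dot_ge0 ar sh.
rewrite (dot_subl bar_inv ar)// (dot_sym ar uh sh) (dot_sym ar ph sh).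
rewrite !(dot_subl bar_inv ar)// (dot_sym ar uh ph) pu pp.
by rewrite subrr subr0 subr_ge0.
Qed.

Lemma hnorm_comb_sub c J J' : uniq J -> uniq J' -> {subset J' <= J} ->
  hnorm (fun n => comb c J n - comb c J' n) ^+ 2 =
  \sum_(j <- J) c j ^+ 2 - \sum_(j <- J') c j ^+ 2.
Proof.
move=> uJ uJ' JJ'; have h := hv_comb c J; have h' := hv_comb c J'.
have sh := hv_sub bar_inv ar h h'.
have sq L : uniq L -> dot (comb c L) (comb c L) = \sum_(j <- L) c j ^+ 2.
  by move=> uL; rewrite -(sqr_hnorm ar (hv_comb c L)) sqr_hnorm_comb.
have p'p : dot (comb c J') (comb c J) = \sum_(j <- J') c j ^+ 2.
  rewrite dot_comb2// big_seq [RHS]big_seq; apply: eq_bigr => j jJ'.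
  by rewrite JJ'// expr2.
rewrite (sqr_hnorm ar sh) (dot_subl bar_inv ar)//.
rewrite (dot_sym ar h sh) (dot_sym ar h' sh) !(dot_subl bar_inv ar)//.
by rewrite (dot_sym ar h h') p'p !sq//; ring.
Qed.

(** As [u] stays away from the span, the residues of its partial projections have a
    nonzero limit, orthogonal to the family. *)
Lemma orthogonal_residue u (eps : R) : hv u -> 0 < eps ->
  (forall J c, uniq J -> eps <= hnorm (fun n => u n - comb c J n)) ->
  exists2 w, hv w & (forall i, dot w (e i) = 0) /\ 0 < dot w w.
Proof.
move=> uh e0 far; pose r J := \sum_(j <- J) coef u j ^+ 2.
have ex k : exists J, uniq J /\ forall J', uniq J' -> r J' <= r J + k.+1%:R^-1 ^+ 2.
  apply: (@near_sup _ _ (fun J => uniq J) r (dot u u)); first by exists [::].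
    by move=> J uJ; exact: dot_bessel.
  by rewrite exprn_gt0// invr_gt0.
pose J k := projT1 (cid (ex k)).
have uJ k : uniq (J k) by exact: (projT2 (cid (ex k))).1.
have JP k J' : uniq J' -> r J' <= r (J k) + k.+1%:R^-1 ^+ 2.
  exact: (projT2 (cid (ex k))).2.
pose x k n := u n - comb (coef u) (J k) n.
have xh k : hv (x k) by apply: (hv_sub bar_inv ar) => //; exact: hv_comb.
have inv_small (q : R) : 0 < q -> exists N, forall k, (N <= k)%N -> k.+1%:R^-1 < q.
  move=> q0; exists (Num.truncn q^-1) => k Nk; rewrite invf_plt ?posrE//.
  by apply: lt_le_trans (truncnS_gt _) _; rewrite ler_nat ltnS.
have near k J' : uniq J' -> {subset J k <= J'} ->
    hnorm (fun n => comb (coef u) J' n - comb (coef u) (J k) n) <= k.+1%:R^-1.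
  move=> uJ' sJ; rewrite -ler_sqr ?nnegrE ?(hnorm_ge0) ?invr_ge0//.
  by rewrite hnorm_comb_sub// lerBlDl; exact: JP.
have [q q0|w wh wP] := @hilbert_complete _ _ _ bar_inv _ ar x xh.
  have q2 : 0 < q / 2 by rewrite divr_gt0.
  have [N HN] := inv_small _ q2; exists N => k l /HN hk /HN hl.
  pose J' := undup (J k ++ J l).
  have sk : {subset J k <= J'} by move=> i; rewrite mem_undup mem_cat => ->.
  have sl : {subset J l <= J'} by move=> i; rewrite mem_undup mem_cat orbC => ->.
  have h1 := near k J' (undup_uniq _) sk; have h2 := near l J' (undup_uniq _) sl.
  rewrite (_ : (fun n => _) = fun n => comb (coef u) (J l) n - comb (coef u) (J k) n).
    apply: le_lt_trans (hnormD_sub bar_inv ar (hv_comb (coef u) (J l))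
      (hv_comb (coef u) J') (hv_comb (coef u) (J k))) _.
    rewrite (hnorm_sub_sym bar_inv ar (hv_comb _ (J l)) (hv_comb _ J')).
    by rewrite [ltRHS]splitr; apply: ltrD; [exact: le_lt_trans h2 hl|exact: le_lt_trans h1 hk].
  by apply/funext => n; rewrite /x opprB addrC addrA subrK.
exists w => //.
have small i k : `|dot (x k) (e i)| <= k.+1%:R^-1.
  rewrite /x (dot_subl bar_inv ar)//; last exact: hv_comb.
  rewrite dot_comb_e//; case: ifPn => ik; rewrite (dot_sym ar)// -/(coef u i).
    by rewrite subrr normr0 invr_ge0.
  rewrite subr0 -ler_sqr ?nnegrE ?invr_ge0// real_normK ?num_real//.
  have := JP k (i :: J k); rewrite /= ik uJ => /(_ isT).
  by rewrite /r big_cons addrC lerD2l.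
have sub_w k : hnorm (fun n => w n - x k n) = hnorm (fun n => x k n - w n).
  exact: (hnorm_sub_sym bar_inv ar).
split=> [i|].
  apply/eqP; rewrite -normr_eq0 eq_le normr_ge0 andbT.
  apply/ler_addgt0Pl => q q0; rewrite addr0.
  have q2 : 0 < q / 2 by rewrite divr_gt0.
  have [N1 H1] := inv_small _ q2; have [N2 H2] := wP _ q2.
  pose k := maxn N1 N2.
  have -> : dot w (e i) = dot (fun n => w n - x k n) (e i) + dot (x k) (e i).
    by rewrite (dot_subl bar_inv ar)// subrK.
  apply: le_trans (ler_normD _ _) _; rewrite [leRHS]splitr; apply: lerD.
    apply: le_trans (dot_CS ar (hv_sub bar_inv ar wh (xh k)) (eh i)) _.
    rewrite /hilbert_norm eo eqxx sqrtr1 mulr1 -/(hnorm _) sub_w.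
    exact: H2 (leq_maxr _ _).
  by apply: le_trans (small i k) _; apply: ltW; exact: H1 (leq_maxl _ _).
rewrite -(sqr_hnorm ar wh) exprn_gt0//.
have e2 : 0 < eps / 2 by rewrite divr_gt0.
have [N HN] := wP _ e2; have := HN N (leqnn _); have := far (J N) (coef u) (uJ N).
have := hnormD_sub bar_inv ar (xh N) wh (hv0 bar_inv ar).
rewrite (_ : (fun n => x N n - 0) = x N); last by apply/funext => n; rewrite subr0.
rewrite (_ : (fun n => w n - 0) = w); last by apply/funext => n; rewrite subr0.
rewrite -[hnorm (fun n => u n - _)]/(hnorm (x N)); lra.
Qed.

End Family.

Lemma sum_partition (I : eqType) (W : nmodType) (s : seq (R * I)) (G : R * I -> W) :
  \sum_(p <- s) G p = \sum_(i <- undup (map snd s)) \sum_(p <- s | p.2 == i) G p.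
Proof.
rewrite (exchange_big_dep xpredT)//= big_seq [RHS]big_seq; apply: eq_bigr => p ps.
rewrite -big_filter (_ : [seq i <- undup (map snd s) | p.2 == i] = [:: p.2]).
  by rewrite big_seq1.
apply: perm_small_eq => //; apply: uniq_perm => //.
  by rewrite filter_uniq// undup_uniq.
move=> i; rewrite mem_filter mem_undup inE eq_sym; case: eqP => //= ->.
by apply/mapP; exists p.
Qed.

Lemma comb_partition (I : choiceType) (e : I -> nat -> V) (s : seq (R * I)) n :
  \sum_(p <- s) (p.1%:C)%C *: e p.2 n =
  comb e (fun i => \sum_(p <- s | p.2 == i) p.1) (undup (map snd s)) n.
Proof.
rewrite sum_partition; apply: eq_bigr => i _; rewrite rmorph_sum scaler_suml.
by apply: eq_bigr => p /eqP ->.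
Qed.

(** Zorn's lemma gives a maximal orthonormal set; were its span not dense,
    [orthogonal_residue] would enlarge it. *)
Lemma hilbert_basis_exists :
  exists (I : choiceType) (e : I -> nat -> V), hilbert_basis bar a e.
Proof.
pose P (A : set (nat -> V)) := (forall u, A u -> hv u) /\
  forall u v, A u -> A v -> dot u v = (u == v)%:R.
have [F FP Ft|A [[Ah Ao] Amax]] := @Zorn_bigcup _ P.
  split=> [u [A FA Au]|u v [A FA Au] [B FB Bv]]; first by apply: (FP A FA).1.
  have [AB|BA] := Ft A B FA FB.
    by apply: (FP B FB).2 => //; exact: AB.
  by apply: (FP A FA).2 => //; exact: BA.
exists (set_type A : choiceType), (fun i => set_val i).
pose e (i : set_type A) : nat -> V := set_val i.
have eh i : hv (e i) by apply: Ah; exact: set_valP.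
have eo i j : dot (e i) (e j) = (i == j)%:R by rewrite Ao//; exact: set_valP.
split=> // u uh eps e0; apply: contrapT => /forallNP far.
have [J c uJ|w wh [wo ww]] := orthogonal_residue eh eo uh e0.
  have := far [seq (c j, j) | j <- J]; move/negP; rewrite -leNgt.
  by congr (_ <= hilbert_norm _ _); apply/funext => n; rewrite big_map.
pose N := Num.sqrt (dot w w); have N0 : 0 < N by rewrite sqrtr_gt0.
pose w' n := ((N^-1)%:C)%C *: w n.
have w'h : hv w'.
  rewrite (_ : w' = fun n => ((N^-1)%:C)%C *: w n + 0); last first.
    by apply/funext => n; rewrite addr0.
  by apply: (hv_lin bar_inv ar) => //; exact: (hv0 bar_inv ar).
have w'dot u' : hv u' -> dot w' u' = N^-1 * dot w u'.
  move=> uh'; rewrite (_ : w' = fun n => ((N^-1)%:C)%C *: w n + 0); last first.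
    by apply/funext => n; rewrite addr0.
  rewrite (dot_linl bar_inv ar)//; last exact: (hv0 bar_inv ar).
  by rewrite (dot0l bar_inv ar)// addr0.
have w'w' : dot w' w' = 1.
  rewrite w'dot// (dot_sym ar wh w'h) w'dot// -[dot w w]sqr_sqrtr; last exact: ltW.
  by rewrite -/N; field; rewrite gt_eqF.
have w'A u' : A u' -> dot w' u' = 0.
  move=> Au; rewrite w'dot; last exact: Ah.
  by have := wo (SigSub (mem_set Au)); rewrite /= => ->; rewrite mulr0.
have nA : ~ A w'.
  by move=> /w'A; rewrite w'w' => /eqP; rewrite oner_eq0.
apply: (Amax (A `|` [set w'])).
  by split=> [x Ax|sub]; [left|apply: nA; apply: sub; right].
split=> [x [/Ah//|->//]|x y].
move=> [Ax|->] [Ay|->].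
- exact: Ao.
- rewrite (dot_sym ar (Ah _ Ax) w'h) w'A//; case: eqP => // xw.
  by rewrite xw in Ax.
- by rewrite w'A//; case: eqP => // wy; rewrite wy in nA.
- by rewrite w'w' eqxx.
Qed.

End Orthonormal.

(** * Series over tuples *)

Section TupleSums.
Variables (R : realType) (I : choiceType).
Implicit Types (J : seq I) (F : seq I -> R) (t : seq I).

Lemma ler_sum_sub (A : eqType) (s s' : seq A) (F : A -> R) : uniq s -> uniq s' ->
  {subset s <= s'} -> (forall x, 0 <= F x) -> \sum_(x <- s) F x <= \sum_(x <- s') F x.
Proof.
move=> us us' ss' F0; have p : perm_eq s [seq x <- s' | x \in s].
  apply: uniq_perm => //; first exact: filter_uniq.
  by move=> x; rewrite mem_filter; case xs: (x \in s) => //=; rewrite ss'.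
rewrite (perm_big _ p) big_filter /= [leRHS](bigID (fun x => x \in s)) /= lerDl.
by apply: sumr_ge0.
Qed.

Lemma sum_words_sub J J' k F : uniq J -> uniq J' -> {subset J <= J'} ->
  (forall t, 0 <= F t) -> \sum_(t <- words J k) F t <= \sum_(t <- words J' k) F t.
Proof.
move=> uJ uJ' sJ F0; apply: ler_sum_sub => //; try exact: words_uniq.
by move=> t; rewrite !mem_words => /andP[-> /allP h]; apply/allP => i /h /sJ.
Qed.

Variable F : seq I -> R.
Hypothesis F0 : forall t, 0 <= F t.

Lemma esum_words k J : uniq J ->
  ((\sum_(t <- words J k) F t)%:E <= \esum_(i in [set: k.-tuple I]) (F i)%:E)%E.
Proof.
move=> uJ; pose L : seq (k.-tuple I) := pmap insub (words J k).
have LE : map val L = words J k.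
  rewrite /L (pmap_filter (@insubK _ _ _)) /=; apply/all_filterP/allP => t.
  by rewrite mem_words => /andP[tk _]; rewrite insubT.
have uL : uniq L by rewrite -(map_inj_uniq val_inj) LE words_uniq.
apply: esum_ge; exists [set` L]; first by split=> //; exact: finite_seq.
by rewrite -fsbig_seq// -LE big_map sumEFin.
Qed.

Lemma esum_le_words k (M : R) : (forall J, uniq J -> \sum_(t <- words J k) F t <= M) ->
  (\esum_(i in [set: k.-tuple I]) (F i)%:E <= M%:E)%E.
Proof.
move=> H; apply: ge_ereal_sup => _ [A [fA _] <-].
rewrite fsbig_finite//= sumEFin lee_fin.
pose L := [seq val x | x <- finmap.enum_fset (fset_set A)].
rewrite -(big_map val xpredT F) -/L; apply: le_trans (H (undup (flatten L)) _).
  apply: ler_sum_sub => //.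
  - by rewrite map_inj_uniq ?finmap.fset_uniq//; exact: val_inj.
  - by apply: words_uniq; exact: undup_uniq.
  move=> t tL; rewrite mem_words; move: (tL) => /mapP[x _ tx].
  rewrite {1}tx size_tuple eqxx /=; apply/allP => i it; rewrite inE mem_undup.
  by apply/flattenP; exists t.
exact: undup_uniq.
Qed.

Lemma series_words_ge (c : nat -> R) (M : R) K J : (forall k, 0 <= c k) -> uniq J ->
  ((\sum_(0 <= k <oo) ((c k)%:E * \esum_(i in [set: k.-tuple I]) (F i)%:E))
     <= M%:E)%E ->
  \sum_(k < K) c k * \sum_(t <- words J k) F t <= M.
Proof.
move=> c0 uJ H; rewrite -lee_fin; apply: le_trans H.
have e0 k : (0 <= \esum_(i in [set: k.-tuple I]) (F i)%:E)%E.
  by apply: esum_ge0 => t _; rewrite lee_fin.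
apply: le_trans (nneseries_lim_ge K _); last first.
  by move=> k _ _; rewrite mule_ge0// lee_fin.
rewrite big_mkord -sumEFin; apply: lee_sum => k _.
by rewrite EFinM lee_wpmul2l// ?lee_fin//; exact: esum_words.
Qed.

Lemma series_words_le (c : nat -> R) (M : R) : (forall k, 0 < c k) ->
  (forall K J, uniq J -> \sum_(k < K) c k * \sum_(t <- words J k) F t <= M) ->
  ((\sum_(0 <= k <oo) ((c k)%:E * \esum_(i in [set: k.-tuple I]) (F i)%:E))
     <= M%:E)%E.
Proof.
move=> c0 H.
have e0 k : (0 <= \esum_(i in [set: k.-tuple I]) (F i)%:E)%E.
  by apply: esum_ge0 => t _; rewrite lee_fin.
pose S k J := \sum_(t <- words J k) F t.
have S0 k J : 0 <= S k J by exact: sumr_ge0.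
have SM k J : uniq J -> S k J <= M / c k.
  move=> uJ; rewrite ler_pdivlMr// mulrC; apply: le_trans (H k.+1 J uJ).
  rewrite big_ord_recr /= lerDr sumr_ge0// => i _.
  by rewrite mulr_ge0 ?(ltW (c0 i))//; exact: S0.
apply: lime_le; first by apply: is_cvg_nneseries => k _ _; rewrite mule_ge0// lee_fin ltW.
near=> K; rewrite big_mkord; apply/lee_addgt0Pr => e pe.
pose T := \sum_(k < K) c k; have T0 : 0 <= T by apply: sumr_ge0 => k _; exact: ltW.
have d0 : 0 < e / (T + 1) by rewrite divr_gt0// ltr_wpDl.
have ex k : exists J, uniq J /\ forall J', uniq J' -> S k J' <= S k J + e / (T + 1).
  apply: (@near_sup _ _ (fun J => uniq J) (S k) (M / c k)) => //; first by exists [::].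
  exact: SM.
pose J0 k := projT1 (cid (ex k)).
have J0P k : uniq (J0 k) /\ forall J', uniq J' -> S k J' <= S k (J0 k) + e / (T + 1).
  exact: (projT2 (cid (ex k))).
pose J := undup (flatten [seq J0 k | k <- iota 0 K]).
apply: le_trans (_ : _ <= \sum_(k < K) (c k * (S k J + e / (T + 1)))%:E)%E _.
  apply: lee_sum => k _; rewrite EFinM lee_wpmul2l ?lee_fin ?(ltW (c0 _))//.
  apply: esum_le_words => J' uJ'; apply: le_trans ((J0P k).2 J' uJ') _.
  rewrite lerD2r; apply: sum_words_sub => //; [exact: (J0P k).1|exact: undup_uniq|].
  move=> i ik; rewrite mem_undup; apply/flatten_mapP; exists (k : nat) => //.
  by rewrite mem_iota add0n ltn_ord.
rewrite sumEFin -EFinD lee_fin; under eq_bigr do rewrite mulrDr.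
rewrite big_split /= lerD//; first by apply: H; exact: undup_uniq.
rewrite -mulr_suml -/T mulrA ler_pdivrMr ?ltr_wpDl// mulrC.
by rewrite ler_wpM2l ?(ltW pe)// lerDl.
Unshelve. all: by end_near. Qed.

End TupleSums.

Lemma cvgR_sum (R : realType) (T A : Type) (G : set_system T) (FG : Filter G)
    (s : seq A) (f : A -> T -> R) (l : A -> R) :
  (forall i, f i x @[x --> G] --> l i) ->
  (\sum_(i <- s) f i x) @[x --> G] --> \sum_(i <- s) l i.
Proof.
move=> fl; elim: s => [|i s IH].
  rewrite big_nil (_ : (fun x => _) = fun=> 0); first exact: cvg_cst.
  by apply/funext => x; rewrite big_nil.
rewrite big_cons (_ : (fun x => _) = fun x => f i x + \sum_(j <- s) f j x).
  exact: cvgD.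
by apply/funext => x; rewrite big_cons.
Qed.

(** * Functionals represented by vectors *)

Section Flat.
Variables (R : realType) (V : tvsType R[i]) (bar : V -> V).
Hypothesis bar_inv : cont_antilinear_involution bar.
Local Notation K := R[i].
Local Notation C := (R[i]^o).
Local Notation E := (real_dual bar).

Section Form.
Variable a : V -> V -> R[i].
Hypothesis ar : real_cont_pos_herm bar a.
Local Notation hv := (hilbert_vector bar a).
Local Notation dot := (hilbert_dot a).
Local Notation hnorm := (hilbert_norm a).
Local Notation nm := (form_norm a).
Implicit Types (x y : V) (rho : E).

Let aP := cph_pos ar.1.

Section Vector.
Variable u : nat -> V.
Hypothesis uh : hv u.

Lemma flat_ex x : exists z : C, (fun n => a (u n) x : C) @ \oo --> z.
Proof.
apply: cauchy_cvgC => e e0; have x0 : 0 < nm x + 1 by rewrite ltr_wpDl ?sqrtr_ge0.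
have [|N HN] := uh.2 (e / (nm x + 1)); first by rewrite divr_gt0.
exists [set n | (N <= n)%N]; first by exists N.
move=> m n /= Nm Nn; rewrite -(phBl aP); apply: le_lt_trans (ph_CS aP _ _) _.
have := HN m n Nm Nn; rewrite ltr_pdivlMr//; apply: le_lt_trans.
by rewrite ler_wpM2l ?sqrtr_ge0// lerDl.
Qed.

Let fl x : C := lim ((a (u n) x : C) @[n --> \oo]).

Lemma fl_cvg x : (fun n => a (u n) x : C) @ \oo --> fl x.
Proof. by apply/cvg_ex; exact: flat_ex. Qed.

Lemma fl_bound x : normc (fl x) <= hnorm u * nm x.
Proof.
apply/ler_addgt0Pl => e e0; have x0 : 0 < nm x + 1 by rewrite ltr_wpDl ?sqrtr_ge0.
have d0 : 0 < e / (nm x + 1) by rewrite divr_gt0.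
have [N HN] := hnorm_eventually ar uh d0.
refine (@cvgC_le R nat \oo _ _ _ _ (@fl_cvg x) _); exists N => // n /= /HN/ltW un.
apply: le_trans (ph_CS aP _ _) _; apply: le_trans (ler_wpM2r (sqrtr_ge0 _) un) _.
rewrite mulrDl addrC lerD2r mulrAC ler_pdivrMr// ler_wpM2l ?(ltW e0)//.
by rewrite lerDl.
Qed.

Lemma fl_lin : lin_fun fl.
Proof.
move=> c x y; apply: (cvgC_unique _ (@fl_cvg _)).
rewrite (_ : (fun n => _) = fun n => (c : C) * (a (u n) x : C) + (a (u n) y : C)); last first.
  by apply/funext => n; rewrite (ph_linr aP).
apply: (@cvgD K C); last exact: fl_cvg.
by apply: (@cvgM K); [exact: cvg_cst|exact: fl_cvg].
Qed.

Lemma fl_real x : (fl x)^* = fl (bar x).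
Proof.
apply: cvgC_unique (@fl_cvg (bar x)).
rewrite (_ : (fun n => _) = fun n => (a (u n) x)^* : C); last first.
  by apply/funext => n; rewrite -conjcE ar.2 uh.1.
exact: cvgC_conj (@fl_cvg x).
Qed.

Lemma fn_flat : fn (flat bar a u) = fl.
Proof.
rewrite /fn /flat /= insubdK//; apply/asboolP; split.
- exact: fl_lin.
- exact: (bounded_continuous ar.1 fl_lin fl_bound).
- by move=> x; rewrite conjcE; exact: fl_real.
Qed.

Lemma flat_cvg x : (fun n => a (u n) x : C) @ \oo --> (fn (flat bar a u) x : C).
Proof. by rewrite fn_flat; exact: fl_cvg. Qed.

Lemma flat_bound x : normc (fn (flat bar a u) x) <= hnorm u * nm x.
Proof. by rewrite fn_flat; exact: fl_bound. Qed.

Lemma flat_dot x : bar x = x -> fn (flat bar a u) x = ((dot u (fun=> x))%:C)%C.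
Proof.
move=> xr; apply: cvgC_unique (@flat_cvg x) _.
exact: (dot_cvg ar uh (hv_const ar xr)).
Qed.

End Vector.

Lemma fn_real_vec rho x : bar x = x -> fn rho x = ((complex.Re (fn rho x))%:C)%C.
Proof. by move=> xr; apply: conj_fixed; rewrite fn_real xr. Qed.

Lemma normc_i (p q : R) : normc ('i * (q%:C)%C + (p%:C)%C : K) ^+ 2 = p ^+ 2 + q ^+ 2.
Proof.
have -> : 'i * (q%:C)%C + (p%:C)%C = Complex p q by rewrite -complexiE; simpc.
by rewrite sqr_sqrtr// addr_ge0// sqr_ge0.
Qed.

(** By splitting [x] into real and imaginary parts, estimates of real functionals by
    real forms need only be proved on real vectors. *)
Lemma real_split x : exists x1 x2, [/\ bar x1 = x1, bar x2 = x2,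
  forall rho, normc (fn rho x) ^+ 2 =
    complex.Re (fn rho x1) ^+ 2 + complex.Re (fn rho x2) ^+ 2 &
  complex.Re (a x x) = complex.Re (a x1 x1) + complex.Re (a x2 x2)].
Proof.
have [[x1 x2] /= [r1 r2 ->]] := real_imag (bar_antilinear bar_inv) (barK bar_inv) x.
exists x1, x2; split=> // [rho|].
  rewrite fn_lin (fn_real_vec rho r1) (fn_real_vec rho r2) /=.
  by rewrite normc_i.
rewrite (ph_linl aP) !(ph_linr aP) conjCi.
have -> : a x1 x2 = a x2 x1 by rewrite (ph_herm aP x2) -conjcE ar.2 r1 r2.
rewrite mulrDr mulrA mulNr -expr2 sqrCi opprK mul1r -raddfD; congr complex.Re.
by ring.
Qed.

End Form.
End Flat.

(** * Gelfand transforms are analytic of Hilbert-Schmidt type *)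

Section AnalyticHS.
Variables (R : realType) (V : tvsType R[i]) (bar : V -> V).
Hypothesis bar_inv : cont_antilinear_involution bar.
Local Notation K := R[i].
Local Notation C := (R[i]^o).
Local Notation E := (real_dual bar).

Lemma dot_const (a : V -> V -> K) x : hilbert_dot a (fun=> x) (fun=> x) = complex.Re (a x x).
Proof. by rewrite /hilbert_dot lim_cst//. Qed.

Lemma flat_bessel a (ar : real_cont_pos_herm bar a) (I : choiceType)
    (e : I -> nat -> V) J :
  (forall i, hilbert_vector bar a (e i)) ->
  (forall i j, hilbert_dot a (e i) (e j) = (i == j)%:R) -> uniq J ->
  bessel a [seq fn (flat bar a (e j)) | j <- J].
Proof.
move=> eh eo uJ v; have [x1 [x2 [r1 r2 nE ->]]] := real_split bar_inv ar v.
rewrite big_map (eq_bigr _ (fun j _ => nE _)) big_split /=.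
have key x : bar x = x ->
    \sum_(j <- J) complex.Re (fn (flat bar a (e j)) x) ^+ 2 <= complex.Re (a x x).
  move=> xr; rewrite -dot_const.
  apply: le_trans (dot_bessel bar_inv ar eh eo (hv_const ar xr) uJ).
  by apply: ler_sum => j _; rewrite (flat_dot ar (eh j) xr).
by rewrite lerD// key.
Qed.

Section Gelfand.
Variables (W : tvsType R[i]) (iota : sym_alg V -> W).
Hypothesis cpl : is_completion sym_nbhs0 iota.
Local Notation S := (sym_alg V).
#[local] Instance FTB X : ProperFilter (trace_nbhs iota X) := trace_proper cpl X.

(** Near [X] the partial sums are bounded by [Qd_HS], applied to the functionals
    of a basis together with the point [xi]. To have one bound for the whole
    segment, the rank one forms of its end points are added to [a]: they dominate
    the rank one form of every point in between. *)
Lemma gelfand_HS X : analytic_HS (gelfand bar iota X).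
Proof.
split=> [|sigma sigma' a ar]; first exact: gelfand_smooth.
have [I [e eb]] := hilbert_basis_exists bar_inv ar.
pose b := add_form a (fsum [:: fn sigma; fn sigma']).
have ll2 : all_lin [:: fn sigma; fn sigma'] by exact: (all_lin_fn [:: sigma; sigma']).
have bc : cont_pos_herm b.
  apply: cph_add; first exact: ar.1.
  by apply: (cph_fsum ll2) => f; exact: (@cont_map_fn _ _ _ [:: sigma; sigma']).
have b4c : cont_pos_herm (scale_form (2 ^+ 2) b).
  by apply: cph_scale => //; exact: sqr_ge0.
have [M [M0 HM]] := trace_bounded cpl X b4c.
exists (2 * M ^+ 2), I, e; split=> // lambda /andP[l0 l1].
set xi := _ + _.
have xiE v : normc (fn xi v) ^+ 2 <= normc (fn sigma v) ^+ 2 + normc (fn sigma' v) ^+ 2.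
  have -> : fn xi v = (lambda%:C)%C * fn sigma v + ((1 - lambda)%:C)%C * fn sigma' v.
    rewrite /xi fnZD; congr (_ + _).
    by rewrite -[_ *: sigma' in LHS]addr0 fnZD -[RHS]addr0.
  set p := normc (fn sigma v); set q := normc (fn sigma' v).
  apply: le_trans (_ : _ <= (lambda * p + (1 - lambda) * q) ^+ 2) _.
    rewrite ler_sqr ?nnegrE ?normc_ge0//; last first.
      by rewrite addr_ge0// mulr_ge0 ?normc_ge0// subr_ge0.
    apply: le_trans (normcD _ _) _; rewrite !normcM !normc_real.
    by rewrite !ger0_norm ?subr_ge0.
  have : 0 <= lambda * (1 - lambda) * (p - q) ^+ 2.
    by rewrite mulr_ge0 ?sqr_ge0// mulr_ge0// subr_ge0.
  have := sqr_ge0 p; have := sqr_ge0 q; nra.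
apply: (@series_words_le _ _ (fun t => normc (iterD [seq flat bar a (e j) | j <- t]
  (gelfand bar iota X) xi) ^+ 2)) => [t|k|k0 J uJ].
- exact: sqr_ge0.
- by rewrite invr_gt0 ltr0n fact_gt0.
have cv : (\sum_(k <- index_enum 'I_k0) k`!%:R^-1 * \sum_(t <- words J k)
     normc (Qe xi [seq flat bar a (e j) | j <- t] Y) ^+ 2 : R)
   @[Y --> trace_nbhs iota X] --> \sum_(k <- index_enum 'I_k0) k`!%:R^-1 *
     \sum_(t <- words J k)
     normc (iterD [seq flat bar a (e j) | j <- t] (gelfand bar iota X) xi) ^+ 2.
  apply: cvgR_sum => k; apply: cvgM; first exact: cvg_cst.
  apply: cvgR_sum => t; rewrite (iterD_gelfand cpl).
  rewrite expr2; under eq_fun do rewrite expr2.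
  by apply: cvgM; apply: cvgC_norm; exact: Qhat_cvg.
apply: (@closed_cvg _ _ _ (FTB X) _ [set x | x <= 2 * M ^+ 2] _ _ _ cv); first exact: closed_le.
apply: filterS HM => Y YM /=.
pose es := [seq fn (flat bar a (e j)) | j <- J].
have lle : all_lin (fn xi :: es).
  by apply/all_lin_cons; split; [exact: fn_lin|move=> f /mapP[j _ ->]; exact: fn_lin].
have bes : bessel b (fn xi :: es).
  move=> v; rewrite big_cons /b /add_form raddfD /= fsum_diag /= addrC lerD//.
    by apply: flat_bessel => //; [exact: (basis_vector eb)|exact: (basis_orthonormal eb)].
  by rewrite !big_cons big_nil addr0; exact: xiE.
have := Qd_HS (sym_val Y) k0 (cph_pos bc) lle bes.
rewrite /es => H; apply: le_trans (le_trans H _).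
  rewrite le_eqVlt; apply/orP; left; apply/eqP; apply: eq_bigr => k _.
  by rewrite words_map big_map; congr (_ * _); apply: eq_bigr => t _; rewrite /Qe -map_comp.
by rewrite ler_wpM2l// ler_sqr ?nnegrE ?sqrtr_ge0.
Qed.

End Gelfand.

(** * Taylor expansion along a line *)

(** The derivative of the sum of [(1 - t) ^ k g_k(t) / k!] over [k <= n] telescopes to
    [(1 - t) ^ n g_(n+1)(t) / n!], to which the mean value theorem applies. *)
Lemma taylor_real (g : nat -> R -> R) n (B : R) :
  (forall k (t : R), is_derive t (1 : R) (g k) (g k.+1 t)) ->
  (forall t, 0 <= t <= 1 -> `|g n.+1 t| <= B) ->
  `|g 0%N 1 - \sum_(k < n.+1) (k`!%:R)^-1 * g k 0| <= B / n`!%:R.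
Proof.
move=> gd gB; pose G m t := \sum_(k < m.+1) (k`!%:R)^-1 * (1 - t) ^+ k * g k t.
have Gd m (t : R) : is_derive t (1 : R) (G m) ((m`!%:R)^-1 * (1 - t) ^+ m * g m.+1 t).
  elim: m => [|m IH].
    rewrite (_ : G 0%N = g 0%N); last first.
      by apply/funext => s; rewrite /G big_ord1 fact0 invr1 expr0 !mul1r.
    by rewrite fact0 invr1 expr0 !mul1r.
  rewrite (_ : G m.+1 = G m + ((m.+1)`!%:R^-1 \*: (cst 1 - id) ^+ m.+1) * g m.+1); last first.
    apply/funext => s; rewrite /G big_ord_recr /=; congr (_ + _).
    by rewrite !fctE.
  have dB : is_derive t (1 : R) (cst 1 - id : R -> R) (0 - 1).
    exact: is_deriveB.
  have dX : is_derive t (1 : R) ((cst 1 - id : R -> R) ^+ m.+1) _ := is_deriveX m.+1 dB.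
  have dZ := is_deriveZ (m.+1)`!%:R^-1 dX.
  have dM := is_deriveM dZ (gd m.+1 t).
  have dD := is_deriveD IH dM.
  apply: (is_derive_eq dD).
  rewrite !fctE /= /GRing.scale /= sub0r.
  rewrite factS natrM; field.
  by rewrite pnatr_eq0 -lt0n fact_gt0 /= nat1r pnatr_eq0.
have Gc : {within `[0, 1], continuous (G n)}.
  apply: continuous_subspaceT => x; apply: differentiable_continuous.
  by apply/derivable1_diffP; exact: (@ex_derive _ _ _ _ _ _ _ (Gd n x)).
have [c cI] := MVT_segment ler01 (fun x _ => Gd n x) Gc.
rewrite subr0 mulr1 => GE.
have -> : g 0%N 1 = G n 1.
  rewrite /G big_ord_recl /= subrr fact0 invr1 expr0 !mul1r big1 ?addr0// => i _.
  by rewrite expr0n /= mulr0 mul0r.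
have -> : \sum_(k < n.+1) (k`!%:R)^-1 * g k 0 = G n 0.
  by apply: eq_bigr => k _; rewrite subr0 expr1n mulr1.
rewrite GE !normrM mulrC; have fn0 : 0 < n`!%:R :> R by rewrite ltr0n fact_gt0.
have c0 : 0 <= c by rewrite (itvP cI).
have c1 : c <= 1 by rewrite (itvP cI).
apply: ler_pM => //; first by apply: gB; rewrite c0.
rewrite ger0_norm ?invr_ge0 ?(ltW fn0)// -[leRHS]mulr1 ler_wpM2l ?invr_ge0 ?(ltW fn0)//.
rewrite normrX exprn_ile1// ler_norml.
by apply/andP; split; lra.
Qed.

(** The square of the left-hand side is [(n + 1) M / n!], at most [M 2 ^ n / n!]. *)
Lemma exp_coeff_small (M e : R) : 0 <= M -> 0 < e -> exists N, forall n, (N <= n)%N ->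
  Num.sqrt ((n.+1)`!%:R * M) / n`!%:R < e.
Proof.
move=> M0 e0; have := @cvg_exp_coeff R 2.
have M1 : 0 < M + 1 by rewrite ltr_wpDl.
move/cvgrPdist_lt/(_ (e ^+ 2 / (M + 1))); rewrite divr_gt0 ?exprn_gt0// => /(_ isT).
case=> N _ HN; exists N => n /HN /=; rewrite sub0r normrN ger0_norm; last first.
  by exact: exp_coeff_ge0.
rewrite ltr_pdivlMr// => H.
have fn0 : 0 < n`!%:R :> R by rewrite ltr0n fact_gt0.
rewrite -ltr_sqr ?nnegrE ?(ltW e0) ?divr_ge0 ?sqrtr_ge0 ?(ltW fn0)//.
rewrite exprMn sqr_sqrtr ?mulr_ge0//; apply: le_lt_trans H.
rewrite factS natrM exprVn expr2 invfM -[exp_coeff 2 n]/(2 ^+ n / n`!%:R).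
have -> : n.+1%:R * n`!%:R * M * (n`!%:R^-1 / n`!%:R) = n.+1%:R / n`!%:R * M :> R.
  by field; rewrite gt_eqF.
have q0 : 0 <= n.+1%:R / n`!%:R :> R by exact: divr_ge0.
have MM : M <= M + 1 by rewrite lerDl.
apply: ler_pM => //.
rewrite ler_wpM2r ?invr_ge0 ?(ltW fn0)// -natrX ler_nat.
exact: ltn_expl.
Qed.

Lemma eq_cvgC (T : Type) (F : set_system T) (g h : T -> C) (z : C) :
  (forall t, g t = h t) -> g @ F --> z -> h @ F --> z.
Proof. by move=> gh; rewrite (funext gh). Qed.

Lemma cvgC_mulr (T : Type) (F : set_system T) (FF : Filter F) (g : T -> C) (z c : C) :
  g @ F --> z -> (fun t => g t * c) @ F --> z * c.
Proof. by move=> gz; apply: cvgM gz _; exact: cvg_cst. Qed.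

Section Line.
Variable f : E -> C.
Hypothesis fa : analytic_HS f.
Variable sigma : E.

Let fm xi := smooth_multilinear fa.1 xi.
Let T xi (s : seq E) : K := iterD s f xi.

Lemma iterD_letter xi u v (t : R) rho rho' :
  T xi (u ++ (t *: rho + rho') :: v) =
  (t%:C)%C * T xi (u ++ rho :: v) + T xi (u ++ rho' :: v).
Proof. by rewrite -rscaleE; exact: fm. Qed.

Lemma iterD_letter0 xi u v : T xi (u ++ 0 :: v) = 0.
Proof.
have := iterD_letter xi u v (-1) 0 0.
by rewrite scaler0 addr0 rmorphN1 mulN1r addNr.
Qed.

Lemma iterD_letterZ xi u v (t : R) rho :
  T xi (u ++ (t *: rho) :: v) = (t%:C)%C * T xi (u ++ rho :: v).
Proof. by rewrite -[t *: rho]addr0 iterD_letter iterD_letter0 addr0. Qed.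

Lemma iterD_nseqZ xi u k (t : R) rho :
  T xi (u ++ nseq k (t *: rho)) = ((t ^+ k)%:C)%C * T xi (u ++ nseq k rho).
Proof.
elim: k u => [|k IH] u; first by rewrite expr0 mul1r.
by rewrite /= iterD_letterZ -!cat_rcons IH mulrA -rmorphM exprS.
Qed.

Let a := fsum [:: fn sigma].

Local Lemma aE v w : a v w = (fn sigma v)^* * fn sigma w.
Proof. by rewrite /a /fsum big_seq1. Qed.

Local Lemma rank1_real : real_cont_pos_herm bar a.
Proof.
split=> [|v w]; last first.
  by rewrite conjcE !aE rmorphM /= conjCK -!fn_real conjCK.
have ll : all_lin [:: fn sigma] by exact: (all_lin_fn [:: sigma]).
by apply: (cph_fsum ll) => g; exact: (@cont_map_fn _ _ _ [:: sigma]).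
Qed.

Local Lemma rank1_norm v : form_norm a v = normc (fn sigma v).
Proof. by rewrite /form_norm aE ReE sqrtr_sqr ger0_norm// normc_ge0. Qed.

(** For the rank one form of [sigma] the Hilbert space has dimension at most one,
    and a unit vector is sent by [flat] to plus or minus [sigma]. *)
Local Lemma rank1_flat (u : nat -> V) : hilbert_vector bar a u -> hilbert_dot a u u = 1 ->
  exists c : R, `|c| = 1 /\ flat bar a u = c *: sigma.
Proof.
move=> uh u1; have ar := rank1_real.
have [z uz] : exists z : C, (fun n => fn sigma (u n) : C) @ \oo --> z.
  apply: cauchy_cvgC => e e0; have [N HN] := uh.2 e e0.
  exists [set n | (N <= n)%N]; first by exists N.
  move=> m n /= Nm Nn; have := HN m n Nm Nn; rewrite rank1_norm.
  suff -> : fn sigma (u m - u n) = fn sigma (u m) - fn sigma (u n) by [].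
  by rewrite addrC -scaleN1r fn_lin mulN1r addrC.
have zr : (z : K)^* = z.
  have uzc := cvgC_conj (@filter_filter _ _ eventually_filter) uz; symmetry; apply: (cvgC_unique _ uz).
  refine (eq_cvgC _ uzc) => n; by rewrite fn_real uh.1.
have flE x : fn (flat bar a u) x = z * fn sigma x.
  have lc : (fun n => (fn sigma (u n) : C) * (fn sigma x : C)) @ \oo --> z * (fn sigma x : C).
    exact: cvgC_mulr uz.
  have fc : (fun n => a (u n) x : C) @ \oo --> (fn (flat bar a u) x : C) by exact: flat_cvg.
  apply: (cvgC_unique _ fc); refine (eq_cvgC _ lc) => n.
  by rewrite aE fn_real uh.1.
have z2 : z * z = 1.
  have d1 := dot_cvg ar uh uh; rewrite u1 rmorph1 in d1.
  have zz : (fun n => (fn sigma (u n) : C) * (fn sigma (u n) : C)) @ \oo --> z * z.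
    exact: (cvgM uz uz).
  apply: (cvgC_unique _ zz); refine (eq_cvgC _ d1) => n.
  by rewrite aE fn_real uh.1.
exists (complex.Re z); split.
  rewrite -normc_real -(conj_fixed zr); apply/eqP.
  rewrite -(@eqrXn2 _ 2) ?normc_ge0// expr1n expr2 -normcM z2 normc1//.
by apply: fn_inj => x; rewrite flE {1}(conj_fixed zr) -[_ *: sigma]addr0 fnZD;
  rewrite -[LHS]addr0.
Qed.

Lemma words1 (A : Type) (x : A) k : words [:: x] k = [:: nseq k x].
Proof. by elim: k => //= k ->. Qed.

(** The defining bound of analyticity, for the rank one form of [sigma] and the
    segment from 0 to [sigma], controls the derivatives in the direction [sigma]. *)
Lemma line_bound : exists M : R, 0 <= M /\ forall k (t : R), 0 <= t <= 1 ->
  normc (iterD (nseq k sigma) f (t *: sigma)) ^+ 2 <= k`!%:R * M.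
Proof.
have ar := rank1_real; have [_ /(_ sigma 0 a ar)[M [I [e [eb H]]]]] := fa.
have HS t J K0 : 0 <= t <= 1 -> uniq J ->
    \sum_(k < K0) k`!%:R^-1 * \sum_(s <- words J k)
      normc (iterD [seq flat bar a (e j) | j <- s] f (t *: sigma)) ^+ 2 <= M.
  move=> t01 uJ; have := H t t01; rewrite scaler0 addr0.
  apply: (@series_words_ge _ _ (fun s => normc (iterD [seq flat bar a (e j) | j <- s] f (t *: sigma)) ^+ 2) _ (fun k => k`!%:R^-1)) => //.
    by move=> s; exact: sqr_ge0.
have term t J k : 0 <= t <= 1 -> uniq J -> \sum_(s <- words J k)
      normc (iterD [seq flat bar a (e j) | j <- s] f (t *: sigma)) ^+ 2 <= k`!%:R * M.
  move=> t01 uJ; rewrite -ler_pdivrMl ?ltr0n ?fact_gt0//.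
  apply: le_trans (HS t J k.+1 t01 uJ).
  rewrite big_ord_recr /= lerDr; apply: sumr_ge0 => i _.
  by rewrite mulr_ge0 ?invr_ge0//; apply: sumr_ge0 => s _; exact: sqr_ge0.
have M0 : 0 <= M.
  have := HS 0 [::] 0%N; rewrite big_ord0; apply => //; by rewrite lexx ler01.
exists M; split=> // k t t01.
have [[i _]|noI] := pselect (exists i : I, True).
  have [|c [c1 cE]] := rank1_flat (basis_vector eb i).
    by rewrite (basis_orthonormal eb) eqxx.
  have := term t [:: i] k t01 isT; rewrite words1 big_seq1 map_nseq cE.
  have := iterD_nseqZ (t *: sigma) [::] k c sigma; rewrite /T !cat0s => ->.
  by rewrite normcM normc_real normrX c1 expr1n mul1r.
case: k => [|k].
  by have := term t [::] 0%N t01 isT; rewrite big_seq1.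
have s0 : sigma = 0.
  have sr x : bar x = x -> fn sigma x = 0.
    move=> xr; apply/eqP; rewrite -normc_eq0 eq_le normc_ge0 andbT.
    apply/ler_addgt0Pl => d d0; rewrite addr0.
    have [s] := basis_total eb (hv_const ar xr) d0.
    case: s => [|[r i]]; last by exfalso; apply: noI; exists i.
    rewrite (_ : (fun n => _) = fun=> x); last by apply/funext => n; rewrite big_nil subr0.
    by rewrite /hilbert_norm dot_const -/(form_norm a x) rank1_norm => /ltW.
  apply: fn_inj => x; have [x1 [x2 [r1 r2 nE _]]] := real_split bar_inv ar x.
  apply/eqP; rewrite -[fn 0 x]/(0 : K) -normc_eq0 -sqrf_eq0 nE !sr//.
  by rewrite raddf0 expr0n addr0.
have -> : iterD (nseq k.+1 sigma) f (t *: sigma) = 0.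
  by rewrite s0; exact: (iterD_letter0 _ [::]).
by rewrite normc0 expr0n mulr_ge0.
Qed.

Lemma line_derive (psi : K -> R) k (t : R) :
  (forall z w, psi (z - w) = psi z - psi w) ->
  (forall (r : R) z, psi ((r%:C)%C * z) = r * psi z) ->
  (forall z, `|psi z| <= normc z) ->
  is_derive t (1 : R) (fun s => psi (iterD (nseq k sigma) f (s *: sigma)))
    (psi (iterD (nseq k.+1 sigma) f (t *: sigma))).
Proof.
move=> psiB psiZ psin.
have dc : diff_quotient sigma (iterD (nseq k sigma) f) (t *: sigma) h @[h --> (0 : R)^'] -->
    iterD (nseq k.+1 sigma) f (t *: sigma) by exact: (smooth_ex fa.1).
have cv : (fun h : R => h^-1 *: (((fun s => psi (iterD (nseq k sigma) f (s *: sigma))) \o shift t) (h *: (1 : R)) -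
    psi (iterD (nseq k sigma) f (t *: sigma)))) @ (0 : R)^' -->
    psi (iterD (nseq k.+1 sigma) f (t *: sigma)).
  apply/cvgrPdist_lt => e e0; move/cvgC_normc/(_ e e0): dc; apply: filterS => h.
  apply: le_lt_trans; rewrite distrC; apply: le_trans (psin _); rewrite psiB /diff_quotient.
  rewrite -fmorphV psiZ psiB.
  have E1 : (h%:A + t) *: sigma = t *: sigma + h *: sigma.
  by rewrite addrC scalerDl; congr (_ + _ *: _); exact: mulr1.
  by rewrite -E1.
apply: DeriveDef; first by apply/cvg_ex; eexists; exact: cv.
exact: (cvg_lim (@norm_hausdorff _ R) cv).
Qed.

Lemma taylor_line (eps : R) : 0 < eps -> exists N, forall n, (N <= n)%N ->
  normc (f sigma - \sum_(k < n.+1) ((k`!%:R^-1)%:C)%C * iterD (nseq k sigma) f 0) < eps.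
Proof.
move=> e0; have [M [M0 HM]] := line_bound.
have e2 : 0 < eps / 2 by rewrite divr_gt0.
have [N HN] := exp_coeff_small M0 e2; exists N => n /HN small.
have part (psi : K -> R) : (forall z w, psi (z - w) = psi z - psi w) ->
    (forall (r : R) z, psi ((r%:C)%C * z) = r * psi z) ->
    (forall z, `|psi z| <= normc z) ->
    `|psi (f sigma - \sum_(k < n.+1) ((k`!%:R^-1)%:C)%C * iterD (nseq k sigma) f 0)|
      <= Num.sqrt ((n.+1)`!%:R * M) / n`!%:R.
  move=> psiB psiZ psin.
  have psi0 : psi 0 = 0 by rewrite -(subrr 0) psiB subrr.
  have psiD z w : psi (z + w) = psi z + psi w.
    by rewrite -[w]opprK psiB -[in RHS](sub0r (- w)) psiB psi0 sub0r.
  have := @taylor_real (fun k s => psi (iterD (nseq k sigma) f (s *: sigma))) n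
    (Num.sqrt ((n.+1)`!%:R * M)) (fun k t => line_derive k t psiB psiZ psin).
  rewrite psiB scale1r (big_morph psi psiD psi0) scale0r.
  under eq_bigr do rewrite psiZ.
  apply=> t t01; apply: le_trans (psin _) _.
  rewrite -ler_sqr ?nnegrE ?normc_ge0 ?sqrtr_ge0// sqr_sqrtr ?mulr_ge0//.
  exact: HM.
apply: le_lt_trans (normc_le_ReIm _) _; rewrite [ltRHS]splitr; apply: ltrD;
  apply: le_lt_trans small; apply: part.
- by move=> z w; rewrite raddfB.
- by move=> r z; rewrite Re_mulr.
- exact: Re_le_normc.
- by move=> z w; rewrite raddfB.
- by move=> r [x y] /=; rewrite mul0r addr0.
- by move=> [x y] /=; rewrite /normc -sqrtr_sqr ler_wsqrtr// lerDr sqr_ge0.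
Qed.

End Line.

(** By the Taylor expansion along the segment from the origin. *)
Lemma analytic_HS_eq (f g : E -> C) : analytic_HS f -> analytic_HS g ->
  (forall s, iterD s f 0 = iterD s g 0) -> f = g.
Proof.
move=> fa ga fg; apply/funext => sigma; apply/eqP.
rewrite -subr_eq0 -normc_eq0 eq_le normc_ge0 andbT.
apply/ler_addgt0Pl => e e0; rewrite addr0.
have e2 : 0 < e / 2 by rewrite divr_gt0.
have [N1 H1] := taylor_line fa sigma e2; have [N2 H2] := taylor_line ga sigma e2.
have := H1 _ (leq_maxl N1 N2); have := H2 _ (leq_maxr N1 N2).
under [X in _ -> normc (_ - X) < _ -> _]eq_bigr do rewrite fg.
set s := \sum_(_ < _) _ => h2 h1.
have -> : f sigma - g sigma = (f sigma - s) - (g sigma - s) by ring.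
apply: le_trans (normcD _ _) _; rewrite normc_opp; apply: ltW.
by rewrite [ltRHS]splitr; apply: ltrD.
Qed.

End AnalyticHS.

Lemma cvgC_lin (R : realType) (T : Type) (F : set_system T) (FF : Filter F)
    (g h : T -> R[i]^o) (c y z : R[i]^o) :
  g @ F --> y -> h @ F --> z -> (fun t => c * g t + h t) @ F --> c * y + z.
Proof. by move=> gy hz; apply: cvgD hz; apply: cvgM gy; exact: cvg_cst. Qed.

(** * Coordinates of bounded functionals *)

Section Coordinates.
Variables (R : realType) (V : tvsType R[i]) (bar : V -> V).
Hypothesis bar_inv : cont_antilinear_involution bar.
Variable a : V -> V -> R[i].
Hypothesis ar : real_cont_pos_herm bar a.
Local Notation K := R[i].
Local Notation C := (R[i]^o).
Local Notation E := (real_dual bar).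
Local Notation hv := (hilbert_vector bar a).
Local Notation dot := (hilbert_dot a).
Local Notation hnorm := (hilbert_norm a).
Local Notation nm := (form_norm a).

Definition form_bounded (M : R) (rho : E) :=
  forall v, normc (fn rho v) <= M * nm v.

Lemma fnB (rho : E) v w : fn rho (v - w) = fn rho v - fn rho w :> K.
Proof. by rewrite addrC -scaleN1r fn_lin mulN1r addrC. Qed.

Lemma form_bounded_le M M' rho : M <= M' -> form_bounded M rho -> form_bounded M' rho.
Proof.
by move=> MM rM v; apply: le_trans (rM v) _; rewrite ler_wpM2r// sqrtr_ge0.
Qed.

Lemma form_boundedZD (t : R) rho sigma M M' : form_bounded M rho -> form_bounded M' sigma ->
  form_bounded (`|t| * M + M') (t *: rho + sigma).
Proof.
move=> rM sM v; rewrite fnZD mulrDl; apply: le_trans (normcD _ _) _.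
by rewrite lerD// normcM normc_real -mulrA ler_wpM2l.
Qed.

(** A functional bounded by the seminorm of [a] extends to the Hilbert space:
    its value at the vector represented by [u]. *)
Definition hval (rho : E) (u : nat -> V) : R :=
  complex.Re (lim ((fn rho (u n) : C) @[n --> \oo])).

Lemma hval_cvg M rho u : form_bounded M rho -> hv u ->
  (fun n => fn rho (u n) : C) @ \oo --> (((hval rho u)%:C)%C : C).
Proof.
move=> rM uh; have M1 : 0 < `|M| + 1 by rewrite ltr_wpDl.
have [z uz] : exists z : C, (fun n => fn rho (u n) : C) @ \oo --> z.
  apply: cauchy_cvgC => d d0; have [|N HN] := uh.2 (d / (`|M| + 1)); first exact: divr_gt0.
  exists [set n | (N <= n)%N]; first by exists N.
  move=> m n /= Nm Nn; rewrite -fnB; apply: le_lt_trans (rM _) _.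
  have := HN m n Nm Nn; rewrite ltr_pdivlMr// mulrC; apply: le_lt_trans.
  by rewrite ler_wpM2r ?sqrtr_ge0// (le_trans (ler_norm M))// lerDl.
have zr : (z : K)^* = z.
  have uzc := cvgC_conj (@filter_filter _ _ eventually_filter) uz; symmetry; apply: (cvgC_unique _ uz).
  by refine (eq_cvgC _ uzc) => n; rewrite fn_real uh.1.
suff -> : (((hval rho u)%:C)%C : C) = z by [].
by rewrite /hval (cvg_lim (@norm_hausdorff _ C) uz) -(conj_fixed zr).
Qed.

Lemma hval_eq M rho u (l : R) : form_bounded M rho -> hv u ->
  (fun n => fn rho (u n) : C) @ \oo --> ((l%:C)%C : C) -> hval rho u = l.
Proof.
move=> rM uh ul; have H := cvgC_unique eventually_filter (hval_cvg rM uh) ul.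
exact: (f_equal (@complex.Re R) H).
Qed.

Lemma hval_const rho x : bar x = x -> fn rho x = ((hval rho (fun=> x))%:C)%C.
Proof. by move=> xr; rewrite /hval lim_cst// -fn_real_vec. Qed.

Lemma hval_bound M rho u : form_bounded M rho -> hv u ->
  `|hval rho u| <= M * hnorm u.
Proof.
move=> rM uh; rewrite -normc_real.
have c1 := cvgC_norm (@filter_filter _ _ eventually_filter) (hval_cvg rM uh).
have c2 : (M * nm (u n)) @[n --> \oo] --> M * hnorm u.
  by apply: cvgM; [exact: cvg_cst|exact: (nm_cvg ar uh)].
by apply: (ler_cvg_to c1 c2); exists 0%N => // n _; exact: rM.
Qed.

Lemma hval_lin M rho (c : R) u v : form_bounded M rho -> hv u -> hv v ->
  hval rho (fun n => (c%:C)%C *: u n + v n) = c * hval rho u + hval rho v.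
Proof.
move=> rM uh vh; apply: (hval_eq rM); first exact: hv_lin.
rewrite rmorphD rmorphM /=.
refine (eq_cvgC _ (cvgC_lin (c := (c%:C)%C : C) _ (hval_cvg rM uh) (hval_cvg rM vh))) => n.
by rewrite fn_lin.
Qed.

Lemma hval0 M rho : form_bounded M rho -> hval rho (fun=> 0) = 0.
Proof.
move=> rM; apply/eqP; rewrite -normr_eq0 eq_le normr_ge0 andbT.
apply: le_trans (hval_bound rM (hv0 bar_inv ar)) _.
rewrite /hilbert_norm /hilbert_dot (ph0r (cph_pos ar.1)) lim_cst// sqrtr0 mulr0//.
Qed.

Lemma hval_comb M rho (I : choiceType) (e : I -> nat -> V) c J : form_bounded M rho ->
  (forall i, hv (e i)) -> hval rho (comb e c J) = \sum_(j <- J) c j * hval rho (e j).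
Proof.
move=> rM eh; elim: J => [|j J IH].
  rewrite big_nil -(hval0 rM); congr (hval _ _).
  by apply/funext => n; rewrite /comb big_nil.
rewrite big_cons -IH -(hval_lin _ rM)//; last exact: hv_comb.
by congr (hval _ _); apply/funext => n; rewrite /comb big_cons.
Qed.

Lemma hvalZD M M' (t : R) rho sigma u : form_bounded M rho -> form_bounded M' sigma ->
  hv u -> hval (t *: rho + sigma) u = t * hval rho u + hval sigma u.
Proof.
move=> rM sM uh; apply: (hval_eq (form_boundedZD t rM sM) uh).
rewrite rmorphD rmorphM /=.
refine (eq_cvgC _ (cvgC_lin (c := (t%:C)%C : C) _ (hval_cvg rM uh) (hval_cvg sM uh))) => n.
exact: esym (fnZD _ _ _ _).
Qed.

Lemma hval_flat u v : hv u -> hv v -> hval (flat bar a u) v = dot u v.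
Proof.
move=> uh vh; apply: (hval_eq (flat_bound ar uh) vh).
apply/cvgC_normc => d d0.
have d2 : 0 < d / 2 by rewrite divr_gt0.
have [N HN] := dot_joint ar uh vh d2; exists N => // n /= Nn.
have c1 : (fun m => a (u m) (v n) - ((dot u v)%:C)%C : C) @ \oo -->
    (fn (flat bar a u) (v n) - ((dot u v)%:C)%C : C).
  have c2 : (fun m => a (u m) (v n) : C) @ \oo --> (fn (flat bar a u) (v n) : C).
    exact: flat_cvg.
  exact: (cvgB c2 (@cvg_cst C _ _ _ _)).
apply: le_lt_trans (_ : _ <= d / 2) _; last by rewrite ltr_pdivrMr// ltr_pMr// ltr1n.
refine (@cvgC_le _ _ _ _ _ _ _ c1 _); exists N => // m /= Nm.
by apply: ltW; exact: HN.
Qed.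

Section Basis.
Variables (I : choiceType) (e : I -> nat -> V).
Hypothesis eb : hilbert_basis bar a e.
Let eh := basis_vector eb.
Let eo := basis_orthonormal eb.

Definition coord (rho : E) (j : I) : R := hval rho (e j).
Definition proj J (rho : E) : E := \sum_(j <- J) coord rho j *: flat bar a (e j).

(** Evaluate [rho] at the vector that has the coordinates [coord rho] on [J]. *)
Lemma coord_bessel M rho J : form_bounded M rho -> uniq J ->
  \sum_(j <- J) coord rho j ^+ 2 <= M ^+ 2.
Proof.
move=> rM uJ; set s := \sum_(_ <- _) _.
have s0 : 0 <= s by apply: sumr_ge0 => j _; exact: sqr_ge0.
have hn2 : hnorm (comb e (coord rho) J) ^+ 2 = s by rewrite (sqr_hnorm_comb bar_inv ar eh eo).
have : `|s| <= M * hnorm (comb e (coord rho) J).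
  have -> : s = \sum_(j <- J) coord rho j * hval rho (e j).
    by apply: eq_bigr => j _; rewrite expr2.
  by rewrite -(hval_comb _ _ rM eh); apply: (hval_bound rM); exact: hv_comb.
rewrite ger0_norm// => H.
have [->|sn0] := eqVneq s 0; first exact: sqr_ge0.
have sp : 0 < s by rewrite lt_neqAle eq_sym sn0.
rewrite -(ler_pM2r sp) -[in leRHS]hn2 -exprMn -expr2 ler_sqr ?nnegrE//.
exact: le_trans H.
Qed.

Lemma proj_bounded J rho : exists M, form_bounded M (proj J rho).
Proof.
rewrite /proj; elim: J => [|j J [M HM]].
  exists 0 => v; rewrite big_nil mul0r.
  by rewrite -[fn 0 v]/(0 : K) normc0.
by eexists; rewrite big_cons; apply: form_boundedZD HM; exact: (flat_bound ar (eh j)).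
Qed.

Lemma hval_proj J rho u : hv u ->
  hval (proj J rho) u = \sum_(j <- J) coord rho j * dot (e j) u.
Proof.
move=> uh; elim: J => [|j J IH].
  rewrite /proj !big_nil; apply: (@hval_eq 0) => //.
    by move=> v; rewrite -[fn 0 v]/(0 : K) normc0 mul0r.
  by rewrite rmorph0; exact: (@cvg_cst C).
have [M HM] := proj_bounded J rho.
rewrite /proj !big_cons (hvalZD _ (flat_bound ar (eh j)) HM uh).
by rewrite -/(proj J rho) IH hval_flat.
Qed.

(** Up to the tail of the square sum of its coordinates a functional is
    given by its orthogonal projection to finitely many basis vectors. *)
Lemma proj_close M rho J (d : R) : form_bounded M rho -> uniq J -> 0 <= d ->
  (forall J', uniq J' ->
     \sum_(j <- J') coord rho j ^+ 2 <= \sum_(j <- J) coord rho j ^+ 2 + d ^+ 2) ->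
  form_bounded d (rho - proj J rho).
Proof.
move=> rM uJ d0 tail; set theta := rho - _.
have [Mp HMp] := proj_bounded J rho.
have tE : theta = -1 *: proj J rho + rho by rewrite scaleN1r addrC.
have [N HN] : exists N, 0 <= N /\ form_bounded N theta.
  have [q qt] : exists q, form_bounded q theta.
    by eexists; rewrite tE; exact: (form_boundedZD (-1) HMp rM).
  by exists `|q|; split=> //; apply: form_bounded_le qt; exact: ler_norm.
have te i : hval theta (e i) = if i \in J then 0 else coord rho i.
  rewrite tE (hvalZD _ HMp rM)// hval_proj// mulN1r.
  rewrite (eq_bigr (fun j => coord rho j * (j == i)%:R)); last by move=> j _; rewrite eo.
  by rewrite sum_delta//; case: ifP => _; rewrite /coord ?addNr// oppr0 add0r.
have real x : bar x = x -> normc (fn theta x) <= d * nm x.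
  move=> xr; apply/ler_addgt0Pl => z z0.
  pose del := z / (N + d + 1).
  have Nd : 0 < N + d + 1 by rewrite ltr_wpDl// addr_ge0//; case: HN.
  have del0 : 0 < del by exact: divr_gt0.
  have [s] := basis_total eb (hv_const ar xr) del0.
  set cc := fun i => \sum_(p <- s | p.2 == i) p.1; set J' := undup (map snd s).
  rewrite (_ : (fun n => _) = fun n => x - comb e cc J' n); last first.
    by apply/funext => n; rewrite comb_partition.
  have uJ' : uniq J' by exact: undup_uniq.
  have ch : hv (comb e cc J') by exact: hv_comb.
  move=> close.
  have hx : hnorm (fun=> x) = nm x by rewrite /hilbert_norm dot_const.
  have b1 : hnorm (comb e cc J') <= nm x + del.
    have c0h := hv0 bar_inv ar.
    have := hnormD_sub bar_inv ar ch (hv_const ar xr) c0h.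
    rewrite (_ : (fun n => comb e cc J' n - 0) = comb e cc J'); last first.
      by apply/funext => n; rewrite subr0.
    rewrite (_ : (fun=> x - 0) = fun=> x); last by apply/funext => n; rewrite subr0.
    rewrite hx (hnorm_sub_sym bar_inv ar ch (hv_const ar xr)) => H.
    by apply: le_trans H _; rewrite addrC lerD2l ltW.
  have b2 : `|hval theta (comb e cc J')| <= d * hnorm (comb e cc J').
    rewrite (hval_comb _ _ HN.2 eh).
    rewrite -ler_sqr ?nnegrE ?mulr_ge0 ?sqrtr_ge0// real_normK ?num_real//.
    apply: le_trans (sum_CS _ _ _) _; rewrite exprMn (sqr_hnorm_comb bar_inv ar eh eo)//.
    rewrite mulrC; apply: ler_wpM2r; first by apply: sumr_ge0 => j _; exact: sqr_ge0.
    have := tail (undup (J ++ J')) (undup_uniq _).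
    have -> : \sum_(j <- undup (J ++ J')) coord rho j ^+ 2 =
        \sum_(j <- J) coord rho j ^+ 2 + \sum_(j <- undup (J ++ J')) hval theta (e j) ^+ 2.
      rewrite (bigID (mem J)) [X in _ = _ + X](bigID (mem J)) /= [X in _ = _ + (X + _)]big1.
        rewrite add0r; congr (_ + _).
          rewrite -big_filter; apply: perm_big; apply: uniq_perm => //.
            by rewrite filter_uniq// undup_uniq.
          by move=> j; rewrite mem_filter mem_undup mem_cat; case: (j \in J).
        by apply: eq_bigr => j jJ; rewrite te (negPf jJ).
      by move=> j jJ; rewrite te jJ expr0n.
    rewrite lerD2l; apply: le_trans; apply: ler_sum_sub => //; first exact: undup_uniq.
      by move=> j jJ; rewrite mem_undup mem_cat jJ orbT.
    by move=> j; exact: sqr_ge0.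
  have b3 : hval theta (fun=> x) = hval theta (fun n => x - comb e cc J' n) +
      hval theta (comb e cc J').
    have sh := hv_sub bar_inv ar (hv_const ar xr) ch.
    rewrite -[X in X + _]mul1r -(hval_lin _ HN.2)//; congr (hval _ _).
    by apply/funext => n; rewrite rmorph1 scale1r subrK.
  rewrite hval_const// normc_real b3; apply: le_trans (ler_normD _ _) _.
  have b4 : `|hval theta (fun n => x - comb e cc J' n)| <= N * del.
    apply: le_trans (hval_bound HN.2 (hv_sub bar_inv ar (hv_const ar xr) ch)) _.
    by rewrite ler_wpM2l ?(ltW close)//; case: HN.
  apply: le_trans (lerD b4 (le_trans b2 (ler_wpM2l d0 b1))) _.
  rewrite mulrDr [d * nm x + _]addrC addrA lerD2r -mulrDl.
  rewrite -[leRHS](divfK (lt0r_neq0 Nd)) mulrC -/del ler_wpM2l ?(ltW del0)//.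
  by rewrite lerDl.
move=> x; have [x1 [x2 [r1 r2 nE aE]]] := real_split bar_inv ar x.
have key y : bar y = y -> complex.Re (fn theta y) ^+ 2 <= d ^+ 2 * complex.Re (a y y).
  move=> yr; have := real y yr; rewrite hval_const// normc_real /= => H.
  rewrite -(sqr_hn (cph_pos ar.1)) -exprMn -[leLHS]real_normK ?num_real//.
  by rewrite ler_sqr ?nnegrE ?mulr_ge0 ?sqrtr_ge0.
rewrite -ler_sqr ?nnegrE ?mulr_ge0 ?sqrtr_ge0 ?normc_ge0// nE exprMn.
by rewrite (sqr_hn (cph_pos ar.1)) aE mulrDr lerD// key.
Qed.

Lemma proj_approx M rho (d : R) : form_bounded M rho -> 0 < d ->
  exists2 J0, uniq J0 & forall J, uniq J -> {subset J0 <= J} ->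
    form_bounded d (rho - proj J rho).
Proof.
move=> rM d0; have d20 : 0 < d ^+ 2 by rewrite exprn_gt0.
have [||J0 [uJ0 HJ0]] := @near_sup R _ (fun J : seq I => uniq J)
  (fun J => \sum_(j <- J) coord rho j ^+ 2) (M ^+ 2) _ _ _ d20.
- by exists [::].
- by move=> J; exact: coord_bessel.
exists J0 => // J uJ sJ; apply: (proj_close rM uJ (ltW d0)) => J' uJ'.
apply: le_trans (HJ0 _ uJ') _; rewrite lerD2r; apply: ler_sum_sub => // j.
exact: sqr_ge0.
Qed.

End Basis.
End Coordinates.

(** * Tensors over the vectors of a basis *)

Section BasisWords.
Variable J : eqType.

Fixpoint lwords (s : seq J) N : seq (seq J) :=
  if N is N'.+1 then lwords s N' ++ words s N' else [::].

Lemma sum_lwords (W : nmodType) s N (F : seq J -> W) :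
  \sum_(t <- lwords s N) F t = \sum_(k < N) \sum_(t <- words s k) F t.
Proof.
elim: N => [|N IH]; first by rewrite big_nil big_ord0.
by rewrite /= big_cat big_ord_recr IH.
Qed.

Lemma mem_lwords s N t : (t \in lwords s N) = (size t < N)%N && all (mem s) t.
Proof.
elim: N => [|N IH]; first by rewrite in_nil ltn0.
by rewrite /= mem_cat IH mem_words -andb_orl orbC [in RHS]ltnS [in RHS]leq_eqVlt.
Qed.

Lemma lwords_uniq s N : uniq s -> uniq (lwords s N).
Proof.
move=> us; elim: N => //= N IH; rewrite cat_uniq IH words_uniq// andbT.
apply/hasPn => t; rewrite mem_words => /andP[/eqP tN _].
by have := mem_lwords s N t; rewrite tN ltnn /= => ->.
Qed.

End BasisWords.

Lemma sum_pick (K : pzRingType) (A : eqType) (s : seq A) x (F : A -> K) : uniq s ->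
  x \in s -> \sum_(y <- s) F y * (x == y)%:R = F x.
Proof.
move=> us xs; rewrite (bigD1_seq x)//= eqxx mulr1 big1 ?addr0// => y yx.
by rewrite eq_sym (negPf yx) mulr0.
Qed.

Lemma cvgC_sum (R : realType) (T A : Type) (G : set_system T) (FG : Filter G)
    (s : seq A) (g : A -> T -> R[i]^o) (l : A -> R[i]^o) :
  (forall i, g i @ G --> l i) ->
  (fun x => \sum_(i <- s) g i x) @ G --> \sum_(i <- s) l i.
Proof.
move=> gl; elim: s => [|i s IH].
  rewrite big_nil (_ : (fun x => _) = fun=> 0); first exact: cvg_cst.
  by apply/funext => x; rewrite big_nil.
rewrite big_cons; apply: (eq_cvgC _ (cvgD (gl i) IH)) => x.
by rewrite big_cons.
Qed.

Section Tensors.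
Variables (R : realType) (V : tvsType R[i]) (bar : V -> V).
Hypothesis bar_inv : cont_antilinear_involution bar.
Variable a : V -> V -> R[i].
Hypothesis ar : real_cont_pos_herm bar a.
Local Notation K := R[i].
Local Notation C := (R[i]^o).
Local Notation E := (real_dual bar).
Local Notation T := (tensor_alg V).
Variables (I : choiceType) (e : I -> nat -> V).
Hypothesis eb : hilbert_basis bar a e.
Let eh := basis_vector eb.
Let eo := basis_orthonormal eb.
Let aP := cph_pos ar.1.
Local Notation co := (coord e).

(** The value of the word of functionals [w] on the elementary tensor of the basis
    vectors [e j], for [j] in [t]. *)
Fixpoint coordw (w : seq E) (t : seq I) : R := match w, t with
  | [::], [::] => 1
  | rho :: w', j :: t' => co rho j * coordw w' t'
  | _, _ => 0
  end.

Lemma coordw_size w t : size w != size t -> coordw w t = 0.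
Proof.
elim: w t => [|rho w IH] [|j t] //=; rewrite eqSS => /IH ->.
by rewrite mulr0.
Qed.

Definition basis_word (n : nat) (t : seq I) := [seq e j n | j <- t].

Lemma wev_basis_cvg w t : (forall rho, rho \in w -> exists M, form_bounded a M rho) ->
  (fun n => wev (map (@fn _ _ _) w) (basis_word n t) : C) @ \oo -->
  (((coordw w t)%:C)%C : C).
Proof.
elim: w t => [|rho w IH] [|j t] wM /=; try by rewrite ?rmorph1 ?rmorph0; exact: (@cvg_cst C).
rewrite rmorphM; apply: cvgM; last first.
  by apply: IH => sigma sw; apply: wM; rewrite inE sw orbT.
by have [|M HM] := wM rho _; [rewrite inE eqxx|exact: (hval_cvg HM (eh j))].
Qed.

Lemma wev_gram_cvg t t' :
  (fun p : nat * nat => wev (map a (basis_word p.1 t)) (basis_word p.2 t') : C)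
    @ filter_prod \oo \oo --> ((t == t')%:R : C).
Proof.
elim: t t' => [|j t IH] [|j' t'] /=; try by exact: (@cvg_cst C).
rewrite eqseq_cons -mulnb natrM; apply: cvgM; last exact: IH.
apply/cvgC_normc => d d0; have [N HN] := dot_joint ar (eh j) (eh j') d0.
exists ([set n | (N <= n)%N], [set n | (N <= n)%N]); first by split; exists N.
move=> [m n] [/= Nm Nn]; have := HN m n Nm Nn; rewrite eo.
by case: eqP; rewrite ?rmorph1 ?rmorph0.
Qed.

Let oo2_filter : Filter (filter_prod \oo \oo : set_system (nat * nat)).
Proof. exact: filter_prod_filter. Qed.

Definition basis_tensor (c : seq I -> K) L n : T :=
  \sum_(t <- L) c t *: tpure (basis_word n t).

Lemma weval_basis_tensor_cvg w c L :
  (forall rho, rho \in w -> exists M, form_bounded a M rho) ->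
  (fun n => weval (map (@fn _ _ _) w) (basis_tensor c L n) : C) @ \oo -->
  (\sum_(t <- L) c t * ((coordw w t)%:C)%C : C).
Proof.
move=> wM.
have cv : (fun n => \sum_(t <- L) c t * wev (map (@fn _ _ _) w) (basis_word n t) : C) @ \oo -->
  (\sum_(t <- L) c t * ((coordw w t)%:C)%C : C).
  apply: cvgC_sum => t; apply: cvgM; first exact: cvg_cst.
  exact: wev_basis_cvg.
refine (eq_cvgC _ cv) => n; rewrite /basis_tensor (weval_sum _ _ _ _ (all_lin_fn w)).
by apply: eq_bigr => t _; rewrite (weval_pure _ (all_lin_fn w)).
Qed.

Lemma basis_tensor_form_cvg c c' L : uniq L ->
  (fun p : nat * nat => tensor_form a (basis_tensor c L p.1) (basis_tensor c' L p.2) : C)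
    @ filter_prod \oo \oo -->
  (\sum_(t <- L) (size t)`!%:R * ((c t)^* * c' t) : C).
Proof.
move=> uL.
have cv : (fun p : nat * nat => \sum_(t <- L) (c t)^* * ((size t)`!%:R *
    \sum_(t' <- L) c' t' * wev (map a (basis_word p.1 t)) (basis_word p.2 t')) : C)
    @ filter_prod \oo \oo -->
   (\sum_(t <- L) (c t)^* * ((size t)`!%:R * \sum_(t' <- L) c' t' * (t == t')%:R) : C).
  apply: cvgC_sum => t; apply: cvgM; first exact: cvg_cst.
  apply: cvgM; first exact: cvg_cst.
  apply: cvgC_sum => t'; apply: cvgM; first exact: cvg_cst.
  exact: wev_gram_cvg.
have -> : \sum_(t <- L) (size t)`!%:R * ((c t)^* * c' t) =
   \sum_(t <- L) (c t)^* * ((size t)`!%:R * \sum_(t' <- L) c' t' * (t == t')%:R).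
  by apply: eq_big_seq => t tL; rewrite sum_pick// mulrCA.
refine (eq_cvgC _ cv) => p; rewrite (tensor_form_suml aP); apply: eq_bigr => t _.
rewrite (tensor_form_pure aP) /basis_word size_map; congr (_ * (_ * _)).
rewrite (weval_sum _ _ _ _ (all_lin_map aP _)); apply: eq_bigr => t' _.
by rewrite (weval_pure _ (all_lin_map aP _)).
Qed.

Lemma basis_tensor_norm_cvg c L (d : R) : uniq L ->
  \sum_(t <- L) (size t)`!%:R * normc (c t) ^+ 2 < d ^+ 2 -> 0 <= d ->
  \forall n \near \oo, tensor_norm a (basis_tensor c L n) < d.
Proof.
move=> uL cd d0.
have cv := cvgC_Re oo2_filter (@basis_tensor_form_cvg c c L uL).
rewrite Re_sum in cv.
rewrite (eq_bigr (fun t => (size t)`!%:R * normc (c t) ^+ 2)) in cv; last first.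
  by move=> t _; rewrite -[_`!%:R](rmorph_nat (real_complex R)) Re_mulr ReE.
have [[A B] /= [[N1 _ A1] [N2 _ B2]] AB] := cvgr_lt _ cv _ cd.
exists (maxn N1 N2) => // n /= Nn.
have : complex.Re (tensor_form a (basis_tensor c L n) (basis_tensor c L n)) < d ^+ 2.
  by apply: (AB (n, n)); split=> /=; [apply: A1|apply: B2] => /=;
    apply: leq_trans Nn; rewrite ?leq_maxl ?leq_maxr.
rewrite -(sqr_hn (pos_herm_tensor aP)) ltr_sqr ?nnegrE ?sqrtr_ge0//.
Qed.

Lemma basis_tensor_cauchy c L (d : R) : uniq L -> 0 < d ->
  exists N, forall m, (N <= m)%N ->
    tensor_norm a (basis_tensor c L m - basis_tensor c L N) < d.
Proof.
move=> uL d0; have d4 : 0 < d ^+ 2 / 4 by rewrite divr_gt0 ?exprn_gt0.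
have cv := cvgC_Re oo2_filter (@basis_tensor_form_cvg c c L uL).
move: cv; set s := complex.Re _ => cv.
move/cvgrPdist_lt/(_ _ d4): cv => [[A B] /= [[N1 _ A1] [N2 _ B2]] AB].
pose N := maxn N1 N2.
have near m n : (N <= m)%N -> (N <= n)%N ->
    `|s - complex.Re (tensor_form a (basis_tensor c L m) (basis_tensor c L n))| < d ^+ 2 / 4.
  move=> Nm Nn; apply: (AB (m, n)); split=> /=; [apply: A1|apply: B2] => /=;
    [apply: leq_trans Nm|apply: leq_trans Nn]; by rewrite ?leq_maxl ?leq_maxr.
exists N => m Nm.
have := near m m Nm Nm; have := near m N Nm (leqnn N).
have := near N m (leqnn N) Nm; have := near N N (leqnn N) (leqnn N).
set X := basis_tensor c L m; set Y := basis_tensor c L N => h1 h2 h3 h4.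
have tP := pos_herm_tensor aP.
suff : hn (tensor_form a) (X - Y) ^+ 2 < d ^+ 2.
  by rewrite ltr_sqr ?nnegrE ?(ltW d0)//; exact: sqrtr_ge0.
rewrite (sqr_hn tP) (phBl tP) !(phBr tP) !raddfB /=.
move: h1 h2 h3 h4; move: (d ^+ 2) (complex.Re (tensor_form a X X)).
move: (complex.Re (tensor_form a X Y)) (complex.Re (tensor_form a Y X)).
move: (complex.Re (tensor_form a Y Y)) => yy yx xy q xx.
rewrite !ltr_norml; lra.
Qed.

End Tensors.

(** * Derivatives at the origin and Taylor coefficients *)

Section Origin.
Variables (R : realType) (V : tvsType R[i]) (bar : V -> V).
Hypothesis bar_inv : cont_antilinear_involution bar.
Local Notation K := R[i].
Local Notation C := (R[i]^o).
Local Notation S := (sym_alg V).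
Local Notation E := (real_dual bar).
Variable f : E -> C.
Hypothesis fa : analytic_HS f.
Let T (w : seq E) : K := iterD w f 0.

Lemma origin_letter u v (t : R) rho rho' :
  T (u ++ (t *: rho + rho') :: v) = (t%:C)%C * T (u ++ rho :: v) + T (u ++ rho' :: v).
Proof. exact: (iterD_letter fa). Qed.

Lemma origin_diff u v rho rho' :
  T (u ++ rho :: v) - T (u ++ rho' :: v) = T (u ++ (rho - rho') :: v).
Proof.
apply/eqP; rewrite subr_eq; apply/eqP.
have := origin_letter u v 1 (rho - rho') rho'.
by rewrite scale1r subrK rmorph1 mul1r.
Qed.

Lemma origin_sum (A : Type) u v (s : seq A) (c : A -> R) (g : A -> E) :
  T (u ++ (\sum_(i <- s) c i *: g i) :: v) =
  \sum_(i <- s) ((c i)%:C)%C * T (u ++ g i :: v).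
Proof.
elim: s => [|i s IH]; last by rewrite !big_cons origin_letter IH.
by rewrite !big_nil; exact: (iterD_letter0 fa).
Qed.

Section Form.
Variable a : V -> V -> K.
Hypothesis ar : real_cont_pos_herm bar a.
Let aP := cph_pos ar.1.

Lemma real_scale (c : R) : 0 <= c -> real_cont_pos_herm bar (scale_form c a).
Proof.
move=> c0; split=> [|v w]; first exact: (cph_scale ar.1 c0).
rewrite conjcE /scale_form rmorphM /= conj_real; congr (_ * _); exact: ar.2.
Qed.

(** Functionals bounded by [M] times the seminorm of [a] form a bounded set. *)
Lemma origin_bounded (M : R) k : 0 <= M -> exists2 B : R, 0 <= B &
  forall w, size w = k -> (forall rho, rho \in w -> form_bounded a M rho) ->
    normc (T w) <= B.
Proof.
move=> M0; have [|B HB] := smooth_bounded fa.1 0 (k := k)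
  (B := fun=> [set rho : E | form_bounded a M rho]).
  move=> _; exists (scale_form (M ^+ 2) a); first by apply: real_scale; exact: sqr_ge0.
  move=> rho v /(_ v) H; apply: le_trans H _.
  rewrite /form_norm /scale_form Re_mulr sqrtrM ?sqr_ge0// sqrtr_sqr.
  by rewrite ger0_norm.
exists `|B| => // w wk wM; apply: le_trans (ler_norm B).
apply: (HB (Tuple (introT eqP wk))) => i.
by apply: wM; rewrite -[w]/(tval (Tuple (introT eqP wk))); exact: mem_tnth.
Qed.

Lemma origin_small (M B d : R) k : 1 <= M -> 0 < d ->
  (forall w, size w = k -> (forall rho, rho \in w -> form_bounded a M rho) ->
    normc (T w) <= B) ->
  forall u v theta, size (u ++ theta :: v) = k ->
  (forall rho, rho \in u ++ v -> form_bounded a M rho) -> form_bounded a d theta ->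
  normc (T (u ++ theta :: v)) <= d * B.
Proof.
move=> M1 d0 HB u v theta sk uvM td.
have -> : theta = d *: (d^-1 *: theta) + 0 by rewrite addr0 scalerA divff ?gt_eqF// scale1r.
rewrite origin_letter [T (u ++ 0 :: v)](iterD_letter0 fa) addr0 normcM normc_real gtr0_norm//.
rewrite ler_pM2l//; apply: HB; first by rewrite -sk !size_cat.
move=> rho; rewrite mem_cat inE orbCA -mem_cat => /predU1P[->|]; last exact: uvM.
apply: (form_bounded_le (M := 1)) => // x.
rewrite -[d^-1 *: theta]addr0 fnZD addr0 normcM normc_real gtr0_norm ?invr_gt0//.
by rewrite mul1r ler_pdivrMl.
Qed.

(** Letters are replaced one at a time, and each replacement is a value on a word
    with one small letter. *)
Lemma origin_telescope (M B d : R) k : 1 <= M -> 0 < d ->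
  (forall w, size w = k -> (forall rho, rho \in w -> form_bounded a M rho) ->
    normc (T w) <= B) ->
  forall (g : E -> E) v u, (size u + size v = k)%N ->
  (forall rho, rho \in u ++ v ++ map g v -> form_bounded a M rho) ->
  (forall rho, rho \in v -> form_bounded a d (rho - g rho)) ->
  normc (T (u ++ v) - T (u ++ map g v)) <= (size v)%:R * (d * B).
Proof.
move=> M1 d0 HB g; elim=> [|x v IH] u sk bM bd; first by rewrite subrr normc0 mul0r.
have -> : T (u ++ x :: v) - T (u ++ map g (x :: v)) =
    T (u ++ (x - g x) :: v) + (T (rcons u (g x) ++ v) - T (rcons u (g x) ++ map g v)).
  rewrite -origin_diff !cat_rcons /=; ring.
apply: le_trans (normcD _ _) _; rewrite [(size (_ :: _))%:R]/= -natr1 mulrDl mul1r addrC.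
apply: lerD.
  apply: IH => [|rho|rho rv]; last by apply: bd; rewrite inE rv orbT.
    by rewrite size_rcons -sk addSnnS.
  move=> H; apply: bM; move: H; rewrite !(mem_cat, mem_rcons, inE, map_cons).
  by move=> /or3P[/predU1P[->|->]|->|->]; rewrite ?inE ?eqxx ?orbT.
apply: (origin_small M1 d0 HB); first by rewrite size_cat.
  move=> rho H; apply: bM; move: H; rewrite !(mem_cat, inE).
  by move=> /orP[->|->]; rewrite ?orbT.
by apply: bd; rewrite inE eqxx.
Qed.

Definition all_bounded (w : seq E) := forall rho, rho \in w -> exists M, form_bounded a M rho.

Lemma all_bounded_max w : all_bounded w ->
  exists2 M : R, 0 <= M & forall rho, rho \in w -> form_bounded a M rho.
Proof.
elim: w => [|rho w IH] wb; first by exists 0.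
have [|M M0 HM] := IH; first by move=> s sw; apply: wb; rewrite inE sw orbT.
have [|m hm] := wb rho; first by rewrite inE eqxx.
exists (M + `|m|) => [|s]; first by rewrite addr_ge0.
rewrite inE => /predU1P[->|/HM sM].
  by apply: form_bounded_le hm; rewrite (le_trans (ler_norm m))// lerDr.
by apply: form_bounded_le sM; rewrite lerDl.
Qed.

Section Basis.
Variables (I : choiceType) (e : I -> nat -> V).
Hypothesis eb : hilbert_basis bar a e.
Let eh := basis_vector eb.
Local Notation pj := (proj (bar := bar) a e).
Local Notation phi := (fun j => flat bar a (e j)).

Lemma proj_approx_all w (d : R) : all_bounded w -> 0 < d ->
  exists2 J0, uniq J0 & forall J, uniq J -> {subset J0 <= J} ->
    forall rho, rho \in w -> form_bounded a d (rho - pj J rho).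
Proof.
move=> wb d0; elim: w wb => [|rho w IH] wb; first by exists [::].
have [|J1 u1 H1] := IH; first by move=> s sw; apply: wb; rewrite inE sw orbT.
have [|m hm] := wb rho; first by rewrite inE eqxx.
have [J2 u2 H2] := proj_approx bar_inv ar eb hm d0.
exists (undup (J1 ++ J2)) => [|J uJ sJ s]; first exact: undup_uniq.
rewrite inE => /predU1P[->|sw].
  by apply: H2 => // j jJ; apply: sJ; rewrite mem_undup mem_cat jJ orbT.
by apply: H1 => // j jJ; apply: sJ; rewrite mem_undup mem_cat jJ.
Qed.

Lemma origin_proj_close w (d : R) : all_bounded w -> 0 < d ->
  exists2 J0, uniq J0 & forall J, uniq J -> {subset J0 <= J} ->
    normc (T w - T (map (pj J) w)) <= d.
Proof.
move=> wb d0; have [M M0 HM] := all_bounded_max wb.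
have M1 : 1 <= M + 1 by rewrite lerDr.
have [B B0 HB] := origin_bounded (size w) (le_trans ler01 M1).
have q0 : 0 < (size w)%:R * B + 1 by rewrite ltr_wpDl// mulr_ge0.
pose d' := Num.min 1 (d / ((size w)%:R * B + 1)).
have d'0 : 0 < d' by rewrite lt_min ltr01 divr_gt0.
have [J0 u0 H0] := proj_approx_all wb d'0; exists J0 => // J uJ sJ.
have close := H0 J uJ sJ.
have pM rho : rho \in w -> form_bounded a (M + 1) (pj J rho).
  move=> rw; have -> : pj J rho = -1 *: (rho - pj J rho) + rho.
    by rewrite scaleN1r opprB subrK.
  apply: form_bounded_le (form_boundedZD (-1) (close rho rw) (HM rho rw)).
  by rewrite normrN normr1 mul1r addrC lerD2l ge_min lexx.
have := @origin_telescope (M + 1) B d' (size w) M1 d'0 HB (pj J) w [::] erefl.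
rewrite !cat0s => H; apply: le_trans (H _ close) _.
  move=> rho; rewrite mem_cat => /orP[rw|/mapP[s sw ->]]; last exact: pM.
  by apply: form_bounded_le (HM rho rw); rewrite lerDl.
rewrite mulrCA; apply: le_trans (_ : _ <= d' * ((size w)%:R * B + 1)) _.
  by rewrite ler_wpM2l ?(ltW d'0)// lerDl.
by rewrite -ler_pdivlMr// ge_min lexx orbT.
Qed.

Lemma origin_expand J w u : T (u ++ map (pj J) w) =
  \sum_(t <- words J (size w)) ((coordw e w t)%:C)%C * T (u ++ map phi t).
Proof.
elim: w u => [|rho w IH] u; first by rewrite sum_words0 /= rmorph1 mul1r.
rewrite [map _ _]/= [proj _ _ _ _]/proj origin_sum [size _]/= sum_wordsS.
apply: eq_bigr => j _; rewrite -cat_rcons IH mulr_sumr; apply: eq_bigr => t _.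
by rewrite /= rmorphM /= mulrA cat_rcons.
Qed.

(** The coefficients of the Taylor series of [f] at the origin, in the basis [e]. *)
Definition taylor_coef (t : seq I) : K := ((size t)`!%:R)^-1 * T (map phi t).

Lemma sum_taylor_coef w J N : (size w < N)%N ->
  \sum_(t <- lwords J N) taylor_coef t * ((coordw e w t)%:C)%C =
  ((size w)`!%:R)^-1 * T (map (pj J) w).
Proof.
move=> wN; rewrite sum_lwords (bigD1 (Ordinal wN))//= [X in _ + X]big1 ?addr0; last first.
  move=> k kw; rewrite (eq_sum_words _ (G := fun=> 0)) ?big1// => t tk.
  rewrite coordw_size ?rmorph0 ?mulr0// tk; apply: contraNneq kw => wk.
  by apply/eqP/val_inj; rewrite /= wk.
have := origin_expand J w [::]; rewrite cat0s => ->; rewrite mulr_sumr.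
by apply: eq_sum_words => t tw; rewrite /taylor_coef tw cat0s -mulrA; congr (_ * _); rewrite mulrC.
Qed.

Lemma Qe0 w (Y : S) : Qe 0 w Y = (size w)`!%:R * weval (map (@fn _ _ bar) w) (sym_val Y).
Proof.
have := Qd0 (sym_val Y) (all_lin_fn w); rewrite size_map => <-.
by rewrite /Qe (_ : fn 0 = fun=> 0)//; apply/funext.
Qed.

Lemma taylor_weval_cvg w J N : all_bounded w -> (size w < N)%N ->
  (fun n => weval (map (@fn _ _ bar) w) (basis_tensor e (taylor_coef) (lwords J N) n) : C)
    @ \oo --> (((size w)`!%:R)^-1 * T (map (pj J) w) : C).
Proof.
move=> wb wN; rewrite -(sum_taylor_coef J wN).
exact: (weval_basis_tensor_cvg eb wb).
Qed.

(** Averaging over the symmetric group does not change the limit, the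
    iterated derivatives being symmetric. *)
Lemma taylor_Qe_cvg w J N : all_bounded w -> (size w < N)%N ->
  (fun n => Qe 0 w (symmetrise (basis_tensor e taylor_coef (lwords J N) n)) : C)
    @ \oo --> (T (map (pj J) w) : C).
Proof.
move=> wb wN; set k := size w.
have kn0 : k`!%:R != 0 :> K by rewrite pnatr_eq0 -lt0n fact_gt0.
have cv : (fun n => \sum_(s <- index_enum 'S_k) (weval (map (@fn _ _ bar) (perm_word 0 s w))
    (basis_tensor e taylor_coef (lwords J N) n) : C)) @ \oo -->
  (\sum_(s <- index_enum 'S_k) ((k`!%:R)^-1 * T (map (pj J) (perm_word 0 s w))) : C).
  apply: cvgC_sum => s; rewrite -[k in (k`!%:R)^-1](size_perm_word 0 s w).
  apply: taylor_weval_cvg; last by rewrite size_perm_word.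
  by move=> rho; rewrite (perm_mem (perm_perm_word 0 s (erefl _))); exact: wb.
have -> : T (map (pj J) w) = \sum_(s : 'S_k) ((k`!%:R)^-1 * T (map (pj J) (perm_word 0 s w))).
  rewrite -mulr_sumr (eq_bigr (fun=> T (map (pj J) w))); last first.
    move=> s _; apply: (smooth_sym fa.1); apply: perm_map.
    exact: perm_perm_word.
  by rewrite sumr_const card_Sn -[T (map (pj J) w) *+ _]mulr_natl mulKf.
refine (eq_cvgC _ cv) => n; rewrite Qe0 (weval_Sym _ (fn (0 : E)) (size_map _ _) (all_lin_fn w)).
rewrite mulVKf//; apply: eq_bigr => s _.
by rewrite (map_perm_word _ 0 (fn (0 : E))).
Qed.

End Basis.
End Form.
End Origin.

Lemma snorm_symmetriseB (R : realType) (V : tvsType R[i]) (a : V -> V -> R[i])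
    (X X' : tensor_alg V) : pos_herm a ->
  snorm a (symmetrise X - symmetrise X') <= tensor_norm a (X - X').
Proof.
move=> aP; apply: le_trans (tensor_norm_Sym (X - X') aP).
by rewrite /snorm le_eqVlt (linB _ _ (@Sym_linear _ V)) eqxx.
Qed.

(** * Tensors approximating an analytic function *)

Section Approximants.
Variables (R : realType) (V : tvsType R[i]) (bar : V -> V).
Hypothesis bar_inv : cont_antilinear_involution bar.
Local Notation K := R[i].
Local Notation C := (R[i]^o).
Local Notation S := (sym_alg V).
Local Notation E := (real_dual bar).
Variable f : E -> C.
Hypothesis fa : analytic_HS f.

Lemma Qe_linear sigma w : linear (Qe (bar := bar) sigma w : S -> C).
Proof.
move=> c X Y; exact: (Qd_linear (fn_lin sigma) (all_lin_fn w)).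
Qed.

(** A symmetric tensor whose derivatives at the origin match those of [f]
    up to [eps], uniformly over the functionals of norm one on symmetric
    tensors that are combinations of words of [a]-bounded letters. *)
Definition approximates a (eps : R) (Y : S) :=
  forall (s : seq (K * seq E)) (N : R), 0 <= N ->
  (forall p, p \in s -> all_bounded a p.2) ->
  (forall Z : S, normc (\sum_(p <- s) p.1 * Qe 0 p.2 Z) <= N * snorm a Z) ->
  normc (\sum_(p <- s) p.1 * (iterD p.2 f 0 - Qe 0 p.2 Y)) <= eps * N.

Section Form.
Variable a : V -> V -> K.
Hypothesis ar : real_cont_pos_herm bar a.
Let aP := cph_pos ar.1.

Section Basis.
Variables (I : choiceType) (e : I -> nat -> V).
Hypothesis eb : hilbert_basis bar a e.
Local Notation cf := (taylor_coef f a e).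
Local Notation bt N J n := (basis_tensor e cf (lwords J N) n).

(** Finitely many words involve finitely many approximations by basis vectors, so
    one truncation serves all the terms. *)
Lemma combination_cvg (s : seq (K * seq E)) (d : R) :
  (forall p, p \in s -> all_bounded a p.2) -> 0 < d ->
  exists N0 (J0 : seq I), forall N (J : seq I), (N0 <= N)%N -> uniq J -> {subset J0 <= J} ->
    \forall n \near \oo, normc (\sum_(p <- s) p.1 *
      (iterD p.2 f 0 - Qe 0 p.2 (symmetrise (bt N J n)))) < d.
Proof.
elim: s d => [|[c w] s IH] d sb d0.
  by exists 0%N, [::] => N J _ _ _; exists 0%N => // n _; rewrite big_nil normc0.
have d2 : 0 < d / 2 by exact: divr_gt0.
have [|//|N1 [J1 H1]] := IH (d / 2); first by move=> p ps; apply: sb; rewrite inE ps orbT.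
have wb : all_bounded a w by apply: (sb (c, w)); rewrite inE eqxx.
have c1 : 0 < normc c + 1 by rewrite ltr_wpDl ?normc_ge0.
pose d' := d / 2 / (normc c + 1) / 2.
have d'0 : 0 < d' by rewrite !divr_gt0.
have [J2 u2 H2] := origin_proj_close bar_inv fa ar eb wb d'0.
exists (maxn N1 (size w).+1), (J1 ++ J2) => N J; rewrite geq_max => /andP[N1N wN] uJ sJ.
have sJ1 : {subset J1 <= J} by move=> j jJ; apply: sJ; rewrite mem_cat jJ.
have sJ2 : {subset J2 <= J} by move=> j jJ; apply: sJ; rewrite mem_cat jJ orbT.
have /cvgC_normc/(_ _ d'0) := @taylor_Qe_cvg _ _ _ _ fa _ _ _ eb _ J _ wb wN.
apply: filterS2 (H1 N J N1N uJ sJ1) => n h1 h2; rewrite big_cons /=.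
apply: le_lt_trans (normcD _ _) _; rewrite [ltRHS]splitr; apply: ler_ltD h1.
rewrite normcM; apply: le_trans (_ : _ <= normc c * (d' + d')) _.
  rewrite ler_wpM2l ?normc_ge0//.
  set q := iterD (map _ w) f 0 in h2.
  have -> : iterD w f 0 - Qe 0 w (symmetrise (bt N J n)) =
    (iterD w f 0 - q) + (q - Qe 0 w (symmetrise (bt N J n))) by ring.
  apply: le_trans (normcD _ _) _; apply: lerD; first exact: H2.
  by rewrite normcB; exact: ltW.
have -> : d' + d' = d / 2 / (normc c + 1) by rewrite /d'; field; rewrite gt_eqF.
by rewrite mulrCA ler_piMr ?(ltW d2)// ler_pdivrMr// mul1r lerDl ler01.
Qed.

Variable M : R.
Hypothesis HS : forall k0 J, uniq J -> \sum_(k < k0) k`!%:R^-1 *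
  \sum_(t <- words J k) normc (iterD [seq flat bar a (e j) | j <- t] f 0) ^+ 2 <= M.

Lemma taylor_coef_norm J N :
  \sum_(t <- lwords J N) (size t)`!%:R * normc (cf t) ^+ 2 =
  \sum_(k < N) k`!%:R^-1 *
    \sum_(t <- words J k) normc (iterD [seq flat bar a (e j) | j <- t] f 0) ^+ 2.
Proof.
rewrite sum_lwords; apply: eq_bigr => k _; rewrite mulr_sumr; apply: eq_sum_words => t tk.
rewrite /taylor_coef normcM tk exprMn mulrA; congr (_ * _).
have kn0 : k`!%:R != 0 :> R by rewrite pnatr_eq0 -lt0n fact_gt0.
have -> : normc ((k`!%:R)^-1 : K) = (k`!%:R)^-1 :> R.
  rewrite -[k`!%:R in LHS](rmorph_nat (real_complex R)) -fmorphV normc_real.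
  by rewrite ger0_norm// invr_ge0.
by rewrite expr2 mulrA mulfV// mul1r.
Qed.

(** Truncated late enough, Taylor tensors differ by a small tail of the
    convergent series of [f]. Norms are only limits in [n], the vectors of the
    basis being Cauchy sequences; this is why both truncation and [n] vary. *)
Lemma taylor_approx (d : R) : 0 < d -> exists N0 (J0 : seq I) n0, forall N (J : seq I),
  (N0 <= N)%N -> uniq J -> {subset J0 <= J} ->
  \forall n \near \oo, tensor_norm a (bt N J n - bt N0 J0 n0) < d.
Proof.
move=> d0; have d2 : 0 < d / 2 by exact: divr_gt0.
pose r (p : nat * seq I) := \sum_(t <- lwords p.2 p.1) (size t)`!%:R * normc (cf t) ^+ 2.
have q0 : 0 < (d / 2) ^+ 2 / 2 by rewrite divr_gt0 ?exprn_gt0.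
have [||[N0 J0] /= [u0 H0]] := @near_sup R _ (fun p : nat * seq I => uniq p.2) r M _ _ _ q0.
- by exists (0%N, [::]).
- by move=> [N J] /= uJ; rewrite /r taylor_coef_norm; exact: HS.
have [n0 Hn0] := basis_tensor_cauchy ar eb cf (lwords_uniq N0 u0) d2.
exists N0, J0, n0 => N J NN uJ sJ.
have uL := lwords_uniq N uJ; have uL0 := lwords_uniq N0 u0.
pose c' (t : seq I) : K := if t \in lwords J0 N0 then 0 else cf t.
have sL : {subset lwords J0 N0 <= lwords J N}.
  move=> t; rewrite !mem_lwords => /andP[tN /allP tJ]; rewrite (leq_trans tN NN).
  by apply/allP => j /tJ; exact: sJ.
have perm0 : perm_eq [seq t <- lwords J N | t \in lwords J0 N0] (lwords J0 N0).
  apply: uniq_perm => //; first exact: filter_uniq.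
  by move=> t; rewrite mem_filter; case: (boolP (t \in lwords J0 N0)) => //= /sL ->.
have diff n : bt N J n - bt N0 J0 n = basis_tensor e c' (lwords J N) n.
  rewrite /basis_tensor (bigID (fun t => t \in lwords J0 N0)) /=.
  rewrite -[X in X + _ - _]big_filter (perm_big _ perm0) /= addrAC subrr add0r.
  rewrite [RHS](bigID (fun t => t \in lwords J0 N0)) /= [X in _ = X + _]big1 ?add0r.
    by apply: eq_bigr => t tJ; rewrite /c' (negPf tJ).
  by move=> t tJ; rewrite /c' tJ scale0r.
have small : \sum_(t <- lwords J N) (size t)`!%:R * normc (c' t) ^+ 2 < (d / 2) ^+ 2.
  apply: le_lt_trans (_ : _ <= (d / 2) ^+ 2 / 2) _; last first.
    by rewrite ltr_pdivrMr// ltr_pMr ?exprn_gt0// ltr1n.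
  have := H0 (N, J) uJ; rewrite /r /= (bigID (fun t => t \in lwords J0 N0)) /=.
  rewrite -[X in X + _ <= _]big_filter (perm_big _ perm0) /= lerD2l; apply: le_trans.
  rewrite (bigID (fun t => t \in lwords J0 N0)) /= [X in X + _]big1 ?add0r.
    by apply: ler_sum => t tJ; rewrite /c' (negPf tJ).
  by move=> t tJ; rewrite /c' tJ normc0 expr0n mulr0.
have near1 := basis_tensor_norm_cvg ar eb uL small (ltW d2).
have near2 : \forall n \near \oo, (n0 <= n)%N by exists n0.
apply: filterS2 near1 near2 => n; rewrite -diff => h1 /Hn0 h2.
have tP := pos_herm_tensor aP.
have -> : bt N J n - bt N0 J0 n0 = (bt N J n - bt N0 J0 n) + (bt N0 J0 n - bt N0 J0 n0).
  by rewrite addrA subrK.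
apply: le_lt_trans (hnD tP _ _) _; rewrite [ltRHS]splitr; exact: ltrD.
Qed.

Lemma approximates_basis (eps : R) : 0 < eps -> exists Y, approximates a eps Y.
Proof.
move=> e0; have [N0 [J0 [n0 H0]]] := taylor_approx e0.
exists (symmetrise (bt N0 J0 n0)) => s N N_ge0 sb sN.
apply/ler_addgt0Pl => d d0; have [N1 [J1 H1]] := combination_cvg sb d0.
pose J := undup (J0 ++ J1); have uJ : uniq J by exact: undup_uniq.
have sJ0 : {subset J0 <= J} by move=> j jJ; rewrite mem_undup mem_cat jJ.
have sJ1 : {subset J1 <= J} by move=> j jJ; rewrite mem_undup mem_cat jJ orbT.
have h0 := H0 (maxn N0 N1) J (leq_maxl _ _) uJ sJ0.
have h1 := H1 (maxn N0 N1) J (leq_maxr _ _) uJ sJ1.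
have [n [k1 k2]] := filter_ex (filterI h0 h1).
set Y := symmetrise (bt N0 J0 n0); set Y' := symmetrise (bt (maxn N0 N1) J n) in k2 *.
have -> : \sum_(p <- s) p.1 * (iterD p.2 f 0 - Qe 0 p.2 Y) =
    \sum_(p <- s) p.1 * (iterD p.2 f 0 - Qe 0 p.2 Y') +
    \sum_(p <- s) p.1 * Qe 0 p.2 (Y' - Y).
  rewrite -big_split; apply: eq_bigr => p _ /=; rewrite -mulrDr; congr (_ * _).
  rewrite (linB _ _ (Qe_linear 0 p.2)); ring.
apply: le_trans (normcD _ _) _; apply: lerD (ltW k2) _.
apply: le_trans (sN _) _; rewrite mulrC ler_wpM2r//.
by apply: le_trans (snorm_symmetriseB _ _ aP) (ltW k1).
Qed.

End Basis.

Lemma approximates_exists (eps : R) : 0 < eps -> exists Y, approximates a eps Y.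
Proof.
have [_ /(_ 0 0 a ar)[M [I [e [eb H]]]]] := fa.
apply: (@approximates_basis I e eb M) => k0 J uJ.
apply: (@series_words_ge _ _ (fun s => normc (iterD [seq flat bar a (e j) | j <- s] f 0) ^+ 2) _
  (fun k => k`!%:R^-1)) => //; first by move=> s; exact: sqr_ge0.
by have := H 0; rewrite lexx ler01 !scaler0 addr0 => /(_ isT).
Qed.

End Form.
End Approximants.

(** * Surjectivity and injectivity *)

Section Bijection.
Variables (R : realType) (V : tvsType R[i]) (bar : V -> V).
Hypothesis bar_inv : cont_antilinear_involution bar.
Local Notation K := R[i].
Local Notation C := (R[i]^o).
Local Notation S := (sym_alg V).
Local Notation E := (real_dual bar).

Lemma flat_const a x : real_cont_pos_herm bar a -> bar x = x ->
  fn (flat bar a (fun=> x)) = a x.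
Proof.
by move=> ar xr; rewrite (fn_flat ar (hv_const ar xr)); apply/funext => v; rewrite lim_cst.
Qed.

(** The tensor is written with real letters, so that the letters [a v] of the words
    belong to the real dual. *)
Lemma inner_combination a (Y : S) : real_cont_pos_herm bar a ->
  exists s : seq (K * seq E), (forall p, p \in s -> all_bounded a p.2) /\
  forall Z : S, tensor_form a (sym_val Y) (sym_val Z) = \sum_(p <- s) p.1 * Qe 0 p.2 Z.
Proof.
move=> ar; have aP := cph_pos ar.1.
have [s [-> sr]] := tensor_span_real (bar_antilinear bar_inv) (barK bar_inv) (sym_val Y).
pose fl (x : V) : E := flat bar a (fun=> x).
exists [seq (p.1^*, map fl p.2) | p <- s]; split=> [q|Z].
  move=> /mapP[p ps ->] rho /mapP[x xp ->]; exists (form_norm a x) => v.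
  by rewrite flat_const//; [exact: (ph_CS aP)|exact: sr xp].
rewrite big_map (tensor_form_suml aP); apply: eq_big_seq => p ps /=.
rewrite (tensor_form_pure aP) Qe0 size_map -map_comp; congr (_ * (_ * weval _ _)).
by apply/eq_in_map => x xp /=; rewrite flat_const//; exact: sr xp.
Qed.

Lemma approximates_le (f : E -> C) a b (eps d : R) Y : cont_pos_herm a -> cont_pos_herm b ->
  fle a b -> eps <= d -> approximates f b eps Y -> approximates f a d Y.
Proof.
move=> ac bc ab ed apx s N N0 sb sN.
apply: le_trans (_ : _ <= eps * N) _; last by rewrite ler_wpM2r.
apply: apx => // [p ps rho rp|Z].
  have [M HM] := sb p ps rho rp; exists `|M| => v; apply: le_trans (HM v) _.
  apply: le_trans (_ : _ <= `|M| * form_norm a v) _.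
    by rewrite ler_wpM2r ?sqrtr_ge0// ler_norm.
  by rewrite ler_wpM2l// ler_wsqrtr.
by apply: le_trans (sN Z) _; rewrite ler_wpM2l// snorm_le.
Qed.

(** The square of the norm of [D = Y - Y'] is the value at [D] of a combination of
    words whose norm, as a functional, is the norm of [D]. *)
Lemma approximates_close (f : E -> C) a (eps : R) Y Y' : real_cont_pos_herm bar a -> 0 <= eps ->
  approximates f a eps Y -> approximates f a eps Y' -> snorm a (Y - Y') <= eps + eps.
Proof.
move=> ar e0 HY HY'; have tP := pos_herm_tensor (cph_pos ar.1).
set D := Y - Y'; set N := snorm a D; have N0 : 0 <= N := snorm_ge0 a D.
have [s [sb sE]] := inner_combination D ar.
have sN (Z : S) : normc (\sum_(p <- s) p.1 * Qe 0 p.2 Z) <= N * snorm a Z.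
  by rewrite -sE; exact: (ph_CS tP).
have DD : N ^+ 2 <= (eps + eps) * N.
  rewrite [leLHS](sqr_hn tP); apply: le_trans (ler_norm _) _.
  apply: le_trans (Re_le_normc _) _; rewrite sE.
  have -> : \sum_(p <- s) p.1 * Qe 0 p.2 D =
      \sum_(p <- s) p.1 * (iterD p.2 f 0 - Qe 0 p.2 Y') -
      \sum_(p <- s) p.1 * (iterD p.2 f 0 - Qe 0 p.2 Y).
    rewrite -sumrB; apply: eq_bigr => p _; rewrite -mulrBr; congr (_ * _).
    rewrite (linB _ _ (Qe_linear 0 p.2)); ring.
  apply: le_trans (normcD _ _) _; rewrite normc_opp mulrDl.
  by apply: lerD; [exact: HY'|exact: HY].
have [->|Nn0] := eqVneq N 0; first by rewrite addr_ge0.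
have Np : 0 < N by rewrite lt_neqAle eq_sym Nn0.
by rewrite -(ler_pM2r Np) -expr2.
Qed.

Lemma real_add (a b : V -> V -> K) : real_cont_pos_herm bar a -> real_cont_pos_herm bar b ->
  real_cont_pos_herm bar (add_form a b).
Proof.
move=> ar br; split=> [|v w]; first exact: (cph_add ar.1 br.1).
by rewrite conjcE /add_form rmorphD; congr (_ + _); [exact: ar.2|exact: br.2].
Qed.

Lemma real_fsum (w : seq E) : real_cont_pos_herm bar (fsum (map (@fn _ _ bar) w)).
Proof.
split=> [|v v'].
  by apply: (cph_fsum (all_lin_fn w)) => g; exact: cont_map_fn.
rewrite conjcE /fsum rmorph_sum !big_map; apply: eq_bigr => rho _.
by rewrite rmorphM /= conjCK -!fn_real conjCK.
Qed.

Lemma fle_addl (a b : V -> V -> K) : pos_herm b -> fle a (add_form a b).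
Proof. by move=> bP v; rewrite /add_form raddfD lerDl; exact: ph_Re_ge0. Qed.

Lemma fle_addr (a b : V -> V -> K) : pos_herm a -> fle b (add_form a b).
Proof. by move=> aP v; rewrite /add_form raddfD lerDr; exact: ph_Re_ge0. Qed.

Lemma fsum_bounded (w : seq E) a : real_cont_pos_herm bar a ->
  fle (fsum (map (@fn _ _ bar) w)) a -> all_bounded a w.
Proof.
move=> ar wa rho rw; exists 1 => v; rewrite mul1r.
rewrite -ler_sqr ?nnegrE ?normc_ge0 ?sqrtr_ge0// [leRHS](sqr_hn (cph_pos ar.1)).
apply: le_trans (wa v); rewrite fsum_diag /= big_map (big_rem rho)//= lerDl.
by apply: sumr_ge0 => s _; exact: sqr_ge0.
Qed.

Section Filter.
Variable f : E -> C.
Hypothesis fa : analytic_HS f.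

(** Approximants for larger forms and higher precision form smaller sets. *)
Definition approx_filter : set_system S :=
  filter_from [set p : (V -> V -> K) * R | real_cont_pos_herm bar p.1 /\ 0 < p.2]
    (fun p => approximates f p.1 p.2).

Lemma approx_filter_proper : ProperFilter approx_filter.
Proof.
apply: filter_from_proper; last first.
  by move=> [a d] /= [ar d0]; exact: approximates_exists.
apply: filter_from_filter.
  by exists (fsum (map (@fn _ _ bar) [::]), 1); split; [exact: real_fsum|exact: ltr01].
move=> [a d] [b d'] /= [ar d0] [br d'0].
have cr := real_add ar br.
exists (add_form a b, Num.min d d') => /=; first by rewrite lt_min d0.
move=> Y HY; split.
  refine (approximates_le ar.1 cr.1 (fle_addl _ (cph_pos br.1)) _ HY) => /=.
  by rewrite ge_min lexx.
refine (approximates_le br.1 cr.1 (fle_addr _ (cph_pos ar.1)) _ HY) => /=.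
by rewrite ge_min lexx orbT.
Qed.

Lemma approx_filter_cauchy : sym_cauchy approx_filter.
Proof.
move=> a eps ac e0; have rr := real_form_real bar_inv ac.
have e4 : 0 < eps / 4 by exact: divr_gt0.
exists [set Y | approximates f (real_form bar a) (eps / 4) Y].
  by exists (real_form bar a, eps / 4).
move=> Y Y' HY HY'.
apply: le_lt_trans (snorm_le _ ac rr.1 (real_form_fle bar ac)) _.
apply: le_lt_trans (approximates_close rr (ltW e4) HY HY') _.
by rewrite -mulr2n -mulr_natr; lra.
Qed.

Section Completion.
Variables (W : tvsType R[i]) (iota : S -> W).
Hypothesis cpl : is_completion sym_nbhs0 iota.

Lemma approx_filter_Qe w : (Qe 0 w : S -> C) @ approx_filter --> (iterD w f 0 : C).
Proof.
have FA := approx_filter_proper; apply/cvgC_normc => d d0.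
have [_ [b [M [bc HM]]]] := Qe_cont 0 w.
pose c := add_form (real_form bar b) (fsum (map (@fn _ _ bar) w)).
have rr := real_form_real bar_inv bc; have wr := real_fsum w.
have cr : real_cont_pos_herm bar c by exact: real_add.
have M1 : 0 < `|M| + 1 by rewrite ltr_wpDl.
have dM : 0 < d / (`|M| + 1) by exact: divr_gt0.
exists (c, d / (`|M| + 1)) => // Y HY; rewrite /= normcB.
have := HY [:: (1, w)] `|M| (normr_ge0 _); rewrite big_seq1 mul1r.
move=> H; apply: le_lt_trans (H _ _) _.
- move=> p; rewrite inE => /eqP -> /=.
  by apply: (fsum_bounded cr); exact: fle_addr _ (cph_pos rr.1).
- move=> Z; rewrite big_seq1 mul1r; apply: le_trans (HM Z) _.
  apply: le_trans (_ : _ <= `|M| * snorm b Z) _.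
    by rewrite ler_wpM2r ?snorm_ge0// ler_norm.
  rewrite ler_wpM2l//; apply: (snorm_le _ bc cr.1) => v.
  by apply: le_trans (real_form_fle bar bc v) (fle_addl _ (cph_pos wr.1) v).
- by rewrite mulrAC ltr_pdivrMr// ltr_pM2l// ltrDl.
Qed.

Lemma gelfand_preimage : exists X, gelfand bar iota X = f.
Proof.
have FA := approx_filter_proper.
have [X cX] := sym_cauchy_cvg cpl FA approx_filter_cauchy.
exists X; apply: (analytic_HS_eq bar_inv) => [||w] //; first exact: gelfand_HS.
rewrite (iterD_gelfand cpl); apply: (ext_unique cpl FA cX); first exact: Qe_cont.
exact: approx_filter_Qe.
Qed.

End Completion.
End Filter.

Section Completion.
Variables (W : tvsType R[i]) (iota : S -> W).
Hypothesis cpl : is_completion sym_nbhs0 iota.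
#[local] Instance FTG X : ProperFilter (trace_nbhs iota X) := trace_proper cpl X.

(** For [Y] near [X], the inner product of [Y] with [Z] tends to 0 as [Z] tends to
    [X], while it differs from the square of the norm of [Y] by at most [eps / 2]
    times that norm. *)
Lemma Qhat_eq0 X : (forall w : seq E, Qhat iota 0 w X = 0) -> X = 0.
Proof.
move=> X0; apply: (completion_eq0 cpl) => a eps ac e0.
have br := real_form_real bar_inv ac; set b := real_form bar a in br.
have tP := pos_herm_tensor (cph_pos br.1).
have e2 : 0 < eps / 2 by exact: divr_gt0.
have [A FA HA] := cvg_sym_cauchy cpl (FTG X) (@iota_trace _ _ _ iota X) br.1 e2.
apply: (filterS _ FA) => Y AY; apply: le_lt_trans (snorm_le _ ac br.1 (real_form_fle bar ac)) _.
apply: le_lt_trans (_ : _ <= eps / 2) _; last by rewrite ltr_pdivrMr// ltr_pMr// ltr1n.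
set N := snorm b Y; have N0 : 0 <= N := snorm_ge0 b Y.
have [s [_ sE]] := inner_combination Y br.
have cv : (fun Z : S => \sum_(p <- s) p.1 * Qe 0 p.2 Z : C) @ trace_nbhs iota X --> (0 : C).
  rewrite [X in _ --> X](_ : _ = \sum_(p <- s) (p.1 : C) * (Qhat iota 0 p.2 X : C)); last first.
    by rewrite big1// => p _; rewrite X0 mulr0.
  apply: cvgC_sum => p; apply: cvgM; first exact: cvg_cst.
  exact: (Qhat_cvg cpl).
have NN : N ^+ 2 <= N * (eps / 2).
  apply/ler_addgt0Pl => d d0; move/cvgC_normc/(_ d d0): cv => near.
  have [Z [Z1 Z2]] := filter_ex (filterI near FA).
  rewrite subr0 -sE in Z1.
  rewrite [leLHS](sqr_hn tP); apply: le_trans (ler_norm _) _.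
  apply: le_trans (Re_le_normc _) _.
  have -> : tensor_form b (sym_val Y) (sym_val Y) =
      tensor_form b (sym_val Y) (sym_val Z) + tensor_form b (sym_val Y) (sym_val Y - sym_val Z).
    by rewrite (phBr tP) addrC subrK.
  apply: le_trans (normcD _ _) _; apply: lerD (ltW Z1) _.
  apply: le_trans (ph_CS tP _ _) _; rewrite ler_wpM2l//.
  by apply: ltW; exact: (HA Y Z AY Z2).
have [->|Nn0] := eqVneq N 0; first exact: ltW.
have Np : 0 < N by rewrite lt_neqAle eq_sym Nn0.
by rewrite -(ler_pM2l Np) -expr2.
Qed.

Lemma gelfand_linear : linear (gelfand bar iota : W -> (E -> C)).
Proof.
move=> c X Y; apply/funext => rho.
rewrite -[RHS]/(c * gelfand bar iota X rho + gelfand bar iota Y rho) !gelfandE.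
exact: (ext_linear cpl (Qe_cont rho [::])).
Qed.

Lemma gelfand_injective : injective (gelfand bar iota).
Proof.
move=> X Y XY; apply/eqP; rewrite -subr_eq0; apply/eqP; apply: Qhat_eq0 => w.
have D0 : gelfand bar iota (X - Y) = gelfand bar iota 0.
  by rewrite (linB _ _ gelfand_linear) XY subrr (lin0 gelfand_linear).
have := iterD_gelfand cpl w (X - Y); rewrite D0 (iterD_gelfand cpl) => /(congr1 (fun g => g 0)).
by rewrite /= => <-; exact: (lin0 (ext_linear cpl (Qe_cont 0 w))).
Qed.

Lemma Qe_delta (rho : E) (Y : S) : Qe rho [::] Y = delta (fn rho) (sym_val Y) :> K.
Proof. by rewrite /Qe /= Qd_delta//; exact: fn_lin. Qed.

Lemma gelfand_vee X Y :
  gelfand bar iota (vee_cpl iota X Y) = fun_mul bar (gelfand bar iota X) (gelfand bar iota Y).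
Proof.
apply/funext => rho; rewrite /fun_mul !gelfandE.
apply: (ext_vee cpl _ _ (Qe_cont rho [::])) => Z Z'; rewrite !Qe_delta.
by rewrite (delta_Sym (fn_lin rho)) (delta_tmul (fn_lin rho)).
Qed.

Lemma gelfand_one : gelfand bar iota (one_cpl iota) = fun_one bar.
Proof.
apply/funext => rho; rewrite gelfandE.
rewrite [LHS](ext_iota cpl _ (Qe_cont rho [::])) Qe_delta.
by rewrite sym_one_val (delta_pure (fn_lin rho)) big_nil.
Qed.

Lemma delta_star (rho : E) X : delta (fn rho) (tensor_star bar X) = (delta (fn rho) X)^*.
Proof.
have dl := delta_linear (fn_lin rho); have sl := tensor_star_lin (bar_antilinear bar_inv).
elim/tensor_ind: X => [|c x Y IH].
  by rewrite (tensor_star0 (bar_antilinear bar_inv)) (lin0 dl) conjC0.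
rewrite sl !dl rmorphD rmorphM IH /=; congr (_ * _ + _).
rewrite (tensor_star_pure (bar_antilinear bar_inv)) !(delta_pure (fn_lin rho)).
rewrite rmorph_prod (perm_big _ (introT permPl (perm_rev _))) big_map.
by apply: eq_bigr => v _; exact: esym (fn_real rho v).
Qed.

Lemma gelfand_star X :
  gelfand bar iota (star_cpl bar iota X) = fun_star bar (gelfand bar iota X).
Proof.
apply/funext => rho; rewrite /fun_star !gelfandE.
apply: (ext_star cpl bar_inv _ (Qe_cont rho [::])) => Y.
by rewrite !Qe_delta (sym_starE bar_inv) delta_star.
Qed.

End Completion.
End Bijection.

(** The axioms hold pointwise for functions; injectivity carries them to [A], and
    the range is closed under the operations. *)
Lemma function_algebra_iso (R : realType) (A : lmodType R[i]) (D : Type)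
    (mul : A -> A -> A) one star (Q : set (D -> R[i]^o)) (phi : A -> (D -> R[i]^o)) :
  linear phi -> injective phi -> Q = range phi ->
  (forall x y, phi (mul x y) = fun d => phi x d * phi y d) ->
  phi one = (fun=> 1) ->
  (forall x, phi (star x) = fun d => (phi x d)^*) ->
  unital_star_iso setT mul one star Q (fun f g d => f d * g d) (fun=> 1)
    (fun f d => (f d)^*) phi.
Proof.
move=> lin inj QE phiM phi1 phiS.
have ZE (c : R[i]) (f g : D -> R[i]^o) d : (c *: f + g) d = c * f d + g d by [].
split=> //.
- split=> //.
  + by move=> x y z _ _ _; apply: inj; rewrite !phiM; apply/funext => d; rewrite mulrA.
  + move=> c x y z _ _ _; apply: inj; rewrite lin !phiM lin; apply/funext => d.
    by rewrite !ZE mulrDl mulrA.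
  + move=> c x y z _ _ _; apply: inj; rewrite lin !phiM lin; apply/funext => d.
    by rewrite !ZE mulrDr mulrCA.
  + move=> x _; split; apply: inj; rewrite phiM phi1; apply/funext => d.
      by rewrite mul1r.
    by rewrite mulr1.
  + by move=> x _; apply: inj; rewrite !phiS; apply/funext => d; rewrite conjCK.
  + move=> c x y _ _; apply: inj; rewrite lin !phiS lin; apply/funext => d.
    by rewrite !ZE rmorphD rmorphM.
  + move=> x y _ _; apply: inj; rewrite phiM !phiS phiM; apply/funext => d.
    by rewrite rmorphM mulrC.
- rewrite QE; split.
  + by exists 0 => //; exact: lin0.
  + by move=> c _ _ [x _ <-] [y _ <-]; exists (c *: x + y) => //; exact: lin.
  + by move=> _ _ [x _ <-] [y _ <-]; exists (mul x y) => //; exact: phiM.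
  + by exists one; rewrite ?phi1.
  + by move=> _ [x _ <-]; exists (star x) => //; exact: phiS.
  + by move=> f g h _ _ _; apply/funext => d; rewrite mulrA.
  + by move=> c f g h _ _ _; apply/funext => d; rewrite !ZE mulrDl mulrA.
  + by move=> c f g h _ _ _; apply/funext => d; rewrite !ZE mulrDr mulrCA.
  + by move=> f _; split; apply/funext => d; rewrite ?mul1r ?mulr1.
  + by move=> f _; apply/funext => d; rewrite conjCK.
  + by move=> c f g _ _; apply/funext => d; rewrite !ZE rmorphD rmorphM.
  + by move=> f g _ _; apply/funext => d; rewrite rmorphM mulrC.
- rewrite QE; split=> [x _|x y _ _ /inj//|f [x _ <-]]; first by exists x.
  by exists x.
- by move=> c x y _ _; exact: lin.
Qed.

Theorem theorem3p26 (R : realType) (V : tvsType R[i])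
    (V_hausdorff : hausdorff_space V)
    (V_hilbert : hilbert_seminorms_cofinal V)
    (bar : V -> V) (bar_inv : cont_antilinear_involution bar)
    (Scpl : tvsType R[i]) (iota : sym_alg V -> Scpl)
    (Scpl_completion : is_completion sym_nbhs0 iota) :
  unital_star_iso
    [set: Scpl] (vee_cpl iota) (one_cpl iota) (star_cpl bar iota)
    [set f | analytic_HS f] (fun_mul bar) (fun_one bar) (fun_star bar)
    (gelfand bar iota).
Proof.
have cpl := Scpl_completion.
apply: function_algebra_iso.
- exact: gelfand_linear.
- exact: gelfand_injective.
- apply/seteqP; split=> [f fa|_ [X _ <-]]; last exact: gelfand_HS.
  by have [X Xf] := gelfand_preimage bar_inv fa cpl; exists X.
- exact: gelfand_vee.
- exact: gelfand_one.
- exact: gelfand_star.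
Qed.
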